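(* Let $\Gamma$ be an admissible directed graph with vertex partition $S=S_0\cup\dots\cup S_n$, and let $u^0<u^1<\dots<u^n$ be the associated real input values. Then $\Gamma$ has a planar realization: there exists a functional $V:\mathbb{R}^2\times\mathbb{R}\to\mathbb{R}$, $(\bm{x},u)\mapsto V(\bm{x},u)$, continuously differentiable in $\bm{x}$ and continuous with respect to $(\bm{x},u)$, such that the gradient system $\dot{\bm{x}}=-\nabla_x V(\bm{x},u)$, $\bm{x}\in\mathbb{R}^2$, is a realization of $\Gamma$.
   Context: **Admissible graph.** A finite directed graph $\Gamma$ is admissible if: (i) its vertex set $S$ is a union of $n+1$ (with $n\ge 1$) pairwise disjoint non-empty subsets $S_0,\dots,S_n$; (ii) for every $1\le i\le n-1$ and every $s\in S_i$ there are exactly two edges $ss'$ and $ss''$ emanating from $s$, with end points $s'\in S_{i-1}$ and $s''\in S_{i+1}$; and for every $s\in S_0\cup S_n$ there is exactly one edge $ss'$ emanating from $s$, with $s'\in S_1$ if $s\in S_0$ and $s'\in S_{n-1}$ if $s\in S_n$. The input of the system takes values in a finite set $U=\{u^0,\dots,u^n\}$, $u^0<u^1<\dots<u^n$; the vertices in $S_i$ are the possible states when the input equals $u^i$. Throughout, $V:\mathbb{R}^d\times\mathbb{R}\to\mathbb{R}$ is continuously differentiable in $\bm{x}$ and continuous in $(\bm{x},u)$. The gradient field for a fixed $u$ is $-\nabla_x V(\cdot,u)$. **One-step connection for increasing $u$.** Let $u_-<u_+$. Suppose $V(\cdot,u)$ has an isolated critical point $\bm{x}^*(u)$ for each $u\in[u_-,u_+]$,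 depending continuously on $u$; that $\bm{x}^*(u)$ is a local minimum point of $V(\cdot,u)$ for $u\in[u_-,u_+)$; and that $\bm{x}^*(u)$ undergoes a saddle-node bifurcation at $u=u_+$, i.e. $\bm{x}^*(u_+)$ is a saddle-node point of the field $-\nabla_x V(\cdot,u_+)$ and, for some $\rho,\delta>0$, the ball $|\bm{x}-\bm{x}^*(u_+)|<\rho$ contains no critical points of $V(\cdot,u)$ for $u\in(u_+,u_++\delta)$. Let $\bm{x}^{**}(u_+)$ be an isolated local minimum point of $V(\cdot,u_+)$. Then the local minimum point $\bm{x}^*(u_-)$ of $V(\cdot,u_-)$ connects in one step to the local minimum point $\bm{x}^{**}(u_+)$ of $V(\cdot,u_+)$ if the unstable manifold of the saddle-node equilibrium $\bm{x}^*(u_+)$ of the field $-\nabla_x V(\cdot,u_+)$ (the equilibrium $\bm{x}^*(u_+)$ itself excluded) belongs to the basin of attraction of the stable equilibrium $\bm{x}^{**}(u_+)$ of this field. **One-step connection for decreasing $u$.** This is defined similarly: a local minimum point $\bm{x}^*(u_+)$ of $V(\cdot,u_+)$ connects in one step to a local minimum point $\bm{x}^{**}(u_-)$ of $V(\cdot,u_-)$ if the continuous branch $\bm{x}^*(u)$, $u\in[u_-,u_+]$, of isolated critical points consists of local minimum points for $u\in(u_-,u_+]$, undergoes a saddle-node bifurcation at $u=u_-$ (with no critical points of $V(\cdot,u)$ in some ball around $\bm{x}^*(u_-)$ for $u\in(u_--\delta,u_-)$), and the unstable manifold of $\bm{x}^*(u_-)$ (without $\bm{x}^*(u_-)$ itself)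 belongs to the basin of attraction of the stable equilibrium, the isolated local minimum point $\bm{x}^{**}(u_-)$, of the field $-\nabla_x V(\cdot,u_-)$. **Connection.** Let $u_-=v_0<v_1<\dots<v_\ell=u_+$ ($\ell\ge1$) be a partition of $[u_-,u_+]$ and let $\bm{x}_k^*$ be a local minimum point of $V(\cdot,v_k)$, $k=0,\dots,\ell$. If, for every $k=1,\dots,\ell$, the point $\bm{x}_{k-1}^*$ connects in one step to $\bm{x}_k^*$ (for $u$ increasing from $v_{k-1}$ to $v_k$), then $\bm{x}_0^*$ connects to $\bm{x}_\ell^*$. Similarly, if for every $k=1,\dots,\ell$ the point $\bm{x}_k^*$ connects in one step to $\bm{x}_{k-1}^*$ (for $u$ decreasing from $v_k$ to $v_{k-1}$), then $\bm{x}_\ell^*$ connects to $\bm{x}_0^*$. A local minimum point of $V(\cdot,u_\mp)$ connects to a local minimum point of $V(\cdot,u_\pm)$ if such a partition and such intermediate local minimum points exist (the case $\ell=1$ being the one-step connection). **Realization.** The gradient system $\dot{\bm{x}}=-\nabla_x V(\bm{x},u)$, $\bm{x}\in\mathbb{R}^d$, is a realization of an admissible graph $\Gamma$ if: (i) $\lim_{|\bm{x}|\to\infty}V(\bm{x},u)=\infty$ for each $u\in[u^0,u^n]$; (ii) for every $i=0,\dots,n$ the set of local minimum points of $V(\cdot,u^i)$ is in one-to-one correspondence $\bm{x}^*=X_i(s)$ with the set $S_i\ni s$; (iii) for $\sigma=\pm1$ (and $0\le i,\,i+\sigma\le n$), a local minimum point $\bm{x}^*$ of $V(\cdot,u^i)$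 connects to a local minimum point $\bm{x}^{**}$ of $V(\cdot,u^{i+\sigma})$ if and only if there is an edge $s's''$ of $\Gamma$ with $\bm{x}^*=X_i(s')$ and $\bm{x}^{**}=X_{i+\sigma}(s'')$. The realization is planar if $d=2$. *)

(* Defs.v *)
From HB Require Import structures.
From mathcomp Require Export all_boot all_order all_algebra.
From mathcomp Require Export all_classical all_reals all_analysis.

Set Implicit Arguments.
Unset Strict Implicit.
Unset Printing Implicit Defensive.

Export Order.TTheory GRing.Theory Num.Theory.
Export numFieldNormedType.Exports.

Local Open Scope classical_set_scope.
Local Open Scope ring_scope.

(* All possible edges join two classes [S i], [S j] with [i] and [j]
   consecutive, and a vertex emits at most one edge into each class, so there
   are no parallel edges and the digraph is given by a relation. *)
Definition admissible (T : finType) (e : rel T) (n : nat)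
    (S : 'I_n.+1 -> {set T}) : Prop :=
  [/\ (1 <= n)%N,
      [/\ (\bigcup_i S i = [set: T])%SET,
          forall i j, i != j -> (S i :&: S j = finset.set0)%SET
        & forall i, S i != finset.set0],
      forall (i j k : 'I_n.+1), i = j.+1 :> nat -> k = i.+1 :> nat ->
        forall s, s \in S i -> exists s' s'',
          [/\ s' \in S j, s'' \in S k
            & [set t | e s t]%SET = [set s'; s'']%SET],
      forall (i j : 'I_n.+1), i = 0%N :> nat -> j = 1%N :> nat ->
        forall s, s \in S i -> exists2 s',
          s' \in S j & [set t | e s t]%SET = [set s']%SET
    & forall (i j : 'I_n.+1), i = n :> nat -> j = n.-1 :> nat ->
        forall s, s \in S i -> exists2 s',
          s' \in S j & [set t | e s t]%SET = [set s']%SET].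

Section Calculus.
Context {R : realType} {d : nat}.
Implicit Types (f : 'rV[R]_d -> R) (F : 'rV[R]_d -> 'rV[R]_d).

Definition C1_on {W : normedModType R} (A : set 'rV[R]_d)
    (g : 'rV[R]_d -> W) : Prop :=
  forall x, A x ->
    differentiable g x /\ forall v, {for x, continuous ('D_v g)}.

Definition C2_on {W : normedModType R} (A : set 'rV[R]_d)
    (g : 'rV[R]_d -> W) : Prop :=
  C1_on A g /\ forall v, C1_on A ('D_v g).

Definition grad f : 'rV[R]_d -> 'rV[R]_d :=
  fun x => \row_i 'D_(delta_mx 0 i) f x.

Definition critical_points f : set 'rV[R]_d := [set x | grad f x = 0].

Definition local_minima f : set 'rV[R]_d :=
  [set x | \forall y \near x, f x <= f y].

(* Continuity up to the end points of [I] together with the equation in its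
   interior gives the one-sided equation at the end points when [F] is
   continuous. *)
Definition solution_on (I : set R) F (x : R -> 'rV[R]_d) : Prop :=
  {within I, continuous x} /\
  forall t, interior I t -> is_derive t (1 : R) x (F (x t)).

Definition unstable_manifold F (p : 'rV[R]_d) : set 'rV[R]_d :=
  [set q | exists x, [/\ solution_on `]-oo, 0%R] F x, x 0 = q
                       & x t @[t --> -oo] --> p]].

(* [F] is only assumed continuous, so forward solutions need not be unique:
   all of them are required to converge. *)
Definition basin F (p : 'rV[R]_d) : set 'rV[R]_d :=
  [set q | (exists x, solution_on `[0%R, +oo[ F x /\ x 0 = q) /\
           forall x, solution_on `[0%R, +oo[ F x -> x 0 = q ->
             x t @[t --> +oo] --> p].

(* Row vectors: [v *m 'J F p] is the derivative of [F] at [p] along [v].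
   The standard definition also excludes nonzero eigenvalues on the imaginary
   axis; below [F] is a gradient field, whose Jacobian is symmetric, so that
   condition is void. *)
Definition saddle_node F (p : 'rV[R]_d) : Prop :=
  [/\ exists2 A, open_nbhs p A & C2_on A F,
      F p = 0,
      mup 0 (char_poly ('J F p)) = 1%N
    & exists v w : 'rV[R]_d,
        [/\ v != 0 /\ v *m 'J F p = 0,
            w != 0 /\ 'J F p *m w^T = 0
          & 'D_v ('D_v F) p *m w^T != 0]].

End Calculus.

Section Connections.
Context {R : realType} {d : nat}.
Variable V : 'rV[R]_d -> R -> R.
Implicit Types (um up : R) (p q : 'rV[R]_d).

Definition field (u : R) : 'rV[R]_d -> 'rV[R]_d := fun x => - grad (V^~ u) x.

Definition regular_potential : Prop :=
  (forall u, C1_on setT (V^~ u)) /\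
  continuous (fun z : 'rV[R]_d * R => V z.1 z.2).

Definition escapes_to (u : R) p q : Prop :=
  [/\ saddle_node (field u) p,
      isolated (local_minima (V^~ u)) q
    & unstable_manifold (field u) p `\ p `<=` basin (field u) q].

Definition critical_branch um up (xs : R -> 'rV[R]_d) : Prop :=
  {within `[um, up], continuous xs} /\
  forall u, um <= u <= up -> isolated (critical_points (V^~ u)) (xs u).

Definition connects1_up um up p q : Prop :=
  um < up /\ exists xs : R -> 'rV[R]_d,
    [/\ critical_branch um up xs,
        xs um = p,
        forall u, um <= u < up -> local_minima (V^~ u) (xs u),
        exists rho delta : R, [/\ 0 < rho, 0 < delta
          & forall u x, up < u < up + delta -> `|x - xs up| < rho ->
              ~ critical_points (V^~ u) x]
      & escapes_to up (xs up) q].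

Definition connects1_down um up p q : Prop :=
  um < up /\ exists xs : R -> 'rV[R]_d,
    [/\ critical_branch um up xs,
        xs up = p,
        forall u, um < u <= up -> local_minima (V^~ u) (xs u),
        exists rho delta : R, [/\ 0 < rho, 0 < delta
          & forall u x, um - delta < u < um -> `|x - xs um| < rho ->
              ~ critical_points (V^~ u) x]
      & escapes_to um (xs um) q].

Definition chain um up (l : nat) (v : nat -> R) (xs : nat -> 'rV[R]_d) :
    Prop :=
  [/\ (1 <= l)%N, v 0%N = um, v l = up,
      forall k, (k < l)%N -> v k < v k.+1
    & forall k, (k <= l)%N -> local_minima (V^~ (v k)) (xs k)].

Definition connects_up um up p q : Prop :=
  exists l v xs, [/\ chain um up l v xs, xs 0%N = p, xs l = q
    & forall k, (k < l)%N ->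
        connects1_up (v k) (v k.+1) (xs k) (xs k.+1)].

Definition connects_down um up p q : Prop :=
  exists l v xs, [/\ chain um up l v xs, xs l = p, xs 0%N = q
    & forall k, (k < l)%N ->
        connects1_down (v k) (v k.+1) (xs k.+1) (xs k)].

Definition realization (T : finType) (e : rel T) (n : nat)
    (S : 'I_n.+1 -> {set T}) (u : 'I_n.+1 -> R) : Prop :=
  (forall c, u ord0 <= c <= u ord_max ->
     forall M, exists r, forall x, r < `|x| -> M < V x c) /\
  exists X : 'I_n.+1 -> T -> 'rV[R]_d,
    (forall i, set_bij [set` S i] (local_minima (V^~ (u i))) (X i)) /\
    forall i j : 'I_n.+1, j = i.+1 :> nat ->
      forall p q, local_minima (V^~ (u i)) p -> local_minima (V^~ (u j)) q ->
      (connects_up (u i) (u j) p q <->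
         exists s' s'', [/\ s' \in S i, s'' \in S j, e s' s'',
                            p = X i s' & q = X j s'']) /\
      (connects_down (u i) (u j) q p <->
         exists s' s'', [/\ s' \in S j, s'' \in S i, e s' s'',
                            q = X j s' & p = X i s'']).

End Connections.

(* Main.v *)
From HB Require Import structures.
Require Import Defs.
From mathcomp Require Import ring lra zify.

Set Implicit Arguments.
Unset Strict Implicit.
Unset Printing Implicit Defensive.

Local Open Scope classical_set_scope.
Local Open Scope ring_scope.

(** Every vertex becomes a point of the plane that moves continuously with the
input, and the potential is built around these points.

The potential of one input value ([Lev]). For the N vertices of a class, take N
quadratic wells with bottoms on a line, at distance [L] from each other. In the
disc of squared radius 2 around a bottom the potential is [profile]: with
rho = r^2 its slope in rho is (1 - rho)^2 plus a contribution of a polynomial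
[crest], which is nonnegative and vanishes exactly on finitely many lines through
the bottom, one of direction [e t] for each vertex [t] of the whole graph. Hence the radial slope is positive away from the bottom
except at the points of the unit circle on those lines. There the field is that
of r' = - 2 r (1 - r^2)^2 along the line and contracts across it: these points
are saddle-nodes ([Lev_saddle_node]) whose unstable manifold is a part of the
line that flows to the bottom ([unstable_ray], [ray_basin]), so any number of
vertices can fold into the same well. The local minima are exactly the bottoms
([well_local_min], [local_min_well]). At the i-th input value a vertex of the
i-th class sits at the bottom of its well; a vertex [s] of a neighbouring class
sits at m + e s, where m is the bottom of the well of the unique out-neighbour of
[s] in the i-th class.

Between two input values ([blend]). The potential of the first value is
deformed into the product [wells] of the squared distances to moving points, one
for each vertex of the two classes, and this product into the potential of the
second value. The points travel without colliding ([path_sep]). At a point of the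
family the slope of the product is at least a fixed multiple of the squared
distance ([wells_stiff]), while at a bottom or a saddle-node the slope of the two
fixed potentials is at worst an arbitrarily small negative multiple of it
([profile_flat]); so the moving point of [s] is a strict minimum until the fold
([funnel_up], [funnel_down]). Beyond the fold [s] is no longer one of the moving
points; the product increases radially at m + e s, where one moves away from all
points in the same well and the others are too far to matter, and it destroys
the critical point ([fold_killed]). This is a saddle-node bifurcation, and each
edge is realized by one step. The classes are extended by empty ones on both
sides, for the folds at the first and at the last input value also have to be
destroyed beyond it.

No other connections arise. The moving minimum is locally the only critical
point ([rigid]), so by connectedness any branch that starts at it coincides with it
([branch_unique]); such a branch cannot fold earlier, because the critical point
persists ([no_inner_fold]), and at the end the limit of an
orbit of the unstable manifold is unique ([connects_up_branch_unique],
[connects_down_branch_unique]). *)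

(** * Calculus on row vectors *)

Section PointwiseContinuity.
Context {R : realType} {T : topologicalType}.
Implicit Types f g : T -> R.

Lemma contD f g : continuous f -> continuous g -> continuous (fun x => f x + g x).
Proof. by move=> fc gc x; exact: (@cvgD _ _ _ (nbhs x) _ f g _ _ (fc x) (gc x)). Qed.

Lemma contM f g : continuous f -> continuous g -> continuous (fun x => f x * g x).
Proof. by move=> fc gc x; exact: (@cvgM _ _ (nbhs x) _ f g _ _ (fc x) (gc x)). Qed.

Lemma cont_cst (c : R) : continuous (fun _ : T => c).
Proof. exact: cst_continuous. Qed.

Lemma contN f : continuous f -> continuous (fun x => - f x).
Proof. by move=> fc x; exact: (@cvgN _ _ _ (nbhs x) _ f _ (fc x)). Qed.

Lemma contB f g : continuous f -> continuous g -> continuous (fun x => f x - g x).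
Proof. by move=> fc gc; apply: contD => //; exact: contN. Qed.

Lemma contX f n : continuous f -> continuous (fun x => f x ^+ n).
Proof.
move=> fc; elim: n => [|n IH].
  by under eq_fun do rewrite expr0; exact: cont_cst.
by under eq_fun do rewrite exprS; exact: contM.
Qed.

Lemma cont_sum (I : Type) (r : seq I) (Q : pred I) (F : I -> T -> R) :
  (forall i, continuous (F i)) -> continuous (fun z => \sum_(i <- r | Q i) F i z).
Proof.
move=> FC; elim: r => [|i r IH].
  by under eq_fun do rewrite big_nil; exact: cont_cst.
under eq_fun do rewrite big_cons.
by case: (Q i) => //; exact: contD.
Qed.

Lemma cont_prod (I : Type) (r : seq I) (Q : pred I) (F : I -> T -> R) :
  (forall i, continuous (F i)) -> continuous (fun z => \prod_(i <- r | Q i) F i z).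
Proof.
move=> FC; elim: r => [|i r IH].
  by under eq_fun do rewrite big_nil; exact: cont_cst.
under eq_fun do rewrite big_cons.
by case: (Q i) => //; exact: contM.
Qed.

Lemma cont_comp {U : topologicalType} (h : R -> U) f :
  continuous h -> continuous f -> continuous (fun x => h (f x)).
Proof. by move=> hc fc x; apply: (@continuous_comp _ _ _ f h); [exact: fc|exact: hc]. Qed.

Lemma cont_lt f z (a : R) : continuous f -> f z < a -> \forall x \near z, f x < a.
Proof. by move=> fc h; apply: (cvgr_lt _ (fc z)). Qed.

Lemma cont_gt f z (a : R) : continuous f -> a < f z -> \forall x \near z, a < f x.
Proof. by move=> fc h; apply: (cvgr_gt _ (fc z)). Qed.

End PointwiseContinuity.

Section DirectionalRules.
Context {R : realType} {V : normedModType R}.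
Implicit Types (f g : V -> R) (z v : V).

Lemma is_derive_pD f g z v (a b : R) : is_derive z v f a -> is_derive z v g b ->
  is_derive z v (fun x => f x + g x) (a + b).
Proof. by move=> ? ?; exact: is_deriveD. Qed.

Lemma is_derive_pN f z v (a : R) : is_derive z v f a ->
  is_derive z v (fun x => - f x) (- a).
Proof. by move=> ?; exact: is_deriveN. Qed.

Lemma is_derive_pB f g z v (a b : R) : is_derive z v f a -> is_derive z v g b ->
  is_derive z v (fun x => f x - g x) (a - b).
Proof. by move=> ? ?; exact: is_deriveB. Qed.

Lemma is_derive_pM f g z v (a b : R) : is_derive z v f a -> is_derive z v g b ->
  is_derive z v (fun x => f x * g x) (f z * b + g z * a).
Proof.
by move=> fa gb; exact: (@is_deriveM _ _ f g z v a b fa gb).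
Qed.

Lemma is_derive_pX f n z v (a : R) : is_derive z v f a ->
  is_derive z v (fun x => f x ^+ n.+1) (n.+1%:R * f z ^+ n * a).
Proof.
move=> fa; have -> : (fun x => f x ^+ n.+1) = f ^+ n.+1.
  by apply/funext => x; rewrite fctE.
exact: (@is_deriveX _ _ f n.+1 z v a fa).
Qed.

Lemma is_derive_pcst (c : R) z v : is_derive z v (fun=> c) 0.
Proof. exact: is_derive_cst. Qed.

Lemma is_derive_psum (I : Type) (r : seq I) (Q : pred I) (F : I -> V -> R) (a : I -> R) z v :
  (forall i, is_derive z v (F i) (a i)) ->
  is_derive z v (fun x => \sum_(i <- r | Q i) F i x) (\sum_(i <- r | Q i) a i).
Proof.
move=> Fa; elim: r => [|i r IH].
  rewrite big_nil; under eq_fun do rewrite big_nil.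
  exact: is_derive_pcst.
rewrite big_cons; under eq_fun do rewrite big_cons.
by case: (Q i) => //; exact: is_derive_pD.
Qed.

Lemma is_derive_pcomp (h : R -> R) f z v (a b : R) :
  is_derive (f z) 1 h a -> differentiable f z -> is_derive z v f b ->
  is_derive z v (fun x => h (f x)) (a * b).
Proof.
move=> ha fz fb.
have dh : differentiable h (f z) by apply/derivable1_diffP; apply: ex_derive.
have dhf : differentiable (h \o f) z by exact: differentiable_comp.
apply: DeriveDef; first exact: diff_derivable.
rewrite (deriveE _ dhf) diff_comp//= -(deriveE _ fz) derive_val.
by rewrite diff1E// derive1E derive_val mulrC.
Qed.

End DirectionalRules.

(** Locked because the trivial-goal tactics would otherwise unfold it down to
the definition of differentiability. *)
HB.lock Definition C1 (R : realType) (d : nat) (f : 'rV[R]_d -> R) : Prop :=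
  C1_on setT f.
Arguments C1 {R d} f.

Section C1Rules.
Context {R : realType} {d : nat}.
Notation P := 'rV[R]_d.
Implicit Types (f g : P -> R) (z v : P).

Lemma C1E f : C1 f = C1_on setT f.
Proof. by rewrite C1.unlock. Qed.

Lemma C1_diff f z : C1 f -> differentiable f z.
Proof. by rewrite C1E => /(_ z I)[]. Qed.

Lemma C1_cont f v : C1 f -> continuous ('D_v f).
Proof. by rewrite C1E => fC z; have [_ /(_ v)] := fC z I. Qed.

Lemma C1_continuous f : C1 f -> continuous f.
Proof. by move=> fC z; apply: differentiable_continuous; exact: C1_diff. Qed.

Lemma C1_is_derive f z v : C1 f -> is_derive z v f ('D_v f z).
Proof. by move=> fC; apply/derivableP/diff_derivable/C1_diff. Qed.

Lemma C1_intro f (df : P -> P -> R) :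
  (forall z, differentiable f z) ->
  (forall z v, is_derive z v f (df v z)) ->
  (forall v, continuous (df v)) -> C1 f.
Proof.
move=> fd dfE dfc; rewrite C1E => z _; split => // v.
suff -> : 'D_v f = df v by exact: dfc.
by apply/funext => y; apply: derive_val.
Qed.

Lemma C1_cst (c : R) : C1 (fun _ : P => c).
Proof.
by apply: (C1_intro (df := fun _ _ => 0)) => [z|v];
  [exact: differentiable_cst | exact: cst_continuous].
Qed.

Lemma C1D f g : C1 f -> C1 g -> C1 (fun z => f z + g z).
Proof.
move=> fC gC; apply: (C1_intro (df := fun v z => 'D_v f z + 'D_v g z)).
- by move=> z; apply: differentiableD; exact: C1_diff.
- by move=> z v; apply: is_derive_pD; exact: C1_is_derive.
- by move=> v; apply: contD; exact: C1_cont.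
Qed.

Lemma C1M f g : C1 f -> C1 g -> C1 (fun z => f z * g z).
Proof.
move=> fC gC; apply: (C1_intro (df := fun v z => f z * 'D_v g z + g z * 'D_v f z)).
- by move=> z; apply: differentiableM; exact: C1_diff.
- by move=> z v; apply: is_derive_pM; exact: C1_is_derive.
- by move=> v; apply: contD; apply: contM; by [exact: C1_cont|exact: C1_continuous].
Qed.

Lemma C1N f : C1 f -> C1 (fun z => - f z).
Proof.
move=> fC; have := C1M (C1_cst (-1)) fC.
by under eq_fun do rewrite mulN1r.
Qed.

Lemma C1B f g : C1 f -> C1 g -> C1 (fun z => f z - g z).
Proof. by move=> fC gC; apply: C1D => //; exact: C1N. Qed.

Lemma C1X f n : C1 f -> C1 (fun z => f z ^+ n).
Proof.
move=> fC; elim: n => [|n IH]; first by under eq_fun do rewrite expr0; exact: C1_cst.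
by under eq_fun do rewrite exprS; exact: C1M.
Qed.

Lemma C1_sum (I : Type) (r : seq I) (Q : pred I) (F : I -> P -> R) :
  (forall i, C1 (F i)) -> C1 (fun z => \sum_(i <- r | Q i) F i z).
Proof.
move=> FC; elim: r => [|i r IH].
  by under eq_fun do rewrite big_nil; exact: C1_cst.
under eq_fun do rewrite big_cons.
by case: (Q i) => //; exact: C1D.
Qed.

Lemma C1_prod (I : Type) (r : seq I) (Q : pred I) (F : I -> P -> R) :
  (forall i, C1 (F i)) -> C1 (fun z => \prod_(i <- r | Q i) F i z).
Proof.
move=> FC; elim: r => [|i r IH].
  by under eq_fun do rewrite big_nil; exact: C1_cst.
under eq_fun do rewrite big_cons.
by case: (Q i) => //; exact: C1M.
Qed.

Lemma C1_comp (h h' : R -> R) f :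
  (forall t : R, is_derive t (1 : R) h (h' t)) -> continuous h' -> C1 f ->
  C1 (fun z => h (f z)).
Proof.
move=> hd hc fC; apply: (C1_intro (df := fun v z => h' (f z) * 'D_v f z)).
- move=> z; apply: (@differentiable_comp _ _ _ _ f h); first exact: C1_diff.
  by apply/derivable1_diffP; apply: ex_derive.
- move=> z v; exact: (@is_derive_pcomp _ _ h f z v _ _ (hd (f z)) (C1_diff z fC) (C1_is_derive z v fC)).
- move=> v; apply: contM; last exact: C1_cont.
  by apply: cont_comp => //; exact: C1_continuous.
Qed.

Lemma is_derive_coord (j : 'I_d) z v : is_derive z v (fun z => z 0 j) (v 0 j).
Proof.
apply: DeriveDef; first exact/diff_derivable/differentiable_coord.
have := @derive_mx R P 1 d id z v (@derivable_id R P z v).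
by rewrite derive_id => /rowP/(_ j); rewrite !mxE => ->.
Qed.

Lemma C1_coord (j : 'I_d) : C1 (fun z => z 0 j).
Proof.
apply: (C1_intro (df := fun v z => v 0 j)).
- by move=> z; exact: differentiable_coord.
- by move=> z v; exact: is_derive_coord.
- by move=> v; exact: cst_continuous.
Qed.

Lemma derive_lin f z (a b : R) v w : C1 f ->
  'D_(a *: v + b *: w) f z = a * 'D_v f z + b * 'D_w f z.
Proof.
move=> fC; have fd := C1_diff z fC.
by rewrite !deriveE// linearD !linearZ.
Qed.

Lemma C1_deriveD f g z v : C1 f -> C1 g ->
  'D_v (fun x => f x + g x) z = 'D_v f z + 'D_v g z.
Proof.
by move=> fC gC; apply: derive_val; apply: is_derive_pD; exact: C1_is_derive.
Qed.

Lemma C1_deriveM f g z v : C1 f -> C1 g ->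
  'D_v (fun x => f x * g x) z = f z * 'D_v g z + g z * 'D_v f z.
Proof.
by move=> fC gC; apply: derive_val; apply: is_derive_pM; exact: C1_is_derive.
Qed.

Lemma C1_deriveZ f (c : R) z v : C1 f -> 'D_v (fun x => c * f x) z = c * 'D_v f z.
Proof.
by move=> fC; rewrite C1_deriveM//; [rewrite derive_cst mulr0 addr0|exact: C1_cst].
Qed.

Lemma is_derive_along f (x : R -> P) t w : differentiable f (x t) ->
  is_derive t (1 : R) x w -> is_derive t (1 : R) (fun s => f (x s)) ('D_w f (x t)).
Proof.
move=> fd xw.
have dx : differentiable x t by apply/derivable1_diffP; apply: ex_derive.
have dfx : differentiable (f \o x) t by exact: differentiable_comp.
apply: DeriveDef; first exact: diff_derivable.
rewrite (deriveE _ dfx) diff_comp//= -(deriveE _ dx) derive_val.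
by rewrite deriveE.
Qed.

Lemma is_derive_row (x : R -> P) t w :
  is_derive t (1 : R) x w <-> forall j, is_derive t (1 : R) (fun s => x s 0 j) (w 0 j).
Proof.
split=> [xw j|xw].
  have -> : w 0 j = 'D_w (fun z : P => z 0 j) (x t).
    by have [_ ->] := is_derive_coord j (x t) w.
  by apply: is_derive_along => //; exact: differentiable_coord.
have dx : derivable x t 1.
  by apply/derivable_mxP => i j; rewrite (ord1 i); have [] := xw j.
apply: DeriveDef => //; rewrite derive_mx//; apply/rowP => j; rewrite mxE.
by have [_ ->] := xw j.
Qed.

Lemma is_derive_line (z w : P) t : is_derive t (1 : R) (fun s : R => z + s *: w) w.
Proof.
apply/is_derive_row => j.
have -> : (fun s : R => (z + s *: w) 0 j) = (fun s => z 0 j + s * w 0 j).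
  by apply/funext => s; rewrite !mxE.
have H := is_derive_pD (is_derive_pcst (z 0 j) t 1)
  (is_derive_pM (is_derive_id t (1 : R)) (is_derive_pcst (w 0 j) t 1)).
by apply: is_derive_eq H _; rewrite mulr0 mulr1 !add0r.
Qed.

Lemma line_continuous (z w : P) : continuous (fun s : R => z + s *: w).
Proof.
move=> t; apply: differentiable_continuous.
by apply/derivable1_diffP; have [] := is_derive_line z w t.
Qed.

Lemma is_derive_on_line f (z w : P) (t : R) : C1 f ->
  is_derive t (1 : R) (fun s => f (z + s *: w)) ('D_w f (z + t *: w)).
Proof.
move=> fC; apply: is_derive_along; [exact: C1_diff | exact: is_derive_line].
Qed.

Lemma line_MVT f z w (l : R) : C1 f -> 0 < l ->
  exists2 c, 0 < c < l & f (z + l *: w) - f z = 'D_w f (z + c *: w) * l.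
Proof.
move=> fC l0.
have [|c] := @MVT R (fun s : R => f (z + s *: w)) (fun s => 'D_w f (z + s *: w)) 0 l l0
    (fun s _ => is_derive_on_line z w s fC).
  apply: derivable_within_continuous => s _.
  by have [] := is_derive_on_line z w s fC.
rewrite in_itv /= scale0r addr0 subr0 => cl E; by exists c.
Qed.

(** The derivative at [z] itself may vanish: this excludes local minima at
saddle-nodes and on ridges, which are critical points. *)
Lemma not_min_of_descent f z w (e : R) : C1 f -> 0 < e ->
  (forall l, 0 < l < e -> 'D_w f (z + l *: w) < 0) -> ~ local_minima f z.
Proof.
move=> fC e0 desc zmin.
have : \forall l \near (0 : R), f z <= f (z + l *: w).
  have := @line_continuous z w 0; rewrite /continuous_at scale0r addr0 => H.
  exact: H zmin.
move=> /nbhs_ballP[r /= r0 rball].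
pose l := Order.min e r / 2.
have m0 : 0 < Order.min e r by rewrite lt_min e0.
have me : Order.min e r <= e by rewrite ge_min lexx.
have mr : Order.min e r <= r by rewrite ge_min lexx orbT.
have l0 : 0 < l by rewrite divr_gt0.
have le : l < e by rewrite /l; lra.
have ld : l < r by rewrite /l; lra.
have := rball l; rewrite /ball/= sub0r normrN gtr0_norm// => /(_ ld) h.
have [c /andP[c0 cl] E] := line_MVT z w fC l0.
have := desc c; rewrite c0 (lt_trans cl)// => /(_ isT) Dneg.
by move: h; rewrite -subr_ge0 E leNgt => /negP; apply; rewrite pmulr_llt0.
Qed.

Lemma derive_near0 f z v : C1 f -> 'D_v f z < 0 ->
  exists2 e : R, 0 < e & forall l, 0 < l < e -> 'D_v f (z + l *: v) < 0.
Proof.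
move=> fC neg.
have H : {for 0, continuous (fun l : R => 'D_v f (z + l *: v))}.
  apply: (@continuous_comp _ _ _ (fun s : R => z + s *: v) ('D_v f)).
    exact: line_continuous.
  exact: C1_cont.
have : \forall l \near (0 : R), 'D_v f (z + l *: v) < 0.
  have E : 'D_v f (z + 0 *: v) = 'D_v f z by rewrite scale0r addr0.
  by apply: (cvgr_lt _ H); rewrite E.
move=> /nbhs_ballP[r /= r0 rball]; exists r => // l /andP[l0 ld].
by apply: rball; rewrite /ball/= sub0r normrN gtr0_norm.
Qed.

Lemma local_min_derive0 f z v : C1 f -> local_minima f z -> 'D_v f z = 0.
Proof.
move=> fC zmin.
suff H w : 0 <= 'D_w f z.
  apply/eqP; rewrite eq_le H andbT.
  have := H (- v); have -> : - v = (-1) *: v + 0 *: v by rewrite scale0r addr0 scaleN1r.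
  by rewrite derive_lin// mul0r addr0 mulN1r oppr_ge0.
rewrite leNgt; apply/negP => /(derive_near0 fC)[e e0 h].
exact: (not_min_of_descent fC e0 h).
Qed.

Lemma grad_dir f z (j : 'I_d) : grad f z 0 j = 'D_(delta_mx 0 j) f z.
Proof. by rewrite mxE. Qed.

Lemma critical_dir f z : C1 f -> critical_points f z <-> forall v, 'D_v f z = 0.
Proof.
move=> fC; split=> [/rowP z0 v|H]; last by apply/rowP => j; rewrite grad_dir H mxE.
rewrite (deriveE _ (C1_diff z fC)) (row_sum_delta v) linear_sum big1// => j _.
rewrite linearZ/= -(deriveE _ (C1_diff z fC)).
by have := z0 j; rewrite grad_dir mxE => ->; rewrite scaler0.
Qed.

Lemma local_min_critical f z : C1 f -> local_minima f z -> critical_points f z.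
Proof. by move=> fC zmin; apply/critical_dir => // v; exact: local_min_derive0. Qed.

End C1Rules.

(** * The Euclidean plane *)

Section Plane.
Context {R : realType}.
Notation P := 'rV[R]_2.
Implicit Types (u v w z : P).

Definition dot u v : R := u 0 0 * v 0 0 + u 0 1 * v 0 1.
Definition sq v : R := dot v v.
Definition pt (x y : R) : P := \row_j (if j == 0 then x else y).
Definition rot v : P := pt (- v 0 1) (v 0 0).

Lemma pt0 x y : pt x y 0 0 = x. Proof. by rewrite mxE. Qed.
Lemma pt1 x y : pt x y 0 1 = y. Proof. by rewrite mxE. Qed.

Lemma ord2 (j : 'I_2) : j = 0 \/ j = 1.
Proof. by case: j => [[|[|j]] hj] //; [left|right]; apply/val_inj. Qed.

Lemma planeP u v : u 0 0 = v 0 0 -> u 0 1 = v 0 1 -> u = v.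
Proof. by move=> h0 h1; apply/rowP => j; case: (ord2 j) => ->. Qed.

Lemma dotC u v : dot u v = dot v u.
Proof. by rewrite /dot; ring. Qed.
Lemma dotBr u v w : dot u (v - w) = dot u v - dot u w.
Proof. by rewrite /dot !mxE; ring. Qed.
Lemma dotZr u (a : R) v : dot u (a *: v) = a * dot u v.
Proof. by rewrite /dot !mxE; ring. Qed.
Lemma dotDl u v w : dot (v + w) u = dot v u + dot w u.
Proof. by rewrite /dot !mxE; ring. Qed.
Lemma dot0r u : dot u 0 = 0.
Proof. by rewrite /dot !mxE; ring. Qed.

Lemma sqE v : sq v = v 0 0 ^+ 2 + v 0 1 ^+ 2.
Proof. by rewrite /sq /dot; ring. Qed.
Lemma sq_ge0 v : 0 <= sq v.
Proof. by rewrite sqE addr_ge0 ?sqr_ge0. Qed.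
Lemma sq0 : sq 0 = 0.
Proof. by rewrite /sq dot0r. Qed.
Lemma sq_eq0 v : (sq v == 0) = (v == 0).
Proof.
apply/eqP/eqP => [|->]; last exact: sq0.
rewrite sqE => /eqP; rewrite paddr_eq0 ?sqr_ge0// !sqrf_eq0 => /andP[/eqP h0 /eqP h1].
by apply: planeP; rewrite !mxE.
Qed.
Lemma sq_gt0 v : (0 < sq v) = (v != 0).
Proof. by rewrite lt_neqAle eq_sym sq_eq0 sq_ge0 andbT. Qed.
Lemma sqZ (a : R) v : sq (a *: v) = a ^+ 2 * sq v.
Proof. by rewrite !sqE !mxE; ring. Qed.
Lemma sqN v : sq (- v) = sq v.
Proof. by rewrite !sqE !mxE; ring. Qed.
Lemma sqBC u v : sq (u - v) = sq (v - u).
Proof. by rewrite -sqN opprB. Qed.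
Lemma sqD u v : sq (u + v) = sq u + 2 * dot u v + sq v.
Proof. by rewrite !sqE /dot !mxE; ring. Qed.
Lemma sqB u v : sq (u - v) = sq u - 2 * dot u v + sq v.
Proof. by rewrite !sqE /dot !mxE; ring. Qed.
Lemma sq_rot v : sq (rot v) = sq v.
Proof. by rewrite !sqE pt0 pt1; ring. Qed.
Lemma dot_rot v : dot (rot v) v = 0.
Proof. by rewrite /dot pt0 pt1; ring. Qed.
Lemma dot_sqr u v : dot u v ^+ 2 + dot (rot u) v ^+ 2 = sq u * sq v.
Proof. by rewrite !sqE /dot pt0 pt1; ring. Qed.
Lemma CauchyS u v : dot u v ^+ 2 <= sq u * sq v.
Proof. by rewrite -dot_sqr lerDl sqr_ge0. Qed.
Lemma frame u v : sq u = 1 -> v = dot u v *: u + dot (rot u) v *: rot u.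
Proof.
rewrite sqE => u1; apply: planeP; rewrite !mxE/= /dot pt0 pt1.
  rewrite -[LHS]mulr1 -u1; ring.
by rewrite -[LHS]mulr1 -u1; ring.
Qed.

Lemma dot_delta u (j : 'I_2) : dot u (delta_mx 0 j) = u 0 j.
Proof. by rewrite /dot !mxE; case: (ord2 j) => -> /=; ring. Qed.

Lemma mul_row_tr u v : u *m v^T = (dot u v)%:M.
Proof.
apply/matrixP => i j; rewrite !mxE !big_ord_recl big_ord0 !mxE (ord1 i) (ord1 j) /dot.
have -> : lift ord0 ord0 = 1 :> 'I_2 by apply/val_inj.
by rewrite addr0.
Qed.

Lemma C1_dot u : C1 (dot u).
Proof. by apply: C1D; (apply: C1M; [exact: C1_cst | exact: C1_coord]). Qed.

Lemma is_derive_dot u z v : is_derive z v (dot u) (dot u v).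
Proof.
have H := is_derive_pD
  (is_derive_pM (is_derive_pcst (u 0 0) z v) (is_derive_coord 0 z v))
  (is_derive_pM (is_derive_pcst (u 0 1) z v) (is_derive_coord 1 z v)).
by apply: is_derive_eq H _; rewrite !mulr0 !addr0.
Qed.

Lemma C1_sq : C1 sq.
Proof. by apply: C1D; (apply: C1M; exact: C1_coord). Qed.

Lemma is_derive_sq z v : is_derive z v sq (2 * dot z v).
Proof.
have H := is_derive_pD
  (is_derive_pM (is_derive_coord 0 z v) (is_derive_coord 0 z v))
  (is_derive_pM (is_derive_coord 1 z v) (is_derive_coord 1 z v)).
by apply: is_derive_eq H _; rewrite /dot; ring.
Qed.

Lemma is_derive_trans (f : P -> R) c z v (a : R) :
  is_derive (z - c) v f a -> is_derive z v (fun x => f (x - c)) a.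
Proof.
move=> [fd fv].
have E : (fun h : R => h^-1 *: (((fun x => f (x - c)) \o shift z) (h *: v) - f (z - c)))
       = (fun h => h^-1 *: ((f \o shift (z - c)) (h *: v) - f (z - c))).
  by apply/funext => h /=; rewrite addrA.
by apply: DeriveDef; rewrite /derivable /derive E.
Qed.

Lemma C1_trans (f : P -> R) c : C1 f -> C1 (fun x => f (x - c)).
Proof.
move=> fC.
have sc : continuous (fun x : P => x - c).
  by move=> x; apply: differentiable_continuous.
apply: (C1_intro (df := fun v z => 'D_v f (z - c))).
- move=> z; apply: (@differentiable_comp _ _ _ _ (fun x : P => x - c) f); last exact: C1_diff.
  by [].
- by move=> z v; apply: is_derive_trans; exact: C1_is_derive.
- move=> v z; apply: (@continuous_comp _ _ _ (fun x : P => x - c) ('D_v f)); first exact: sc.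
  exact: C1_cont.
Qed.

Lemma derive_trans (f : P -> R) c z v : C1 f -> 'D_v (fun x => f (x - c)) z = 'D_v f (z - c).
Proof. by move=> fC; apply: derive_val; apply: is_derive_trans; exact: C1_is_derive. Qed.

Lemma sq_cont : continuous sq.
Proof. exact: C1_continuous C1_sq. Qed.

Lemma near_disc z c (r : R) : sq (z - c) < r -> \forall x \near z, sq (x - c) < r.
Proof.
by move=> h; exact: (cont_lt (C1_continuous (C1_trans c C1_sq)) h).
Qed.

Lemma normr_coord z (j : 'I_2) : `|z 0 j| <= `|z|.
Proof.
rewrite [leRHS]/Num.Def.normr/= mx_normrE.
by apply: (le_bigmax _ (fun i : 'I_1 * 'I_2 => `|z i.1 i.2|) (0, j)).
Qed.

Lemma sq_norm z : sq z <= 2 * `|z| ^+ 2.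
Proof.
have h (j : 'I_2) : z 0 j ^+ 2 <= `|z| ^+ 2.
  by rewrite -(real_normK (num_real (z 0 j))) lerXn2r ?nnegrE// normr_coord.
by rewrite sqE; have := h 0; have := h 1; lra.
Qed.

Lemma norm_sq z : `|z| ^+ 2 <= sq z.
Proof.
have h (j : 'I_2) : `|z 0 j| <= Num.sqrt (sq z).
  rewrite -sqrtr_sqr ler_wsqrtr// sqE.
  by case: (ord2 j) => ->; rewrite ?lerDl ?lerDr sqr_ge0.
have : `|z| <= Num.sqrt (sq z).
  rewrite [leLHS]/Num.Def.normr/= mx_normrE bigmax_le ?sqrtr_ge0// => -[i j] _ /=.
  by rewrite (ord1 i).
by move=> H; rewrite -[leRHS](@sqr_sqrtr _ (sq z)) ?sq_ge0// lerXn2r ?nnegrE// sqrtr_ge0.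
Qed.

End Plane.

(** * The squared positive part *)

Section PositivePart.
Context {R : realType}.
Definition ppart (t : R) : R := Num.max t 0.
(** Zero on a half-line with a continuous derivative: this cuts off the bumps and
smooths the ramps. *)
Definition psq (t : R) : R := ppart t ^+ 2.

Lemma ppart_ge0 t : 0 <= ppart t.
Proof. by rewrite le_max lexx orbT. Qed.
Lemma ppart_id t : 0 <= t -> ppart t = t.
Proof. by move=> h; apply/max_idPl. Qed.
Lemma ppart_0 t : t <= 0 -> ppart t = 0.
Proof. by move=> h; apply/max_idPr. Qed.
Lemma ppart_cont : continuous ppart.
Proof. by move=> t; apply: continuous_max; [exact: cvg_id | exact: cvg_cst]. Qed.

Lemma is_derive_psq (t : R) : is_derive t (1 : R) psq (2 * ppart t).
Proof.
have [t0|t0|->] := ltgtP t 0.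
- rewrite ppart_0 ?ltW// mulr0.
  apply: near_eq_is_derive (is_derive_pcst 0 t (1 : R)).
  have := lt_nbhsl t0; apply: filterS => x x0.
  by rewrite /psq ppart_0 ?expr0n// ltW.
- rewrite ppart_id ?ltW//.
  have H := is_derive_pX 1 (is_derive_id t (1 : R)).
  have E : 2 * t ^+ 1 * 1 = 2 * t by rewrite expr1 mulr1.
  apply: near_eq_is_derive (is_derive_eq H E).
  have := lt_nbhsr t0; apply: filterS => x x0.
  by rewrite /psq ppart_id// ltW.
- apply/is_derive1_caratheodory; exists ppart; split.
  + move=> z; rewrite /psq subr0 [ppart 0]ppart_0// expr0n subr0.
    case: (leP 0 z) => z0; first by rewrite ppart_id// expr2.
    by rewrite ppart_0 ?ltW// expr0n/= mul0r.
  + exact: ppart_cont.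
  + by rewrite ppart_0// mulr0.
Qed.

Lemma is_derive_psq_comp (V : normedModType R) (f : V -> R) z v a : 
  differentiable f z -> is_derive z v f a ->
  is_derive z v (fun x => psq (f x)) (2 * ppart (f z) * a).
Proof. by move=> fd fa; exact: (is_derive_pcomp (is_derive_psq (f z)) fd fa). Qed.

Lemma C1_psq d (f : 'rV[R]_d -> R) : C1 f -> C1 (fun x => psq (f x)).
Proof.
apply: (C1_comp (h' := fun t => 2 * ppart t)); first exact: is_derive_psq.
by apply: contM; [exact: cont_cst | exact: ppart_cont].
Qed.

End PositivePart.

(** * The landscape around one well *)

Section Profile.
Context {R : realType} {I : finType} (e : I -> 'rV[R]_2).
Notation P := 'rV[R]_2.
Implicit Types (u v w z : P) (t : I).
Hypothesis e_unit : forall t, sq (e t) = 1.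

(** A nonnegative homogeneous polynomial whose zeros other than the origin
form the lines spanned by the [e t]: up to sign, [dot (rot (e t)) v] is the distance to such a line. The
fourth power raises the degree to at least 8, and the constants 32 and 2 bound
the value by 1/32 on the disc of squared radius 2; [radial_profile_ge] needs
both. *)
Definition crest v : R :=
  32^-1 * (sq v / 2) ^+ 4 * \prod_(t : I) (dot (rot (e t)) v ^+ 2 / 2).

Definition crest_deg : R := (2 * #|I| + 8)%N%:R.

Definition cocrest t v : R :=
  32^-1 * (sq v / 2) ^+ 4 * \prod_(t' | t' != t) (dot (rot (e t')) v ^+ 2 / 2) / 2.

(** The crest vanishes to second order on each of its lines, and the other factor
is positive near [e t] ([cocrest_gt0]): this is the transversal stiffness of the
saddle-node. *)
Lemma crest_split t v : crest v = dot (rot (e t)) v ^+ 2 * cocrest t v.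
Proof. by rewrite /crest (bigD1 t)//= /cocrest; ring. Qed.

Lemma crest_ge0 v : 0 <= crest v.
Proof.
rewrite /crest mulr_ge0//.
  by rewrite mulr_ge0 ?invr_ge0// exprn_ge0// divr_ge0// sq_ge0.
by apply: prodr_ge0 => t _; rewrite divr_ge0// sqr_ge0.
Qed.

Lemma crest_le v : sq v <= 2 -> crest v <= 32^-1.
Proof.
move=> v2; rewrite /crest -mulrA ler_piMr// mulr_ile1//.
- by rewrite exprn_ge0// divr_ge0// sq_ge0.
- by apply: prodr_ge0 => t _; rewrite divr_ge0// sqr_ge0.
- by rewrite exprn_ile1 ?divr_ge0 ?sq_ge0// ler_pdivrMr// mul1r.
- apply: prodr_ile1 => t _.
  rewrite divr_ge0 ?sqr_ge0//= ler_pdivrMr// mul1r.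
  by apply: le_trans (CauchyS _ _) _; rewrite sq_rot e_unit mul1r.
Qed.

Lemma C1_facets t : C1 (fun v => dot (rot (e t)) v ^+ 2 / 2).
Proof. by apply: C1M; [apply: C1X; exact: C1_dot | exact: C1_cst]. Qed.

Lemma C1_sq4 : C1 (fun v : P => 32^-1 * (sq v / 2) ^+ 4).
Proof.
apply: C1M; first exact: C1_cst.
by apply: C1X; apply: C1M; [exact: C1_sq | exact: C1_cst].
Qed.

Lemma C1_crest : C1 crest.
Proof. by apply: C1M; [exact: C1_sq4 | apply: C1_prod => t; exact: C1_facets]. Qed.

Lemma C1_cocrest t : C1 (cocrest t).
Proof.
apply: C1M; last exact: C1_cst.
by apply: C1M; [exact: C1_sq4 | apply: C1_prod => t'; exact: C1_facets].
Qed.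

Lemma euler_facets (r : seq I) v :
  'D_v (fun v => \prod_(t <- r) (dot (rot (e t)) v ^+ 2 / 2)) v =
  2 * (size r)%:R * \prod_(t <- r) (dot (rot (e t)) v ^+ 2 / 2).
Proof.
elim: r => [|t r IH].
  under eq_fun do rewrite big_nil.
  by rewrite derive_cst mulr0 mul0r.
under eq_fun do rewrite big_cons.
rewrite C1_deriveM; last by apply: C1_prod => t'; exact: C1_facets.
  rewrite IH big_cons /= -natr1.
  have [_ ->] := is_derive_pM (is_derive_pX 1 (is_derive_dot (rot (e t)) v v))
                   (is_derive_pcst 2^-1 v v).
  by rewrite expr1; ring.
exact: C1_facets.
Qed.

Lemma euler_crest v : 'D_v crest v = crest_deg * crest v.
Proof.
rewrite /crest C1_deriveM; [|exact: C1_sq4|by apply: C1_prod => t; exact: C1_facets].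
rewrite euler_facets.
have [_ ->] := is_derive_pM (is_derive_pcst 32^-1 v v) (is_derive_pX 3
   (is_derive_pM (is_derive_sq v v) (is_derive_pcst 2^-1 v v))).
rewrite -/(sq v) /crest_deg natrD natrM.
have -> : (size (index_enum I))%:R = #|I|%:R :> R.
  by rewrite cardT enumT.
by rewrite /sq; field.
Qed.

(** With rho = sq v and s = 2 - rho, and without the crest, this is
rho + s^2 - s^3/3, whose derivative in rho is (1 - s)^2 = (1 - rho)^2. It joins
the well rho at rho = 2 with a continuous gradient. *)
Definition profile v : R :=
  sq v + (2 - sq v) ^+ 2 * (1 - (2 - sq v) / 3 + crest v).

Lemma C1_profile : C1 profile.
Proof.
apply: C1D; first exact: C1_sq.
have C : C1 (fun v : P => 2 - sq v) by apply: C1B; [exact: C1_cst|exact: C1_sq].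
apply: C1M; first exact: C1X.
apply: C1D; last exact: C1_crest.
apply: C1B; first exact: C1_cst.
by apply: C1M => //; exact: C1_cst.
Qed.

Lemma derive_profile v w : 'D_w profile v =
  2 * dot v w * (1 - sq v) ^+ 2 + (2 - sq v) ^+ 2 * 'D_w crest v
  - 4 * dot v w * (2 - sq v) * crest v.
Proof.
have ds := is_derive_pB (is_derive_pcst 2 v w) (is_derive_sq v w).
have [_ ->] := is_derive_pD (is_derive_sq v w) (is_derive_pM (is_derive_pX 1 ds)
  (is_derive_pD (is_derive_pB (is_derive_pcst 1 v w)
     (is_derive_pM ds (is_derive_pcst 3^-1 v w))) (C1_is_derive v w C1_crest))).
by field.
Qed.

(** By Euler's identity the radial derivative of the crest is a multiple of the
crest. *)
Lemma radial_profile v : 'D_v profile v =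
  2 * sq v * (1 - sq v) ^+ 2 + (2 - sq v) * crest v *
     (crest_deg * (2 - sq v) - 4 * sq v).
Proof. by rewrite derive_profile euler_crest /sq; ring. Qed.

Lemma crest_deg_ge8 : 8 <= crest_deg.
Proof. by rewrite /crest_deg ler_nat leq_addl. Qed.

Lemma radial_profile_ge v : sq v <= 2 -> sq v * (1 - sq v) ^+ 2 <= 'D_v profile v.
Proof.
move=> v2; rewrite radial_profile.
have := sq_ge0 v; have := crest_ge0 v; have := crest_le v2; have := crest_deg_ge8.
set a := sq v; set c := crest v; set k := crest_deg => k8 c1 c0 a0.
rewrite -/a in v2.
(* up to rho = 4/3 the degree makes the contribution of the crest nonnegative;
   beyond, its negative part is at most half of the first term *)
have [a43|a43] := leP a (4 / 3).
  have : 0 <= (2 - a) * c * (k * (2 - a) - 4 * a).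
    apply: mulr_ge0; first by apply: mulr_ge0 => //; lra.
    by nra.
  have : 0 <= a * (1 - a) ^+ 2 by apply: mulr_ge0 => //; exact: sqr_ge0.
  by lra.
have h0 : 0 <= (a - 4 / 3) * (a - 2 / 3) by apply: mulr_ge0; lra.
have h1 : 9^-1 <= (1 - a) ^+ 2.
  have -> : (1 - a) ^+ 2 = (a - 4 / 3) * (a - 2 / 3) + 9^-1 by field.
  by lra.
have h2 : 0 <= (2 - a) * c * k * (2 - a).
  by apply: mulr_ge0; [apply: mulr_ge0; [apply: mulr_ge0|]|]; lra.
have h3 : (2 - a) * c <= 2 / 3 * 32^-1.
  by apply: ler_pM => //; lra.
have h4 : 0 <= a * ((1 - a) ^+ 2 - 9^-1) by apply: mulr_ge0 => //; lra.
have h5 : 0 <= a * (2 / 3 * 32^-1 - (2 - a) * c) by apply: mulr_ge0 => //; lra.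
by lra.
Qed.

Lemma radial_profile_gt0 v : 0 < sq v -> sq v <= 2 -> sq v != 1 \/ crest v != 0 ->
  0 < 'D_v profile v.
Proof.
move=> v0 v2; have [v1|v1 _] := eqVneq (sq v) 1.
  case=> // c0; rewrite radial_profile v1.
  have : 0 < crest v by rewrite lt_neqAle eq_sym c0 crest_ge0.
  by have := crest_deg_ge8; nra.
apply: lt_le_trans (radial_profile_ge v2); rewrite mulr_gt0//.
by rewrite exprn_even_gt0//= subr_eq0 eq_sym.
Qed.

End Profile.

(** * The potential of one input value *)

Section Wells.
Context {R : realType}.
Notation P := 'rV[R]_2.
Implicit Types (f : P -> R) (c z v : P).

Lemma well_min f c (r : R) : C1 f -> 0 < r ->
  (forall z, sq (z - c) < r -> 0 <= 'D_(z - c) f z) -> local_minima f c.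
Proof.
move=> fC r0 H; rewrite /local_minima /=.
have : sq (c - c) < r by rewrite subrr sq0.
move=> /near_disc; apply: filterS => z zr.
have [l /andP[l0 l1] E] := line_MVT c (z - c) fC (@ltr01 R).
rewrite scale1r [c + _]addrC subrK mulr1 in E.
rewrite -subr_ge0 E.
have := H (c + l *: (z - c)); rewrite [c + _]addrC addrK sqZ.
have -> : l *: (z - c) = l *: (z - c) + 0 *: 0 by rewrite scaler0 addr0.
rewrite derive_lin// mul0r addr0 pmulr_rge0//; apply.
by apply: le_lt_trans zr; rewrite ler_piMl ?sq_ge0// expr_le1// ltW.
Qed.

End Wells.

Section Ramps.
Context {R : realType} (L : R).
Hypothesis L4 : 4 <= L.
Implicit Types (x t : R).

(** A continuous step of width 1 and its primitive, a smoothing of the positive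
part. *)
Definition ramp t := ppart (t + 2^-1) - ppart (t - 2^-1).
Definition rampI t := (psq (t + 2^-1) - psq (t - 2^-1)) / 2.
Definition ridge (j : nat) : R := (j%:R + 2^-1) * L.

Lemma ramp_lo t : t <= - 2^-1 -> ramp t = 0.
Proof. by move=> h; rewrite /ramp !ppart_0 ?subr0//; lra. Qed.
Lemma ramp_hi t : 2^-1 <= t -> ramp t = 1.
Proof. by move=> h; rewrite /ramp !ppart_id//; lra. Qed.
Lemma ramp_mid t : - 2^-1 <= t -> t <= 2^-1 -> ramp t = t + 2^-1.
Proof. by move=> h h'; rewrite /ramp ppart_id ?ppart_0 ?subr0//; lra. Qed.
Lemma rampI_lo t : t <= - 2^-1 -> rampI t = 0.
Proof. by move=> h; rewrite /rampI /psq !ppart_0 ?expr0n ?subrr ?mul0r//; lra. Qed.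
Lemma rampI_hi t : 2^-1 <= t -> rampI t = t.
Proof. by move=> h; rewrite /rampI /psq !ppart_id; [field|lra|lra]. Qed.
Lemma rampI_le t : rampI t <= ppart t + 1.
Proof.
have p0 := ppart_ge0 t.
have [h|h] := leP t (- 2^-1); first by rewrite rampI_lo//; lra.
have [h'|h'] := leP 2^-1 t; first by rewrite rampI_hi// ppart_id//; lra.
rewrite /rampI /psq (@ppart_0 _ (t - 2^-1)); last by lra.
rewrite (@ppart_id _ (t + 2^-1)); last by lra.
have : 0 <= (1 - (t + 2^-1)) * (1 + (t + 2^-1)) by apply: mulr_ge0; lra.
by rewrite expr0n /=; lra.
Qed.

Lemma is_derive_rampI t : is_derive t (1 : R) rampI (ramp t).
Proof.
have d1 (c : R) := is_derive_pD (is_derive_id t (1 : R)) (is_derive_pcst c t 1).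
have dd (c : R) : differentiable (fun t : R => id t + c) t.
  by apply/derivable1_diffP; case: (d1 c).
have [dA eA] := is_derive_psq_comp (dd 2^-1) (d1 2^-1).
have [dB eB] := is_derive_psq_comp (dd (- 2^-1)) (d1 (- 2^-1)).
have H := is_derive_pM (is_derive_pB (is_derive_psq_comp (dd 2^-1) (d1 2^-1))
  (is_derive_psq_comp (dd (- 2^-1)) (d1 (- 2^-1)))) (is_derive_pcst 2^-1 t 1).
by apply: is_derive_eq H _; rewrite /ramp /=; field.
Qed.

Lemma ramp_cont : continuous ramp.
Proof.
apply: contB; apply: (cont_comp (h := @ppart R) (f := fun t => _)); 
  by [exact: ppart_cont | apply: contD; [move=> x; exact: cvg_id | exact: cont_cst]].
Qed.

Lemma natr_gap (j k : nat) : (j < k)%N -> 0 <= (k%:R - 1 - j%:R) * L.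
Proof.
have hL := L4.
move=> jk; apply: mulr_ge0; last by lra.
by rewrite -addrA -opprD subr_ge0 nat1r ler_nat.
Qed.

Lemma ridge_gap (j k : nat) : (j < k)%N -> ridge j <= (k%:R - 2^-1) * L.
Proof. have hL := L4; by move=> /natr_gap; rewrite /ridge; lra. Qed.

Lemma ramps_lo (a b : nat) x (F : R -> R) : (forall t, t <= - 2^-1 -> F t = 0) ->
  x <= (a%:R + 2^-1) * L - 2^-1 -> \sum_(a <= j < b) F (x - ridge j) = 0.
Proof.
have hL := L4.
move=> F0 xa; rewrite big_nat_cond big1// => j /andP[/andP[aj _] _]; apply: F0.
have : (a%:R : R) <= j%:R by rewrite ler_nat.
rewrite -subr_ge0 => /mulr_ge0/(_ (_ : 0 <= L)) h.
by have := h ltac:(lra); rewrite /ridge; lra.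
Qed.

Lemma ramps_hi (k : nat) x : (k%:R - 2^-1) * L + 2^-1 <= x ->
  \sum_(0 <= j < k) ramp (x - ridge j) = k%:R /\
  \sum_(0 <= j < k) rampI (x - ridge j) = k%:R * x - k%:R ^+ 2 / 2 * L.
Proof.
have hL := L4.
move=> xk; split.
  rewrite (eq_big_nat _ _ (F2 := fun=> 1)); first by rewrite sumr_const_nat subn0.
  by move=> j /andP[_ /ridge_gap h]; rewrite ramp_hi//; lra.
rewrite (eq_big_nat _ _ (F2 := fun j => x - ridge j)); last first.
  by move=> j /andP[_ /ridge_gap h]; rewrite rampI_hi//; lra.
elim: k {xk} => [|k IH]; first by rewrite big_geq//; ring.
by rewrite big_nat_recr//= IH /ridge -natr1; field.
Qed.

(** Between two consecutive steps every ramp is constant, which makes the valleys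
of [base] exact parabolas. *)
Lemma ramps_valley (k M : nat) x : (k <= M)%N ->
  (k%:R - 2^-1) * L + 2^-1 <= x -> x <= (k%:R + 2^-1) * L - 2^-1 ->
  \sum_(0 <= j < M) ramp (x - ridge j) = k%:R /\
  \sum_(0 <= j < M) rampI (x - ridge j) = k%:R * x - k%:R ^+ 2 / 2 * L.
Proof.
have hL := L4.
move=> kM lo hi; have [h1 h2] := ramps_hi lo.
rewrite !(@big_cat_nat _ _ _ k 0 M)//= h1 h2.
by rewrite !(ramps_lo _ _ hi) ?addr0//; [exact: rampI_lo|exact: ramp_lo].
Qed.

Lemma ramps_ridge (j M : nat) t : (j < M)%N -> - 2^-1 <= t -> t <= 2^-1 ->
  \sum_(0 <= i < M) ramp (ridge j + t - ridge i) = j%:R + t + 2^-1.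
Proof.
have hL := L4.
move=> jM lo hi.
rewrite (@big_cat_nat _ _ _ j 0 M)//=; last exact: ltnW.
have := @ramps_hi j (ridge j + t); case; [by rewrite /ridge; lra | move=> -> _].
rewrite big_ltn// ramps_lo; [|exact: ramp_lo|by rewrite /ridge -(natr1 j); lra].
by rewrite [ridge j + t]addrC addrK ramp_mid//; ring.
Qed.

(** Half the derivative in the abscissa of [base]: a sawtooth that vanishes with
positive slope at the bottoms and with negative slope at the ridges. *)
Definition slope (M : nat) x := x - L * \sum_(0 <= j < M) ramp (x - ridge j).

Lemma slope_eq0 (M : nat) x : slope M x = 0 ->
  (exists2 k, (k <= M)%N & x = k%:R * L) \/ (exists2 j, (j < M)%N & x = ridge j).
Proof.
have hL := L4.
rewrite /slope; elim: M => [|M IH].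
  by rewrite big_geq// mulr0 subr0 => ->; left; exists 0%N => //; rewrite mul0r.
rewrite big_nat_recr//=.
have [lo|lo] := leP (x - ridge M) (- 2^-1).
  rewrite ramp_lo// addr0 => /IH[[k kM ->]|[j jM ->]].
    by left; exists k => //; exact: leqW.
  by right; exists j => //; exact: ltnW.
have := @ramps_hi M x; case; [by move: lo; rewrite /ridge; lra | move=> -> _].
have [hi|hi] := leP 2^-1 (x - ridge M).
  rewrite ramp_hi// => E; left; exists M.+1 => //.
  by rewrite -(natr1 M); lra.
rewrite ramp_mid; [|lra|lra] => E; right; exists M => //.
have : (1 - L) * (x - ridge M) = 0 by rewrite -E /ridge; field.
by move/eqP; rewrite mulf_eq0 => /orP[/eqP h|/eqP h]; lra.
Qed.

Lemma slope_ridge (j M : nat) t : (j < M)%N -> - 2^-1 <= t -> t <= 2^-1 ->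
  slope M (ridge j + t) = (1 - L) * t.
Proof. have hL := L4; by move=> jM lo hi; rewrite /slope ramps_ridge// /ridge; field. Qed.

End Ramps.

Section Level.
Context {R : realType} {I : finType} (e : I -> 'rV[R]_2) (L : R).
Notation P := 'rV[R]_2.
Implicit Types (u v w z : P) (t : I) (N k : nat).
Hypothesis e_unit : forall t, sq (e t) = 1.
Hypothesis L4 : 4 <= L.

(** The difference between [profile] and the quadratic well, cut off outside the
disc where it is added. *)
Definition star v : R := psq (2 - sq v) * (1 - (2 - sq v) / 3 + crest e v).

Definition well k : P := pt (k%:R * L) 0.

(** The minimum of the [N] parabolas [sq (z - well k)], smoothed at the ridges
between them. *)
Definition base N z : R :=
  sq z - 2 * L * \sum_(0 <= j < N.-1) rampI (z 0 0 - ridge L j).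

Definition Lev N z : R := base N z + \sum_(k < N) star (z - well k).

Lemma C1_2sq : C1 (fun v : P => 2 - sq v).
Proof. by apply: C1B; [exact: C1_cst | exact: C1_sq]. Qed.

Lemma C1_star : C1 star.
Proof.
apply: C1M; first exact: C1_psq C1_2sq.
apply: C1D; last exact: C1_crest.
by apply: C1B; [exact: C1_cst | apply: C1M; [exact: C1_2sq | exact: C1_cst]].
Qed.

Lemma is_derive_star v w : is_derive v w star
  (2 * ppart (2 - sq v) * (- (2 * dot v w)) * (1 - (2 - sq v) / 3 + crest e v) +
   psq (2 - sq v) * (2 * dot v w / 3 + 'D_w (crest e) v)).
Proof.
have ds := is_derive_pB (is_derive_pcst 2 v w) (is_derive_sq v w).
have dp := is_derive_psq_comp (C1_diff v C1_2sq) ds.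
have H := is_derive_pM dp
  (is_derive_pD (is_derive_pB (is_derive_pcst 1 v w)
     (is_derive_pM ds (is_derive_pcst 3^-1 v w))) (C1_is_derive v w (C1_crest e))).
by apply: is_derive_eq H _; field.
Qed.

Lemma star_out v : 2 <= sq v -> star v = 0.
Proof. by move=> h; rewrite /star /psq ppart_0 ?expr0n ?mul0r//; lra. Qed.

Lemma derive_star_out v w : 2 <= sq v -> 'D_w star v = 0.
Proof.
move=> h; have [_ ->] := is_derive_star v w.
by rewrite /psq ppart_0 ?expr0n ?mulr0 ?mul0r ?add0r//; lra.
Qed.

Lemma star_ge0 v : 0 <= star v.
Proof.
have [h|h] := leP 2 (sq v); first by rewrite star_out.
rewrite /star mulr_ge0 ?sqr_ge0// addr_ge0 ?crest_ge0//.
by have := sq_ge0 v; lra.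
Qed.

Lemma is_derive_base N z w : is_derive z w (base N)
  (2 * slope L N.-1 (z 0 0) * w 0 0 + 2 * z 0 1 * w 0 1).
Proof.
have H : is_derive z w (fun z : P => \sum_(0 <= j < N.-1) rampI (z 0 0 - ridge L j))
    (\sum_(0 <= j < N.-1) ramp (z 0 0 - ridge L j) * w 0 0).
  apply: is_derive_psum => j.
  have d0 := is_derive_pB (is_derive_coord 0 z w) (is_derive_pcst (ridge L j) z w).
  have d1 : differentiable (fun z : P => z 0 0 - ridge L j) z.
    by apply: C1_diff; apply: C1B; [exact: C1_coord | exact: C1_cst].
  have := is_derive_pcomp (f := fun z : P => z 0 0 - ridge L j)
    (is_derive_rampI (z 0 0 - ridge L j)) d1 d0.
  by rewrite subr0.
have K := is_derive_pB (is_derive_sq z w) (is_derive_pM (is_derive_pcst (2 * L) z w) H).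
apply: is_derive_eq K _.
by rewrite /slope /dot -mulr_suml; ring.
Qed.

Lemma C1_base N : C1 (base N).
Proof.
apply: C1B; first exact: C1_sq.
apply: C1M; first exact: C1_cst.
apply: C1_sum => j; apply: (C1_comp (h' := ramp)).
- exact: is_derive_rampI.
- exact: ramp_cont.
- by apply: C1B; [exact: C1_coord | exact: C1_cst].
Qed.

Lemma C1_stars N : C1 (fun z => \sum_(k < N) star (z - well k)).
Proof. by apply: C1_sum => k; apply: C1_trans; exact: C1_star. Qed.

Lemma C1_Lev N : C1 (Lev N).
Proof. by apply: C1D; [exact: C1_base | exact: C1_stars]. Qed.

Lemma sq_well z k : sq (z - well k) = (z 0 0 - k%:R * L) ^+ 2 + z 0 1 ^+ 2.
Proof. by rewrite sqE !mxE/= subr0. Qed.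

Lemma well_far k k' z : k != k' -> sq (z - well k) <= 2 -> 2 <= sq (z - well k').
Proof.
have hL := L4; rewrite !sq_well => kk' h.
have x1 : (z 0 0 - k%:R * L) ^+ 2 <= 2 by have := sqr_ge0 (z 0 1); lra.
suff : 2 <= (z 0 0 - k'%:R * L) ^+ 2 by have := sqr_ge0 (z 0 1); lra.
have hx : -2 <= z 0 0 - k%:R * L <= 2.
  by rewrite -ler_norml -(@ler_pXn2r _ 2%N) ?nnegrE// real_normK ?num_real//; lra.
case/andP: hx => xl xr.
move: kk'; rewrite neq_lt => /orP[/natr_gap|/natr_gap] => /(_ R L L4) g.
  have h1 : 0 <= (k'%:R * L - z 0 0 - 2) * (k'%:R * L - z 0 0 + 2).
    by apply: mulr_ge0; lra.
  by lra.
have h1 : 0 <= (z 0 0 - k'%:R * L - 2) * (z 0 0 - k'%:R * L + 2).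
  by apply: mulr_ge0; lra.
by lra.
Qed.

Lemma Lev_disc N k z : (k < N)%N -> sq (z - well k) <= 2 ->
  Lev N z = profile e (z - well k).
Proof.
have hL := L4; move=> kN h; rewrite /Lev (bigD1 (Ordinal kN))//= big1 ?addr0; last first.
  move=> k' kk'; apply: star_out; apply: (well_far _ h).
  by rewrite eq_sym; apply: contra kk' => /eqP E; apply/eqP/val_inj.
have hx : -(3 / 2) <= z 0 0 - k%:R * L <= 3 / 2.
  have h32 : (0 : R) <= 3 / 2 by lra.
  rewrite -ler_norml -(@ler_pXn2r _ 2%N) ?nnegrE//.
  rewrite real_normK ?num_real//; move: h; rewrite sq_well.
  by have := sqr_ge0 (z 0 1); lra.
case/andP: hx => xl xr.
have kM : (k <= N.-1)%N by lia.
rewrite /base; have := @ramps_valley _ _ L4 k N.-1 (z 0 0) kM; case; [lra|lra|].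
move=> _ ->; rewrite /star /profile /psq ppart_id; last by lra.
by congr (_ + _); rewrite sq_well sqE; field.
Qed.

Lemma derive_Lev_disc N k z w : (k < N)%N -> sq (z - well k) < 2 ->
  'D_w (Lev N) z = 'D_w (profile e) (z - well k).
Proof.
move=> kN h; rewrite -derive_trans; last exact: C1_profile.
apply: near_eq_derive; have := near_disc h; apply: filterS => x xh.
by apply: Lev_disc => //; exact: ltW.
Qed.

Lemma derive_Lev_out N z w : (forall k, (k < N)%N -> 2 <= sq (z - well k)) ->
  'D_w (Lev N) z = 2 * slope L N.-1 (z 0 0) * w 0 0 + 2 * z 0 1 * w 0 1.
Proof.
move=> out; rewrite /Lev C1_deriveD; [|exact: C1_base|exact: C1_stars].
have [_ ->] := is_derive_base N z w.
suff -> : 'D_w (fun z => \sum_(k < N) star (z - well k)) z = 0 by rewrite addr0.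
have E : is_derive z w (fun z => \sum_(k < N) star (z - well k))
           (\sum_(k < N) 'D_w star (z - well k)).
  apply: is_derive_psum => k; apply: is_derive_trans.
  exact: C1_is_derive C1_star.
by case: E => _ ->; rewrite big1// => k _; apply: derive_star_out; exact: out.
Qed.

Lemma well_local_min N k : (k < N)%N -> local_minima (Lev N) (well k).
Proof.
move=> kN; apply: (well_min (C1_Lev N) (@ltr01 R)) => z z1.
rewrite (derive_Lev_disc _ kN); last by rewrite (lt_trans z1)// ltr1n.
apply: le_trans (radial_profile_ge e_unit _); last by rewrite (le_trans (ltW z1))// ler1n.
by rewrite mulr_ge0 ?sq_ge0 ?sqr_ge0.
Qed.

(** In a disc the radial slope leaves only the bottom and points of the unit
circle, from where the potential decreases towards the bottom. Outside the discs
the potential is [base], whose critical points are on ridges, where it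
decreases in the abscissa. *)
Lemma local_min_well N z : (0 < N)%N -> local_minima (Lev N) z ->
  exists2 k, (k < N)%N & z = well k.
Proof.
have hL := L4; move=> N0 zmin.
have zc w : 'D_w (Lev N) z = 0 by apply: local_min_derive0 => //; exact: C1_Lev.
have [[k [kN zk]]|out] := pselect (exists k, (k < N)%N /\ sq (z - well k) < 2).
  exists k => //; set v := z - well k in zk.
  have [/eqP|v0] := eqVneq v 0; first by rewrite subr_eq0 => /eqP.
  have vp : 0 < sq v by rewrite sq_gt0.
  (* on the unit circle: follow the radius inwards *)
  have slide (l : R) : 0 < l < 1 -> z + l *: (- v) - well k = (1 - l) *: v.
    by move=> _; rewrite scalerBl scale1r scalerN addrAC.
  have [v1|v1] := eqVneq (sq v) 1; last first.
    have := @radial_profile_gt0 _ _ _ e_unit v vp (ltW zk) (or_introl v1).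
    by rewrite -(derive_Lev_disc v kN zk) zc ltxx.
  exfalso; apply: (not_min_of_descent (C1_Lev N) (@ltr01 R) _ zmin (w := - v)).
  move=> l l01; have l1 : 0 < 1 - l by case/andP: l01; lra.
  have ql : sq ((1 - l) *: v) < 1.
    by rewrite sqZ v1 mulr1 expr_lt1 ?ltW//; case/andP: l01; lra.
  rewrite (derive_Lev_disc _ kN) slide//; last by rewrite (lt_trans ql)// ltr1n.
  have -> : - v = (- (1 - l)^-1) *: ((1 - l) *: v) + 0 *: 0.
    by rewrite scaler0 addr0 scalerA mulNr mulVf ?gt_eqF// scaleN1r.
  rewrite derive_lin; last exact: C1_profile.
  rewrite mul0r addr0 mulNr oppr_lt0 mulr_gt0 ?invr_gt0//.
  apply: (radial_profile_gt0 e_unit).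
  - by rewrite sqZ v1 mulr1 exprn_gt0.
  - by rewrite (le_trans (ltW ql))// ler1n.
  - by left; rewrite lt_eqF.
have out' k : (k < N)%N -> 2 <= sq (z - well k).
  by move=> kN; rewrite leNgt; apply/negP => zk; apply: out; exists k.
have /eqP := zc (pt 0 1); rewrite derive_Lev_out// pt0 pt1 mulr0 mulr1 add0r.
rewrite mulf_eq0 pnatr_eq0/= => /eqP y0.
have /eqP := zc (pt 1 0); rewrite derive_Lev_out// pt0 pt1 mulr0 mulr1 addr0.
rewrite mulf_eq0 pnatr_eq0/= => /eqP /(slope_eq0 L4)[[k kN x0]|[j jN x0]].
  exfalso; have kN' : (k < N)%N by lia.
  by have := out' k kN'; rewrite sq_well x0 y0 subrr expr0n /=; lra.
(* on a ridge: follow the first axis over the width of the ramp *)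
exfalso; apply: (not_min_of_descent (C1_Lev N) (_ : 0 < 2^-1 :> R) _ zmin (w := pt 1 0)).
  by rewrite invr_gt0.
move=> l /andP[l0 l1].
have E0 : (z + l *: pt 1 0) 0 0 = ridge L j + l by rewrite !mxE /= mulr1 x0.
have E1 : (z + l *: pt 1 0) 0 1 = 0 by rewrite !mxE /= mulr0 addr0 y0.
rewrite derive_Lev_out; last first.
  move=> k kN; rewrite sq_well E0 E1 expr0n addr0 /ridge.
  have [kj|jk] := leqP k j.
    have := @natr_gap _ L L4 k j.+1 ltac:(lia); rewrite -(natr1 j) => g.
    have h1 : 0 <= ((j%:R + 2^-1) * L + l - k%:R * L - 3 / 2) *
                  ((j%:R + 2^-1) * L + l - k%:R * L + 3 / 2).
      by apply: mulr_ge0; lra.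
    by lra.
  have g := @natr_gap _ L L4 j k jk.
  have h1 : 0 <= (k%:R * L - (j%:R + 2^-1) * L - l - 3 / 2) *
                (k%:R * L - (j%:R + 2^-1) * L - l + 3 / 2).
    by apply: mulr_ge0; lra.
  by lra.
rewrite E0 E1 slope_ridge// ?pt0 ?pt1; [|lra|lra].
have : 0 < (L - 1) * l by apply: mulr_gt0; lra.
by lra.
Qed.

Lemma Lev_coercive N (M : R) : exists r, forall z, r < `|z| -> M < Lev N z.
Proof.
have hL := L4; pose K := 2 * L * N%:R.
have K0 : 0 <= K by rewrite !mulr_ge0//; lra.
exists (2 * K + 1 + `|M|) => z zr.
have s0 : 0 <= \sum_(k < N) star (z - well k) by apply: sumr_ge0 => k _; exact: star_ge0.
have s1 : \sum_(0 <= j < N.-1) rampI (z 0 0 - ridge L j) <= N%:R * (`|z| + 1).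
  apply: (@le_trans _ _ (\sum_(0 <= j < N.-1) (`|z| + 1))).
    apply: ler_sum => j _; apply: le_trans (rampI_le _) _.
    rewrite lerD2r /ppart ge_max normr_ge0 andbT.
    apply: le_trans (normr_coord z 0); apply: le_trans (ler_norm (z 0 0)).
    rewrite gerBl /ridge mulr_ge0//; last by lra.
  rewrite sumr_const_nat subn0 -[leLHS]mulr_natl ler_wpM2r// ?addr_ge0//.
  by rewrite ler_nat leq_pred.
have s2 := norm_sq z.
have s3 : 2 * L * \sum_(0 <= j < N.-1) rampI (z 0 0 - ridge L j) <= K * (`|z| + 1).
  by rewrite /K -!mulrA ler_wpM2l// ler_wpM2l//; lra.
have M0 := ler_norm M; have M1 := normr_ge0 M.
have s4 : 0 <= (`|z| - K - (K + 1 + `|M|)) * `|z| by apply: mulr_ge0 => //; lra.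
have s5 : 0 <= (K + 1 + `|M|) * (`|z| - 1) by apply: mulr_ge0 => //; lra.
by rewrite /Lev /base; lra.
Qed.

End Level.

(** * Saddle-nodes *)

Section SaddleNodeGeometry.
Context {R : realType} {I : finType} (e : I -> 'rV[R]_2).
Notation P := 'rV[R]_2.
Implicit Types (u v w z : P) (t : I).
Hypothesis e_unit : forall t, sq (e t) = 1.
Hypothesis e_indep : forall t t', t != t' -> dot (rot (e t')) (e t) != 0.

Lemma cocrest_gt0 t : 0 < cocrest e t (e t).
Proof.
rewrite /cocrest e_unit; apply: mulr_gt0; last by rewrite invr_gt0.
apply: mulr_gt0; first by apply: mulr_gt0; rewrite ?invr_gt0// exprn_gt0.
apply: prodr_gt0 => t' t't; apply: mulr_gt0; last by rewrite invr_gt0.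
by rewrite exprn_even_gt0//= e_indep// eq_sym.
Qed.

Lemma cocrest_ge0 t v : 0 <= cocrest e t v.
Proof.
rewrite /cocrest divr_ge0// mulr_ge0//.
  by rewrite mulr_ge0 ?invr_ge0// exprn_ge0// divr_ge0// sq_ge0.
by apply: prodr_ge0 => t' _; rewrite divr_ge0// sqr_ge0.
Qed.

Lemma derive_crest t v w : 'D_w (crest e) v =
  2 * dot (rot (e t)) v * dot (rot (e t)) w * cocrest e t v +
  dot (rot (e t)) v ^+ 2 * 'D_w (cocrest e t) v.
Proof.
have -> : crest e = fun v => dot (rot (e t)) v ^+ 2 * cocrest e t v.
  by apply/funext => x; exact: crest_split.
have [_ ->] := is_derive_pM (is_derive_pX 1 (is_derive_dot (rot (e t)) v w))
                (C1_is_derive v w (C1_cocrest e t)).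
by rewrite expr1; ring.
Qed.

(** In the derivative along [v - e t], one term is a nonnegative multiple of the
square of the transversal coordinate; the others are at most [om v] times the
squared distance to [e t], and [om] vanishes at [e t]. *)
Lemma profile_flat t (eta : R) : 0 < eta -> exists2 r : R, 0 < r &
  forall v, sq (v - e t) < r -> - eta * sq (v - e t) <= 'D_(v - e t) (profile e) v.
Proof.
move=> eta0; set n := rot (e t); set H := cocrest e t.
pose D v := (v - e t) 0 0 * 'D_(delta_mx 0 0) H v + (v - e t) 0 1 * 'D_(delta_mx 0 1) H v.
have HC : C1 H by exact: C1_cocrest.
have DE v : 'D_(v - e t) H v = D v.
  have {1}-> : v - e t = (v - e t) 0 0 *: delta_mx 0 0 + (v - e t) 0 1 *: delta_mx 0 1.
    by apply: planeP; rewrite !mxE /= !mulr1 !mulr0 ?addr0 ?add0r.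
  by rewrite derive_lin.
pose om v := 2 * `|dot v (v - e t)| * sq (e t + v) + (2 - sq v) ^+ 2 * `|D v|
             + 4 * `|dot v (v - e t) * (2 - sq v)| * H v.
have omc : continuous om.
  have cc (j : 'I_2) : continuous (fun v : P => (v - e t) 0 j).
    apply: C1_continuous; exact: (C1_trans (e t) (C1_coord j)).
  have c0 (j : 'I_2) : continuous (fun v : P => v 0 j) by apply: C1_continuous; exact: C1_coord.
  have cd : continuous (fun v : P => dot v (v - e t)).
    by apply: contD; apply: contM.
  have cn (f : P -> R) : continuous f -> continuous (fun v => `|f v|).
    by move=> fc; exact: (cont_comp (@norm_continuous _ _) fc).
  have c2 : continuous (fun v : P => 2 - sq v) by apply: contB; [exact: cont_cst|exact: sq_cont].
  have cD : continuous D.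
    by apply: contD; apply: contM => //; exact: C1_cont.
  apply: contD; first apply: contD.
  - apply: contM; first by apply: contM; [exact: cont_cst | exact: cn].
    have -> : (fun v => sq (e t + v)) = (fun v => sq (v - (- e t))).
      by apply/funext => v; rewrite opprK addrC.
    exact: (C1_continuous (C1_trans (- e t) C1_sq)).
  - by apply: contM; [exact: contX | exact: cn].
  - apply: contM; last exact: C1_continuous.
    by apply: contM; [exact: cont_cst | apply: cn; exact: contM].
have om0 : om (e t) = 0.
  by rewrite /om /D subrr dot0r !mxE !mul0r addr0 normr0 !(mulr0, mul0r, addr0).
have : \forall v \near e t, om v < eta by apply: cont_lt => //; rewrite om0.
move=> /nbhs_ballP[r /= r0 rb]; exists (r ^+ 2); first by rewrite exprn_gt0.
move=> v vr; have {rb} : om v < eta.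
  apply: rb; rewrite -ball_normE /= distrC.
  rewrite -(@ltr_pXn2r _ 2%N) ?nnegrE// ?ltW//.
  by apply: le_lt_trans vr; exact: norm_sq.
rewrite /om derive_profile (derive_crest t) DE (crest_split e t) -/n -/H.
set w := v - e t; set q := sq w.
have vE : v = e t + w by rewrite /w addrC subrK.
have lE : dot n w = dot n v by rewrite /w dotBr dot_rot subr0.
have lq : dot n v ^+ 2 <= q.
  by rewrite -lE; apply: le_trans (CauchyS _ _) _; rewrite sq_rot e_unit mul1r.
have sE : (1 - sq v) ^+ 2 <= sq (e t + v) * q.
  have -> : 1 - sq v = - dot (e t + v) w.
    by rewrite /w dotBr !dotDl -/(sq v) -/(sq (e t)) e_unit (dotC v); ring.
  by rewrite sqrrN; exact: CauchyS.
have H0 : 0 <= H v by exact: cocrest_ge0.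
have q0 : 0 <= q by exact: sq_ge0.
rewrite lE.
set a := dot v w; set b := 2 - sq v; set l2 := dot n v ^+ 2; set d := D v.
have l20 : 0 <= l2 by exact: sqr_ge0.
rewrite -/l2 in lq.
move=> omlt.
have t1 : - (2 * `|a| * sq (e t + v)) * q <= 2 * a * (1 - sq v) ^+ 2.
  have h : 0 <= (a + `|a|) * (1 - sq v) ^+ 2.
    by apply: mulr_ge0; [have := lerNnormlW (lexx `|a|); lra | exact: sqr_ge0].
  have h' : 0 <= `|a| * (sq (e t + v) * q - (1 - sq v) ^+ 2).
    by apply: mulr_ge0 => //; lra.
  by lra.
have t2 : - (b ^+ 2 * `|d|) * q <= b ^+ 2 * (l2 * d).
  have h : 0 <= (d + `|d|) * (b ^+ 2 * l2).
    by apply: mulr_ge0; [have := lerNnormlW (lexx `|d|); lra | rewrite mulr_ge0// sqr_ge0].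
  have h' : 0 <= `|d| * b ^+ 2 * (q - l2).
    by apply: mulr_ge0; [rewrite mulr_ge0// sqr_ge0 | lra].
  by lra.
have t3 : - (4 * `|a * b| * H v) * q <= - (4 * a * b * (l2 * H v)).
  have h : 0 <= (`|a * b| - a * b) * (l2 * H v).
    by apply: mulr_ge0; [have := ler_norm (a * b); lra | rewrite mulr_ge0].
  have h' : 0 <= `|a * b| * H v * (q - l2).
    by apply: mulr_ge0; [rewrite mulr_ge0 | lra].
  by lra.
have t4 : 0 <= b ^+ 2 * (2 * l2 * H v).
  by apply: mulr_ge0; [exact: sqr_ge0 | apply: mulr_ge0 => //; lra].
have t5 : 0 <= (eta - (2 * `|a| * sq (e t + v) + b ^+ 2 * `|d| + 4 * `|a * b| * H v)) * q.
  by apply: mulr_ge0 => //; rewrite subr_ge0; exact: ltW.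
have -> : 2 * dot n v * dot n v * H v = 2 * l2 * H v by rewrite /l2; ring.
by lra.
Qed.

End SaddleNodeGeometry.

Section LocalDifferentiability.
Context {R : realType} {V W : normedModType R}.

(** Two functions that agree near a point differ there by a function that is
locally zero. *)
Lemma near_eq_differentiable (f g : V -> W) x :
  (\forall y \near x, f y = g y) -> differentiable f x -> differentiable g x.
Proof.
move=> fg df; pose h := g - f.
have hx : h x = 0.
  by rewrite /h !fctE (nbhs_singleton fg) subrr.
have H0 : h \o shift x = cst (h x) + (\0 : V -> W) +o_ 0 id.
  apply/eqaddoP => eps eps0; rewrite hx.
  have : \forall y \near (0 : V), f (y + x) = g (y + x).
    have c : continuous (fun y : V => y + x) by move=> y; exact: differentiable_continuous.
    by have := c 0; rewrite /continuous_at add0r => /(_ _ fg).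
  apply: filterS => y E /=.
  by rewrite /h !fctE /= E subrr /cst addr0 subr0 normr0 mulr_ge0 // ltW.
have c0 : continuous (\0 : {linear V -> W}) by exact: cst_continuous.
have dh : differentiable h x.
  apply/diff_locallyP; have E : 'd h x = (\0 : {linear V -> W}) :> (V -> W).
    exact: diff_unique c0 H0.
  by rewrite E; split.
have -> : g = f + h by rewrite /h addrC subrK.
exact: differentiableD.
Qed.

End LocalDifferentiability.

Section Polynomials.
Context {R : realType}.
Notation P := 'rV[R]_2.
Implicit Types (f g : P -> R) (c v w z : P).

(** Near a saddle-node the field is polynomial; this class is closed under
directional derivatives, which gives all the regularity at once. *)
Inductive polyfun : (P -> R) -> Prop :=
| polyfun_cst (a : R) : polyfun (fun=> a)
| polyfun_coord (j : 'I_2) : polyfun (fun z => z 0 j)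
| polyfunD f g : polyfun f -> polyfun g -> polyfun (fun z => f z + g z)
| polyfunM f g : polyfun f -> polyfun g -> polyfun (fun z => f z * g z).

Lemma polyfun_C1 f : polyfun f -> C1 f.
Proof.
elim=> [a|j|{}f g _ fC _ gC|{}f g _ fC _ gC].
- exact: C1_cst.
- exact: C1_coord.
- exact: C1D.
- exact: C1M.
Qed.

Lemma polyfun_derive f v : polyfun f -> polyfun ('D_v f).
Proof.
elim=> [a|j|{}f g fp fC gp gC|{}f g fp fC gp gC].
- have -> : 'D_v (fun=> a) = (fun=> 0) :> (P -> R).
    by apply/funext => z; rewrite derive_cst.
  exact: polyfun_cst.
- have -> : 'D_v (fun z : P => z 0 j) = fun=> v 0 j.
    by apply/funext => z; have [_ ->] := is_derive_coord j z v.
  exact: polyfun_cst.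
- have -> : 'D_v (fun z => f z + g z) = fun z => 'D_v f z + 'D_v g z.
    by apply/funext => z; rewrite C1_deriveD//; exact: polyfun_C1.
  exact: polyfunD.
- have -> : 'D_v (fun z => f z * g z) = fun z => f z * 'D_v g z + g z * 'D_v f z.
    by apply/funext => z; rewrite C1_deriveM//; exact: polyfun_C1.
  by apply: polyfunD; exact: polyfunM.
Qed.

Lemma polyfunN f : polyfun f -> polyfun (fun z => - f z).
Proof.
move=> fp; have := polyfunM (polyfun_cst (-1)) fp.
by under eq_fun do rewrite mulN1r.
Qed.

Lemma polyfunB f g : polyfun f -> polyfun g -> polyfun (fun z => f z - g z).
Proof. by move=> fp gp; apply: polyfunD => //; exact: polyfunN. Qed.

Lemma polyfunX f n : polyfun f -> polyfun (fun z => f z ^+ n).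
Proof.
move=> fp; elim: n => [|n IH]; first by under eq_fun do rewrite expr0; exact: polyfun_cst.
by under eq_fun do rewrite exprS; exact: polyfunM.
Qed.

Lemma polyfun_prod (J : Type) (r : seq J) (Q : pred J) (F : J -> P -> R) :
  (forall i, polyfun (F i)) -> polyfun (fun z => \prod_(i <- r | Q i) F i z).
Proof.
move=> Fp; elim: r => [|i r IH].
  by under eq_fun do rewrite big_nil; exact: polyfun_cst.
under eq_fun do rewrite big_cons.
by case: (Q i) => //; exact: polyfunM.
Qed.

Lemma polyfun_dot w : polyfun (dot w).
Proof. by apply: polyfunD; apply: polyfunM; [exact: polyfun_cst|exact: polyfun_coord
  |exact: polyfun_cst|exact: polyfun_coord]. Qed.

Lemma polyfun_sq : polyfun sq.
Proof. by apply: polyfunD; apply: polyfunM; exact: polyfun_coord. Qed.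

Lemma polyfun_trans f c : polyfun f -> polyfun (fun z => f (z - c)).
Proof.
elim=> [a|j|{}f g _ fp _ gp|{}f g _ fp _ gp].
- exact: polyfun_cst.
- have -> : (fun z : P => (z - c) 0 j) = fun z => z 0 j - c 0 j.
    by apply/funext => z; rewrite !mxE.
  by apply: polyfunB; [exact: polyfun_coord | exact: polyfun_cst].
- exact: polyfunD.
- exact: polyfunM.
Qed.

Definition prow (g : 'I_2 -> P -> R) : P -> P := fun z => \row_j g j z.

Lemma prow_differentiable (g : 'I_2 -> P -> R) z : (forall j, polyfun (g j)) -> differentiable (prow g) z.
Proof.
move=> gp.
have -> : prow g = (fun z => g 0 z *: delta_mx 0 0) + (fun z => g 1 z *: delta_mx 0 1).
  apply/funext => x; apply: planeP; rewrite !mxE /=;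
  by rewrite !(mulr1, mulr0) ?addr0 ?add0r.
by apply: differentiableD; apply: differentiableZl; apply: C1_diff; exact: polyfun_C1.
Qed.

Lemma derive_prow (g : 'I_2 -> P -> R) v : (forall j, polyfun (g j)) ->
  'D_v (prow g) = prow (fun j => 'D_v (g j)).
Proof.
move=> gp; apply/funext => z; rewrite derive_mx.
  apply/rowP => j; rewrite !mxE.
  by congr ('D_v _ z); apply/funext => x; rewrite mxE.
by apply/diff_derivable/prow_differentiable.
Qed.

Lemma derive_prow_at (g : 'I_2 -> P -> R) v z : (forall j, polyfun (g j)) ->
  'D_v (prow g) z = prow (fun j => 'D_v (g j)) z.
Proof. by move=> /(derive_prow v) E; exact: (congr1 (@^~ z) E). Qed.

Lemma prow_C1 (g : 'I_2 -> P -> R) (A : set P) : (forall j, polyfun (g j)) -> C1_on A (prow g).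
Proof.
move=> gp z _; split; first exact: prow_differentiable.
move=> v; rewrite derive_prow//; apply: differentiable_continuous.
by apply: prow_differentiable => j; exact: polyfun_derive.
Qed.

Lemma near_poly_C2 (F : P -> P) (g : 'I_2 -> P -> R) (A : set P) : open A -> (forall j, polyfun (g j)) ->
  (forall z, A z -> F z = prow g z) -> C2_on A F.
Proof.
move=> Ao gp FE.
have near1 z : A z -> \forall y \near z, A y by move=> Az; exact: open_nbhs_nbhs.
have step (h : 'I_2 -> P -> R) (G : P -> P) : (forall j, polyfun (h j)) ->
    (forall z, A z -> G z = prow h z) ->
    C1_on A G /\ forall v z, A z -> 'D_v G z = prow (fun j => 'D_v (h j)) z.
  move=> hp GE.
  have DE v z : A z -> 'D_v G z = prow (fun j => 'D_v (h j)) z.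
    move=> Az; rewrite -(derive_prow v hp); apply: near_eq_derive.
    by apply: filterS (near1 z Az) => y; exact: GE.
  split; last exact: DE.
  move=> z Az; split.
    apply: near_eq_differentiable (prow_differentiable z hp).
    by apply: filterS (near1 z Az) => y Ay; rewrite GE.
  move=> v; have := prow_C1 (A := setT) (fun j => polyfun_derive v (hp j)).
  move=> /(_ z I)[/differentiable_continuous dc _].
  have E := DE v z Az; change ('D_v G x @[x --> z] --> 'D_v G z).
  rewrite E; apply: cvg_trans; last exact: dc.
  have N : \forall y \near z, prow (fun j => 'D_v (h j)) y = 'D_v G y.
    by apply: filterS (near1 z Az) => y Ay; rewrite DE.
  exact: near_eq_cvg N.
have [F1 FD] := step g F gp FE; split; first exact: F1.
move=> v; exact: (step _ ('D_v F) (fun j => polyfun_derive v (gp j)) (FD v)).1.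
Qed.

Lemma polyfun_crest (I : finType) (e : I -> P) : polyfun (crest e).
Proof.
rewrite /crest.
apply: polyfunM.
  apply: polyfunM; first exact: polyfun_cst.
  by apply: polyfunX; apply: polyfunM; [exact: polyfun_sq | exact: polyfun_cst].
apply: polyfun_prod => t; apply: polyfunM; last exact: polyfun_cst.
by apply: polyfunX; exact: polyfun_dot.
Qed.

Lemma polyfun_cocrest (I : finType) (e : I -> P) t : polyfun (cocrest e t).
Proof.
rewrite /cocrest.
apply: polyfunM; last exact: polyfun_cst.
apply: polyfunM.
  apply: polyfunM; first exact: polyfun_cst.
  by apply: polyfunX; apply: polyfunM; [exact: polyfun_sq | exact: polyfun_cst].
apply: polyfun_prod => t'; apply: polyfunM; last exact: polyfun_cst.
by apply: polyfunX; exact: polyfun_dot.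
Qed.

Lemma polyfun_2sq : polyfun (fun v : P => 2 - sq v).
Proof. by apply: polyfunB; [exact: polyfun_cst|exact: polyfun_sq]. Qed.

Lemma polyfun_profile (I : finType) (e : I -> P) : polyfun (profile e).
Proof.
rewrite /profile.
apply: polyfunD; first exact: polyfun_sq.
apply: polyfunM; first by apply: polyfunX; exact: polyfun_2sq.
apply: polyfunD; last exact: polyfun_crest.
apply: polyfunB; first exact: polyfun_cst.
by apply: polyfunM; [exact: polyfun_2sq|exact: polyfun_cst].
Qed.

End Polynomials.

Section VanishingFactor.
Context {R : realType}.
Notation P := 'rV[R]_2.
Implicit Types (f g : P -> R) (v w z : P).

Lemma derive_vanish f g z v : C1 f -> C1 g -> f z = 0 ->
  'D_v (fun x => f x * g x) z = 'D_v f z * g z.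
Proof. by move=> fC gC f0; rewrite C1_deriveM// f0 mul0r add0r mulrC. Qed.

Lemma derive_vanish2 f g z v : C1 f -> C1 g -> f z = 0 ->
  'D_v (fun x => f x ^+ 2 * g x) z = 0.
Proof.
move=> fC gC f0.
have -> : (fun x => f x ^+ 2 * g x) = (fun x => f x * (f x * g x)).
  by apply/funext => x; rewrite expr2 mulrA.
by rewrite derive_vanish ?f0 ?mul0r ?mulr0//; exact: C1M.
Qed.

End VanishingFactor.

Section SaddleNode.
Context {R : realType} {I : finType} (e : I -> 'rV[R]_2) (L : R).
Notation P := 'rV[R]_2.
Implicit Types (u v w z : P) (t : I) (N k : nat).
Hypothesis e_unit : forall t, sq (e t) = 1.
Hypothesis e_indep : forall t t', t != t' -> dot (rot (e t')) (e t) != 0.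
Hypothesis L4 : 4 <= L.

Let kap v : R := 1 - sq v.

Lemma polyfun_kap : polyfun kap.
Proof. by apply: polyfunB; [exact: polyfun_cst | exact: polyfun_sq]. Qed.

Let cA w : P -> R := fun v => 2 * dot w v.
Let cB t w : P -> R := fun v => (2 - sq v) ^+ 2 * (2 * dot (rot (e t)) w * cocrest e t v).
Let cC t w : P -> R := fun v => (2 - sq v) ^+ 2 * 'D_w (cocrest e t) v
    - 4 * dot w v * (2 - sq v) * cocrest e t v.

Lemma polyfun_cA w : polyfun (cA w).
Proof. by apply: polyfunM; [exact: polyfun_cst | exact: polyfun_dot]. Qed.

Lemma polyfun_cB t w : polyfun (cB t w).
Proof.
apply: polyfunM; first by apply: polyfunX; exact: polyfun_2sq.
by apply: polyfunM; [exact: polyfun_cst | exact: polyfun_cocrest].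
Qed.

Lemma polyfun_cC t w : polyfun (cC t w).
Proof.
apply: polyfunB; apply: polyfunM.
- by apply: polyfunX; exact: polyfun_2sq.
- by apply: polyfun_derive; exact: polyfun_cocrest.
- apply: polyfunM; last exact: polyfun_2sq.
  by apply: polyfunM; [exact: polyfun_cst | exact: polyfun_dot].
- exact: polyfun_cocrest.
Qed.

(** Both [1 - sq v] and the transversal coordinate [dot (rot (e t)) v] vanish at
[e t]; sorting the gradient by them makes its first two derivatives at [e t]
immediate. *)
Lemma derive_profile_split t w : 'D_w (profile e) = fun v =>
  kap v ^+ 2 * cA w v + dot (rot (e t)) v * cB t w v + dot (rot (e t)) v ^+ 2 * cC t w v.
Proof.
apply/funext => v; rewrite derive_profile (derive_crest e t) (crest_split e t).
by rewrite /kap /cA /cB /cC (dotC v w); ring.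
Qed.

Let kap_e t : kap (e t) = 0. Proof. by rewrite /kap e_unit subrr. Qed.
Let rot_e t : dot (rot (e t)) (e t) = 0. Proof. exact: dot_rot. Qed.

Lemma hessian_profile t v w : 'D_v ('D_w (profile e)) (e t) =
  2 * cocrest e t (e t) * dot (rot (e t)) v * dot (rot (e t)) w.
Proof.
have h1 := polyfun_C1 polyfun_kap.
have h2 := polyfun_C1 (polyfun_cA w).
have h3 := polyfun_C1 (polyfun_cB t w).
have h4 := polyfun_C1 (polyfun_cC t w).
have h5 := C1_dot (rot (e t)).
rewrite (derive_profile_split t w) C1_deriveD; last 2 first.
- apply: C1D; apply: C1M => //; exact: C1X.
- by apply: C1M => //; exact: C1X.
rewrite C1_deriveD; [|by apply: C1M => //; exact: C1X|exact: C1M].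
rewrite derive_vanish2// derive_vanish2// derive_vanish// addr0 add0r.
have [_ ->] := is_derive_dot (rot (e t)) (e t) v.
by rewrite /cB e_unit; ring.
Qed.

(** In the direction [e t] only the square of [1 - sq v] survives: twice its
derivative squared, 2 * 4, times the factor 2 of [cA]. *)
Lemma cubic_profile t w :
  'D_(e t) ('D_(e t) ('D_w (profile e))) (e t) = 16 * dot (e t) w.
Proof.
have h1 := polyfun_C1 polyfun_kap.
have h2 := polyfun_C1 (polyfun_cA w).
have h3 := polyfun_C1 (polyfun_cB t w).
have h4 := polyfun_C1 (polyfun_cC t w).
have h5 := C1_dot (rot (e t)).
have flat g v : C1 g -> 'D_(e t) (fun v => dot (rot (e t)) v * g v) v =
    dot (rot (e t)) v * 'D_(e t) g v.
  move=> gC; rewrite C1_deriveM//.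
  by have [_ ->] := is_derive_dot (rot (e t)) v (e t); rewrite rot_e mulr0 addr0.
have h6 : C1 (fun v => cB t w v + dot (rot (e t)) v * cC t w v).
  by apply: C1D => //; exact: C1M.
have -> : 'D_w (profile e) = fun v => kap v * (kap v * cA w v) +
    dot (rot (e t)) v * (cB t w v + dot (rot (e t)) v * cC t w v).
  by rewrite (derive_profile_split t w); apply/funext => v; ring.
have dk v : 'D_(e t) kap v = - (2 * dot v (e t)).
  have [_ ->] := is_derive_pB (is_derive_pcst 1 v (e t)) (is_derive_sq v (e t)).
  by rewrite sub0r.
have E : 'D_(e t) (fun v => kap v * (kap v * cA w v) +
      dot (rot (e t)) v * (cB t w v + dot (rot (e t)) v * cC t w v)) =
    fun v => kap v * (kap v * 'D_(e t) (cA w) v - 4 * dot v (e t) * cA w v) +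
      dot (rot (e t)) v * 'D_(e t) (fun v => cB t w v + dot (rot (e t)) v * cC t w v) v.
  apply/funext => v; rewrite C1_deriveD; [|by do 2?[apply: C1M => //]|exact: C1M].
  rewrite (flat _ v h6); congr (_ + _).
  rewrite (C1_deriveM v (e t) h1 (C1M h1 h2)) (C1_deriveM v (e t) h1 h2) dk.
  by ring.
have hd g : polyfun g -> C1 ('D_(e t) g) by move=> gp; apply: polyfun_C1; exact: polyfun_derive.
have h7 : C1 (fun v => kap v * 'D_(e t) (cA w) v - 4 * dot v (e t) * cA w v).
  apply: C1B; first by apply: C1M => //; apply: hd; exact: polyfun_cA.
  apply: C1M => //; apply: C1M; first exact: C1_cst.
  by under eq_fun do rewrite dotC; exact: C1_dot.
have h8 : C1 ('D_(e t) (fun v => cB t w v + dot (rot (e t)) v * cC t w v)).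
  apply: hd; apply: polyfunD; first exact: polyfun_cB.
  by apply: polyfunM; [exact: polyfun_dot | exact: polyfun_cC].
rewrite E C1_deriveD; [|exact: C1M|exact: C1M].
rewrite derive_vanish// derive_vanish// dk kap_e mul0r.
have [_ ->] := is_derive_dot (rot (e t)) (e t) (e t).
by rewrite rot_e -/(sq (e t)) e_unit /cA (dotC w); ring.
Qed.

Definition field_of N : P -> P := fun z => - grad (Lev e L N) z.

Section AtOnePoint.
Variables (N k : nat) (t : I).
Hypothesis kN : (k < N)%N.
Let m : P := well L k.
Let p : P := m + e t.
Let F := field_of N.

Lemma snE : p - m = e t. Proof. by rewrite /p addrC addKr. Qed.

Let g (j : 'I_2) : P -> R := fun z => - 'D_(delta_mx 0 j) (profile e) (z - m).

Lemma polyfun_g j : polyfun (g j).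
Proof.
apply: polyfunN; apply: (polyfun_trans (f := 'D_(delta_mx 0 j) (profile e))).
by apply: polyfun_derive; exact: polyfun_profile.
Qed.

Lemma field_ofE z : sq (z - m) < 2 -> F z = prow g z.
Proof.
move=> zm; apply/rowP => j; rewrite !mxE /g /F.
by rewrite (derive_Lev_disc e L4 _ kN zm).
Qed.

Let disc : set P := [set z | sq (z - m) < 2].

Lemma disc_open : open disc.
Proof. by rewrite openE => z /near_disc. Qed.

Lemma disc_p : disc p.
Proof. by rewrite /disc /= snE e_unit ltr1n. Qed.

Lemma field_derive v : 'D_v F p =
  - (2 * cocrest e t (e t) * dot (rot (e t)) v) *: rot (e t).
Proof.
have -> : 'D_v F p = 'D_v (prow g) p.
  by apply: near_eq_derive; apply: filterS (near_disc disc_p) => z; exact: field_ofE.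
rewrite derive_prow_at; last exact: polyfun_g.
have hp j : C1 (fun z => 'D_(delta_mx 0 j) (profile e) (z - m)).
  exact: (C1_trans m (polyfun_C1 (polyfun_derive _ (polyfun_profile e)))).
apply/rowP => j; rewrite !mxE /g.
have [_ ->] := is_derive_pN (C1_is_derive p v (hp j)).
rewrite (derive_trans m p v (polyfun_C1 (polyfun_derive (delta_mx 0 j) (polyfun_profile e)))).
rewrite snE hessian_profile mulNr; congr (- (_ * _)).
by rewrite /dot !mxE; case: (ord2 j) => -> /=; ring.
Qed.

Lemma field_derive2 : 'D_(e t) ('D_(e t) F) p = (- 16) *: e t.
Proof.
have gp := polyfun_g.
have -> : 'D_(e t) ('D_(e t) F) p = 'D_(e t) ('D_(e t) (prow g)) p.
  apply: near_eq_derive; apply: filterS (near_disc disc_p) => z zd.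
  apply: near_eq_derive; apply: filterS (near_disc zd) => y; exact: field_ofE.
rewrite (derive_prow (e t) gp) derive_prow_at; last by move=> j; exact: polyfun_derive.
have pp j : polyfun ('D_(delta_mx 0 j) (profile e)).
  by apply: polyfun_derive; exact: polyfun_profile.
apply/rowP => j; rewrite !mxE /g.
have -> : 'D_(e t) (fun z => - 'D_(delta_mx 0 j) (profile e) (z - m)) =
   fun z => - 'D_(e t) ('D_(delta_mx 0 j) (profile e)) (z - m).
  apply/funext => z; have hp := C1_trans m (polyfun_C1 (pp j)).
  have [_ ->] := is_derive_pN (C1_is_derive z (e t) hp).
  by rewrite (derive_trans m z (e t) (polyfun_C1 (pp j))).
have hp := C1_trans m (polyfun_C1 (polyfun_derive (e t) (pp j))).
have [_ ->] := is_derive_pN (C1_is_derive p (e t) hp).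
rewrite (derive_trans m p (e t) (polyfun_C1 (polyfun_derive (e t) (pp j)))).
rewrite snE cubic_profile mulNr; congr (- (_ * _)).
by rewrite /dot !mxE; case: (ord2 j) => -> /=; ring.
Qed.

Lemma field_p : F p = 0.
Proof.
rewrite field_ofE; last exact: disc_p.
have E (j : 'I_2) := congr1 (@^~ (e t)) (derive_profile_split t (delta_mx 0 j)).
apply/rowP => j; rewrite !mxE /g snE (E j) /=.
by rewrite kap_e rot_e expr0n !mul0r !addr0 oppr0.
Qed.

Lemma field_diff : differentiable F p.
Proof.
apply: near_eq_differentiable (prow_differentiable p polyfun_g).
by apply: filterS (near_disc disc_p) => z zd; rewrite field_ofE.
Qed.

Let c := 2 * cocrest e t (e t).
Let n := rot (e t).

Lemma jacobian_p : 'J F p = (- c) *: (n^T *m n).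
Proof.
apply/row_matrixP => i; rewrite rowE -deriveEjacobian; last exact: field_diff.
rewrite field_derive dot_delta -/c -/n; move: n => n'.
by apply/rowP => j; rewrite !mxE big_ord_recl big_ord0 !mxE; ring.
Qed.

Lemma c_gt0 : 0 < c.
Proof. by rewrite /c mulr_gt0// cocrest_gt0. Qed.

Lemma char_poly_p : char_poly ('J F p) = ('X - 0%:P) * ('X + c%:P).
Proof.
have n1 : (n 0 0)%:P ^+ 2 + (n 0 1)%:P ^+ 2 = 1 :> {poly R}.
  by rewrite -!rmorphXn -rmorphD -sqE sq_rot e_unit rmorph1.
have J i j : 'J F p i j = - c * (n 0 i * n 0 j).
  by rewrite jacobian_p !mxE !big_ord_recl big_ord0 !mxE addr0.
move: ('J F p) c J => A c' J.
rewrite /char_poly (expand_det_row _ 0) !big_ord_recl big_ord0 /cofactor !det_mx11 !mxE /=.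
have E1 : lift ord0 ord0 = 1 :> 'I_2 by apply/val_inj.
have E2 : lift (1 : 'I_2) 0 = 0 :> 'I_2 by apply/val_inj.
rewrite !E1 !E2 !J /=.
rewrite !(polyCM, polyCN) /=.
set a := (n 0 0)%:P; set b := (n 0 1)%:P.
transitivity ('X * ('X + c'%:P * (a ^+ 2 + b ^+ 2))); last by rewrite n1 mulr1 subr0.
by rewrite /bump /= !expr0 expr1; ring.
Qed.

(** The Jacobian is a negative multiple of the projection on [rot (e t)], so
[e t] is the null direction, and the second derivative of the field in this
direction is - 16 [e t]. *)
Lemma Lev_saddle_node : saddle_node F p.
Proof.
have eN0 : e t != 0 by rewrite -sq_gt0 e_unit ltr01.
split.
- exists disc; first by split; [exact: disc_open | exact: disc_p].
  exact: near_poly_C2 disc_open polyfun_g field_ofE.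
- exact: field_p.
- rewrite char_poly_p mupMl; first by rewrite -[_ - _]expr1 mup_XsubCX eqxx.
  by rewrite rootE !hornerE gt_eqF// c_gt0.
- exists (e t), (e t); split.
  + split=> //; rewrite -deriveEjacobian; last exact: field_diff.
    by rewrite field_derive rot_e mulr0 oppr0 scale0r.
  + split=> //; rewrite jacobian_p -scalemxAl -mulmxA.
    by rewrite mul_row_tr dot_rot -scalemx1 scale0r mulmx0 scaler0.
  + rewrite field_derive2 -scalemxAl mul_row_tr -/(sq (e t)) e_unit.
    apply/negP => /eqP/matrixP/(_ 0 0); rewrite !mxE /= mulr1.
    by move/eqP; rewrite oppr_eq0 pnatr_eq0.
Qed.

(** The Jacobian is singular at [p], but the radial derivative is positive near
[p] except where the crest vanishes on the unit circle, that is, at [p]. *)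
Lemma near_saddle_critical : \forall z \near p, critical_points (Lev e L N) z -> z = p.
Proof.
have c1 : \forall z \near p, 0 < cocrest e t (z - m).
  apply: cont_gt; last by rewrite snE cocrest_gt0.
  by apply: C1_continuous; apply: C1_trans; exact: C1_cocrest.
have c2 : \forall z \near p, 0 < dot (e t) (z - m).
  apply: cont_gt; last by rewrite snE -/(sq (e t)) e_unit.
  by apply: C1_continuous; apply: C1_trans; exact: C1_dot.
have c3 := near_disc disc_p.
near=> z => /critical_dir zc.
have z2 : sq (z - m) < 2 by near: z.
have zH : 0 < cocrest e t (z - m) by near: z.
have ze : 0 < dot (e t) (z - m) by near: z.
set v := z - m in z2 zH ze *.
have v0 : 0 < sq v.
  by rewrite sq_gt0; apply: contraTneq ze => ->; rewrite dot0r ltxx.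
have D0 : 'D_v (profile e) v = 0.
  by rewrite -(derive_Lev_disc e L4 v kN z2) zc//; exact: C1_Lev.
have v1 : sq v = 1.
  apply/eqP; apply/negPn/negP => h.
  by have := radial_profile_gt0 e_unit v0 (ltW z2) (or_introl h); rewrite D0 ltxx.
have cr : crest e v = 0.
  apply/eqP; apply/negPn/negP => h.
  by have := radial_profile_gt0 e_unit v0 (ltW z2) (or_intror h); rewrite D0 ltxx.
have l0 : dot (rot (e t)) v = 0.
  move/eqP: cr; rewrite (crest_split e t) mulf_eq0 (gt_eqF zH) orbF sqrf_eq0.
  by move/eqP.
have d1 : dot (e t) v = 1.
  have := dot_sqr (e t) v; rewrite l0 e_unit v1 expr0n addr0 mulr1 => /eqP.
  by rewrite sqrf_eq1 => /orP[/eqP//|/eqP E]; move: ze; rewrite E; lra.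
have : v = e t by rewrite (frame v (e_unit t)) l0 d1 scale0r scale1r addr0.
by rewrite /v /p => <-; rewrite addrC subrK.
Unshelve. all: by end_near. Qed.

End AtOnePoint.
End SaddleNode.

(** * Trajectories that leave a saddle-node *)

Section Trajectories.
Context {R : realType} {d : nat}.
Notation P := 'rV[R]_d.
Variable F : P -> P.
Implicit Types (x : R -> P) (f : P -> R) (a b s t : R).

Definition sol_seg x a b :=
  {within `[a, b], continuous x} /\
  forall t, a < t < b -> is_derive t (1 : R) x (F (x t)).

Lemma sol_seg_sub x a b a' b' : sol_seg x a b -> a <= a' -> b' <= b -> sol_seg x a' b'.
Proof.
move=> [xc xd] aa' bb'; split.
  apply: continuous_subspaceW xc => t /=; rewrite !in_itv /= => /andP[h1 h2].
  by rewrite (le_trans aa') ?(le_trans h2).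
by move=> t /andP[h1 h2]; apply: xd; rewrite (le_lt_trans aa') ?(lt_le_trans h2).
Qed.

Lemma sol_forward x a b : solution_on `[0, +oo[ F x -> 0 <= a -> sol_seg x a b.
Proof.
move=> [xc xd] a0; split.
  apply: continuous_subspaceW xc => t /=; rewrite !in_itv /= andbT => /andP[h1 h2].
  exact: le_trans h1.
move=> t /andP[h1 h2]; apply: xd; rewrite interior_itv_bndy /= in_itv /= andbT.
exact: le_lt_trans h1.
Qed.

Lemma sol_backward x a b : solution_on `]-oo, 0] F x -> b <= 0 -> sol_seg x a b.
Proof.
move=> [xc xd] b0; split.
  apply: continuous_subspaceW xc => t /=; rewrite !in_itv /= => /andP[h1 h2].
  exact: le_trans b0.
move=> t /andP[h1 h2]; apply: xd; rewrite interior_itv_Nybnd /= in_itv /=.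
exact: lt_le_trans b0.
Qed.

Lemma nonincr_of_derive (g dg : R -> R) a b : a <= b ->
  {within `[a, b], continuous g} ->
  (forall t, a < t < b -> is_derive t (1 : R) g (dg t)) ->
  (forall t, a < t < b -> dg t <= 0) -> g b <= g a.
Proof.
move=> ab gc gd g0; rewrite -subr_le0.
have [->|ab'] := eqVneq a b; first by rewrite subrr.
have a_b : a < b by rewrite lt_neqAle ab'.
have gd' t : t \in `]a, b[%R -> is_derive t (1 : R) g (dg t).
  by rewrite in_itv; exact: gd.
have [c cab ->] := MVT a_b gd' gc.
rewrite in_itv in cab.
by apply: mulr_le0_ge0; [exact: g0 | rewrite subr_ge0].
Qed.

Lemma within_comp f x a b : continuous f -> {within `[a, b], continuous x} ->
  {within `[a, b], continuous (fun t => f (x t))}.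
Proof.
move=> fc /subspace_continuousP xc; apply/subspace_continuousP => t tI.
by apply: cvg_comp; [exact: xc | exact: fc].
Qed.

Lemma within_mul (g h : R -> R) a b : {within `[a, b], continuous g} ->
  {within `[a, b], continuous h} -> {within `[a, b], continuous (fun t => g t * h t)}.
Proof.
move=> /subspace_continuousP gc /subspace_continuousP hc.
by apply/subspace_continuousP => t tI; apply: cvgM; [exact: gc | exact: hc].
Qed.

(** The product of [f] with an exponential is nonincreasing along the
trajectory. *)
Lemma seg_exp f x (k : R) a b : C1 f -> sol_seg x a b -> a <= b ->
  (forall t, a < t < b -> 'D_(F (x t)) f (x t) <= - k * f (x t)) ->
  f (x b) * expR (k * (b - a)) <= f (x a).
Proof.
move=> fC [xc xd] ab H.
pose w t := expR (k * (t - a)).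
have dw t : is_derive t (1 : R) w (k * w t).
  have h1 := is_derive_pM (is_derive_pcst k t (1 : R))
    (is_derive_pB (is_derive_id t (1 : R)) (is_derive_pcst a t 1)).
  have h2 : is_derive (k * (t - a)) (1 : R) (@expR R) (expR (k * (t - a))) by exact: is_derive_expR.
  have h3 := @is_derive1_comp R (@expR R) (fun s => k * (s - a)) t _ _ h2 h1.
  by apply: is_derive_eq h3 _; rewrite /w; ring.
have wc : continuous w.
  by move=> t; apply: differentiable_continuous; apply/derivable1_diffP; case: (dw t).
have -> : f (x a) = f (x a) * w a by rewrite /w subrr mulr0 expR0 mulr1.
rewrite -/(w b).
apply: (nonincr_of_derive (g := fun t => f (x t) * w t)
  (dg := fun t => f (x t) * (k * w t) + w t * 'D_(F (x t)) f (x t))) => //.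
- apply: within_mul; first exact: within_comp (C1_continuous fC) xc.
  exact: continuous_subspaceT.
- move=> t tab; apply: is_derive_pM => //.
  by apply: is_derive_along; [exact: C1_diff | exact: xd].
- move=> t tab; have := H t tab.
  have w0 : 0 < w t by exact: expR_gt0.
  rewrite -subr_ge0 => h; have : 0 <= w t * (- k * f (x t) - 'D_(F (x t)) f (x t)).
    by apply: mulr_ge0 => //; exact: ltW.
  by lra.
Qed.

Lemma seg_mono f x a b : C1 f -> sol_seg x a b -> a <= b ->
  (forall t, a < t < b -> 'D_(F (x t)) f (x t) <= 0) -> f (x b) <= f (x a).
Proof.
move=> fC xs ab H; have := seg_exp (k := 0) fC xs ab.
rewrite mul0r expR0 mulr1; apply=> t tab.
by rewrite oppr0 mul0r; exact: H.
Qed.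

(** The assumption on the derivative holds only below [M]. If [f] were to exceed
its initial value, consider the first time at which it reaches a level between
the initial value and [M]: it has not increased before. *)
Lemma seg_barrier f x (M : R) a b : C1 f -> sol_seg x a b -> a <= b -> f (x a) < M ->
  (forall t, a < t < b -> f (x t) < M -> 'D_(F (x t)) f (x t) <= 0) ->
  f (x b) <= f (x a).
Proof.
move=> fC xs ab fM H; rewrite leNgt; apply/negP => fab.
have [c ac cMb] : exists2 c, f (x a) < c & c < Num.min M (f (x b)).
  have mm : f (x a) < Num.min M (f (x b)) by rewrite lt_min fM.
  by exists ((f (x a) + Num.min M (f (x b))) / 2); lra.
move: cMb; rewrite lt_min => /andP[cM cb].
pose E := [set t | a <= t <= b /\ c <= f (x t)].
have Eb : E b by split; [rewrite ab lexx | exact: ltW].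
have Elb : lbound E a by move=> t [/andP[]].
have hE : has_inf E by split; [exists b | exists a].
set s := inf E.
have as_ : a <= s by apply: lb_le_inf => //; exists b.
have sb : s <= b by apply: ge_inf => //; exists a.
have gc := within_comp (C1_continuous fC) xs.1.
have below t : a <= t -> t < s -> f (x t) < c.
  move=> at_ ts; rewrite ltNge; apply/negP => ct.
  have : s <= t by apply: ge_inf; [exists a | split=> //; rewrite at_ (le_trans (ltW ts))].
  by rewrite leNgt ts.
have cs : c <= f (x s).
  rewrite leNgt; apply/negP => sc.
  have sI : `[a, b]%classic s by rewrite /= in_itv /= as_ sb.
  have /subspace_continuousP gcw := gc; have gs := gcw s sI.
  have : \forall t \near within `[a, b]%classic (nbhs s), f (x t) < c.
    by apply: (cvgr_lt _ gs).
  rewrite near_withinE => /nbhs_ballP[r /= r0 rb].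
  have [t [tab ct] tsr] := @inf_adherent _ E r r0 hE.
  have st : s <= t by apply: ge_inf; [exists a|].
  have : f (x t) < c.
    apply: rb; last by rewrite /= in_itv.
    by rewrite /ball /= distrC ger0_norm ?subr_ge0// ltrBlDl.
  by rewrite ltNge ct.
have : f (x s) <= f (x a).
  apply: seg_mono (sol_seg_sub xs (lexx a) sb) as_ _ => // t /andP[at_ ts].
  apply: H; first by rewrite at_ (lt_le_trans ts).
  by apply: lt_trans cM; apply: below => //; exact: ltW.
by move=> h; have := lt_le_trans ac (le_trans cs h); rewrite ltxx.
Qed.

End Trajectories.

Section RadialFlow.
Context {R : realType}.
Implicit Types (v w y t : R).

Let E v : R := v + expR v.

Let E_incr v w : v < w -> E v < E w.
Proof. by move=> vw; rewrite ltrD// ltr_expR. Qed.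

Let E_inj v w : E v = E w -> v = w.
Proof.
by move=> h; have [/E_incr|/E_incr|//] := ltgtP v w; rewrite h ltxx.
Qed.

Let dE v : is_derive v (1 : R) E (1 + expR v).
Proof. exact: is_derive_pD (is_derive_id v 1) (is_derive_expR v). Qed.

Let E_cont : continuous E.
Proof.
by move=> v; apply: differentiable_continuous; apply/derivable1_diffP; case: (dE v).
Qed.

Let E_surj y : exists v, E v = y.
Proof.
have ay : y - expR y <= y by rewrite gerBl expR_ge0.
have h : Num.min (E (y - expR y)) (E y) <= y <= Num.max (E (y - expR y)) (E y).
  apply/andP; split.
    rewrite ge_min; apply/orP; left; rewrite /E -addrA gerDl addrC subr_le0.
    by rewrite ler_expR.
  by rewrite le_max; apply/orP; right; rewrite /E lerDl expR_ge0.
have [v _ <-] := IVT ay (continuous_subspaceT E_cont) h.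
by exists v.
Qed.

Let invE y : R := sval (cid (E_surj y)).
Let invEK y : E (invE y) = y. Proof. exact: svalP (cid (E_surj y)). Qed.
Let EK v : invE (E v) = v. Proof. by apply: E_inj; rewrite invEK. Qed.

Let dinvE y : is_derive y (1 : R) invE (1 + expR (invE y))^-1.
Proof.
have H := @is_derive_inverse R E invE (1 + expR (invE y)) (invE y).
rewrite invEK in H; apply: H.
- by near=> v; exact: EK.
- by near=> v; exact: E_cont.
- by rewrite gt_eqF// addr_gt0// expR_gt0.
Unshelve. all: by end_near. Qed.

Let invE_ge M y : E M <= y -> M <= invE y.
Proof. by rewrite -{1}(invEK y); apply: contraTT; rewrite -!ltNge; exact: E_incr. Qed.

(** An explicit heteroclinic orbit of r' = - 2 r (1 - r^2)^2: the substitution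
r^2 = e^v / (1 + e^v) turns this equation into (v + e^v)' = - 4. *)
Definition orbit_radius t : R :=
  let v := invE (- 4 * t) in expR ((v - ln (1 + expR v)) / 2).

Let w1_gt0 v : 0 < 1 + expR v. Proof. by rewrite addr_gt0// expR_gt0. Qed.

Lemma orbit_radius_sqr t :
  1 - orbit_radius t ^+ 2 = (1 + expR (invE (- 4 * t)))^-1.
Proof.
rewrite /orbit_radius -expRM_natr divfK ?pnatr_eq0// expRB lnK ?posrE//.
by field; rewrite gt_eqF.
Qed.

Lemma orbit_radius_gt0 t : 0 < orbit_radius t.
Proof. exact: expR_gt0. Qed.

Lemma orbit_radius_lt1 t : orbit_radius t < 1.
Proof.
rewrite -(@ltr_pXn2r _ 2%N) ?nnegrE ?ltW ?orbit_radius_gt0// expr1n -subr_gt0.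
by rewrite orbit_radius_sqr invr_gt0.
Qed.

Lemma is_derive_orbit_radius t : is_derive t (1 : R) orbit_radius
  (- (2 * orbit_radius t * (1 - orbit_radius t ^+ 2) ^+ 2)).
Proof.
have d0 := is_derive_pM (is_derive_pcst (- 4) t (1 : R)) (is_derive_id t (1 : R)).
have d1 := @is_derive1_comp R invE (fun t => - 4 * t) t _ _ (dinvE _) d0.
have d2 := @is_derive1_comp R (@expR R) (fun t => invE (- 4 * t)) t _ _ (is_derive_expR _) d1.
have d3 := is_derive_pD (is_derive_pcst 1 t (1 : R)) d2.
have d4 := @is_derive1_comp R (@ln R) (fun t => 1 + expR (invE (- 4 * t))) t _ _
  (is_derive1_ln (w1_gt0 _)) d3.
have d5 := is_derive_pM (is_derive_pB d1 d4) (is_derive_pcst 2^-1 t (1 : R)).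
have d6 := @is_derive1_comp R (@expR R) _ t _ _ (is_derive_expR _) d5.
apply: is_derive_eq d6 _; rewrite orbit_radius_sqr /orbit_radius /=.
set v := invE _; set r := expR (_ / 2).
by field; rewrite gt_eqF.
Qed.

Lemma orbit_radius_onto (r : R) : 0 < r < 1 -> exists t, orbit_radius t = r.
Proof.
move=> /andP[r0 r1].
have q1 : 0 < 1 - r ^+ 2 by rewrite subr_gt0 expr_lt1// ltW.
have q0 : 0 < r ^+ 2 / (1 - r ^+ 2) by rewrite divr_gt0// exprn_gt0.
pose v := ln (r ^+ 2 / (1 - r ^+ 2)).
exists (- (E v / 4)).
apply/eqP; rewrite -(@eqrXn2 _ 2%N) ?ltW ?orbit_radius_gt0//.
apply/eqP.
have := orbit_radius_sqr (- (E v / 4)).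
have -> : - 4 * - (E v / 4) = E v by field.
rewrite EK /v lnK ?posrE//.
have -> : (1 + r ^+ 2 / (1 - r ^+ 2))^-1 = 1 - r ^+ 2.
  have q1' : 1 - r ^+ 2 != 0 by rewrite gt_eqF.
  have -> : 1 + r ^+ 2 / (1 - r ^+ 2) = (1 - r ^+ 2)^-1 by field.
  by rewrite invrK.
by lra.
Qed.

Lemma orbit_radius_cvg (eps : R) : 0 < eps ->
  exists T, forall t, t <= T -> 1 - orbit_radius t < eps.
Proof.
move=> e0; exists (- (E eps^-1 / 4)) => t tT.
have : eps^-1 <= invE (- 4 * t) by apply: invE_ge; lra.
rewrite -ler_expR => h.
have g := expR_ge1Dx eps^-1.
have h1 : (1 + expR (invE (- 4 * t)))^-1 < eps.
  rewrite invf_plt ?posrE//; lra.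
rewrite -orbit_radius_sqr in h1.
have r0 := orbit_radius_gt0 t; have r1 := orbit_radius_lt1 t.
have : 0 < orbit_radius t * (1 - orbit_radius t) by rewrite mulr_gt0// subr_gt0.
by lra.
Qed.

End RadialFlow.

Section Escape.
Context {R : realType} {I : finType} (e : I -> 'rV[R]_2) (L : R).
Notation P := 'rV[R]_2.
Implicit Types (u v w z q : P) (x : R -> P) (a b s t : R).
Hypothesis e_unit : forall i, sq (e i) = 1.
Hypothesis e_indep : forall i j, i != j -> dot (rot (e j)) (e i) != 0.
Hypothesis L4 : 4 <= L.
Variables (N k : nat) (i : I).
Hypothesis kN : (k < N)%N.

Let m : P := well L k.
Let p : P := m + e i.
Let n : P := rot (e i).
Let V := Lev e L N.
Let F : P -> P := field_of e L N.
Let f z := sq (z - m).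

Let VC : C1 V. Proof. exact: C1_Lev. Qed.
Let fC : C1 f. Proof. exact: (C1_trans m C1_sq). Qed.

Lemma dot_grad (h : P -> R) z w : C1 h -> dot (grad h z) w = 'D_w h z.
Proof.
move=> hC; have {2}-> : w = w 0 0 *: delta_mx 0 0 + w 0 1 *: delta_mx 0 1.
  by apply: planeP; rewrite !mxE /= !mulr1 !mulr0 ?addr0 ?add0r.
by rewrite derive_lin// /dot !grad_dir; ring.
Qed.

Lemma dot_field z w : dot (F z) w = - 'D_w V z.
Proof.
rewrite -(dot_grad z w VC) /F /field_of -/V; move: (grad V z) => g.
by rewrite /dot !mxE; ring.
Qed.

Lemma radius_derive z : 'D_(F z) f z = - 2 * 'D_(z - m) V z.
Proof.
rewrite derive_trans; last exact: C1_sq.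
have [_ ->] := is_derive_sq (z - m) (F z).
by rewrite dotC dot_field; ring.
Qed.

Lemma radius_decr z : f z < 2 -> 'D_(F z) f z <= - 2 * (1 - f z) ^+ 2 * f z.
Proof.
move=> fz; rewrite radius_derive (derive_Lev_disc e L4 _ kN fz).
have := radial_profile_ge e_unit (ltW fz); rewrite -/(f z) => h.
by lra.
Qed.

Lemma radius_decr0 z : f z < 2 -> 'D_(F z) f z <= 0.
Proof.
move=> fz; apply: le_trans (radius_decr fz) _.
have : 0 <= (1 - f z) ^+ 2 * f z by rewrite mulr_ge0 ?sqr_ge0 ?sq_ge0.
by lra.
Qed.

(** The open unit disc is invariant, and in it the squared distance to the bottom
decays at an exponential rate fixed by its initial value. *)
Lemma disc_basin x : solution_on `[0, +oo[ F x -> f (x 0) < 1 ->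
  x t @[t --> +oo] --> m.
Proof.
move=> xs f0; set r := f (x 0) in f0.
have r0 : 0 <= r by exact: sq_ge0.
have fx t : 0 <= t -> f (x t) <= r.
  move=> t0; apply: (seg_barrier (M := 1) fC (sol_forward t xs (lexx 0)) t0) => // s _ fs.
  by apply: radius_decr0; rewrite (lt_trans fs)// ltr1n.
pose c := 2 * (1 - r) ^+ 2.
have c0 : 0 < c by rewrite mulr_gt0// exprn_gt0// subr_gt0.
have decay t : 0 <= t -> f (x t) * expR (c * (t - 0)) <= r.
  move=> t0; apply: (seg_exp fC (sol_forward t xs (lexx 0)) t0) => s /andP[s0 st].
  have fs := fx s (ltW s0).
  apply: le_trans (radius_decr _) _; first by rewrite (le_lt_trans fs)// (lt_trans f0)// ltr1n.
  have h : (1 - r) ^+ 2 <= (1 - f (x s)) ^+ 2.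
    by rewrite lerXn2r ?nnegrE ?subr_ge0 ?(ltW f0) ?(le_trans fs (ltW f0))// lerD2l lerN2.
  have : 0 <= ((1 - f (x s)) ^+ 2 - (1 - r) ^+ 2) * f (x s).
    by rewrite mulr_ge0 ?sq_ge0// subr_ge0.
  by rewrite /c; lra.
apply/cvgrPdist_lt => eps eps0.
exists (r / eps ^+ 2 / c); split; first exact: num_real.
move=> t tT.
have t0 : 0 < t by apply: le_lt_trans tT; rewrite !divr_ge0// ?ltW// exprn_gt0.
rewrite distrC -(@ltr_pXn2r _ 2%N) ?nnegrE ?(ltW eps0)//.
apply: le_lt_trans (norm_sq _) _; rewrite -/(f (x t)).
have := decay t (ltW t0); rewrite subr0 => d.
have g := expR_ge1Dx (c * t).
move: tT; rewrite ltr_pdivrMr// ltr_pdivrMr ?exprn_gt0// => tT.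
rewrite ltNge; apply/negP => h.
have E0 : 0 < eps ^+ 2 by rewrite exprn_gt0.
have : eps ^+ 2 * (1 + c * t) <= f (x t) * expR (c * t).
  apply: ler_pM => //; first exact: ltW.
  by rewrite addr_ge0// mulr_ge0// ltW.
by lra.
Qed.

Lemma field_ray (rho : R) : rho ^+ 2 < 2 ->
  F (m + rho *: e i) = (- (2 * rho * (1 - rho ^+ 2) ^+ 2)) *: e i.
Proof.
move=> r2.
have E : m + rho *: e i - m = rho *: e i by rewrite addrC addKr.
have sE : sq (rho *: e i) = rho ^+ 2 by rewrite sqZ e_unit mulr1.
apply/rowP => j; rewrite [LHS]mxE grad_dir.
rewrite (derive_Lev_disc e L4 _ kN); last by rewrite E sE.
rewrite E; have D := derive_profile_split e i (delta_mx 0 j).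
have R0 : dot (rot (e i)) (rho *: e i) = 0 by rewrite dotZr dot_rot mulr0.
rewrite (congr1 (@^~ (rho *: e i)) D) /= R0 expr0n !mul0r !addr0.
rewrite sE dotZr dotC dot_delta [RHS]mxE; ring.
Qed.

Lemma ray_solution (A : set R) (sg c : R) : sg ^+ 2 = 1 ->
  solution_on A F (fun t => m + (sg * orbit_radius (t + c)) *: e i).
Proof.
move=> sg1.
have d t : is_derive t (1 : R) (fun t => m + (sg * orbit_radius (t + c)) *: e i)
    (F (m + (sg * orbit_radius (t + c)) *: e i)).
  rewrite field_ray; last first.
    rewrite exprMn sg1 mul1r (@lt_trans _ _ 1) ?ltr1n//.
    by rewrite expr_lt1 ?orbit_radius_lt1// ltW// orbit_radius_gt0.
  apply/is_derive_row => j.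
  have -> : (fun s => (m + (sg * orbit_radius (s + c)) *: e i) 0 j) =
      (fun s => m 0 j + (sg * orbit_radius (s + c)) * e i 0 j).
    by apply/funext => s; rewrite !mxE.
  have d0 := is_derive_pD (is_derive_id t (1 : R)) (is_derive_pcst c t 1).
  have d1 := @is_derive1_comp R (@orbit_radius R) (fun t => t + c) t _ _
     (is_derive_orbit_radius _) d0.
  have d2 := is_derive_pD (is_derive_pcst (m 0 j) t (1 : R))
    (is_derive_pM (is_derive_pM (is_derive_pcst sg t (1 : R)) d1)
       (is_derive_pcst (e i 0 j) t 1)).
  apply: is_derive_eq d2 _; rewrite [RHS]mxE exprMn sg1 /=; ring.
split; last by move=> t _; exact: d.
apply: continuous_subspaceT => t; apply: differentiable_continuous.
by apply/derivable1_diffP; case: (d t).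
Qed.

Lemma rest_solution (A : set R) : solution_on A F (fun=> m).
Proof.
split; first by apply: continuous_subspaceT => t; exact: cvg_cst.
move=> t _; have -> : F m = 0.
  have := @field_ray 0; rewrite scale0r addr0 mulr0 mul0r oppr0 scale0r; apply.
  by rewrite expr0n.
exact: is_derive_cst.
Qed.

Lemma ray_basin (rho : R) : `|rho| < 1 -> basin F m (m + rho *: e i).
Proof.
move=> r1; split; last first.
  move=> x xs x0; apply: disc_basin xs _.
  rewrite x0 /f addrC addKr sqZ e_unit mulr1 -real_normK ?num_real//.
  by rewrite expr_lt1.
have [->|r0] := eqVneq rho 0.
  by exists (fun=> m); split; [exact: rest_solution | rewrite scale0r addr0].
have [c cE] := @orbit_radius_onto _ `|rho| ltac:(by rewrite normr_gt0 r0 r1).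
exists (fun t => m + (Num.sg rho * orbit_radius (t + c)) *: e i); split.
  by apply: ray_solution; rewrite sqr_sg r0.
by rewrite add0r cE -numEsg.
Qed.

Lemma near_Ny_comp x (h : P -> R) (M : R) : x t @[t --> -oo] --> p -> continuous h ->
  h p < M -> exists T, forall t, t < T -> h (x t) < M.
Proof.
move=> xp hc hM.
have : \forall y \near p, h y < M by exact: cont_lt.
by move=> /xp[T [_ HT]]; exists T.
Qed.

Let l z := dot n (z - m).

(** A trajectory that emanates from [p] stays in the closed unit disc, because the
squared distance [f] to [m] decreases along it from the value 1. Its transversal
coordinate [l] obeys a linear equation that contracts near [p]; backwards in
time it would grow beyond any bound unless it vanishes. So the trajectory
is on the line through [m] and [p]. *)
Lemma unstable_ray q : unstable_manifold F p q -> q <> p ->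
  exists2 rho : R, `|rho| < 1 & q = m + rho *: e i.
Proof.
move=> [x [xs x0 xp]] qp.
have pm : p - m = e i by rewrite /p addrC addKr.
have fp : f p = 1 by rewrite /f pm e_unit.
have fcont : continuous f by exact: C1_continuous.
have seg a b (b0 : b <= 0) := sol_backward a xs b0.
have f2 t : t <= 0 -> f (x t) < 2.
  move=> t0; have [|T HT] := near_Ny_comp (M := 3 / 2) xp fcont.
    by rewrite fp; lra.
  pose a := Num.min (T - 1) t.
  have at_ : a <= t by rewrite /a ge_min lexx orbT.
  have aT : a < T by rewrite /a gt_min; apply/orP; left; lra.
  have fa := HT a aT.
  apply: (@le_lt_trans _ _ (f (x a))); last by lra.
  apply: (seg_barrier (M := 2) fC (seg a t t0) at_); first by lra.
  by move=> s _; exact: radius_decr0.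
have fmono a b : b <= 0 -> a <= b -> f (x b) <= f (x a).
  move=> b0 ab; apply: (seg_mono fC (seg a b b0) ab) => s /andP[_ sb].
  by apply: radius_decr0; apply: f2; exact: le_trans (ltW sb) b0.
have f1 t : t <= 0 -> f (x t) <= 1.
  move=> t0; rewrite leNgt; apply/negP => ft.
  have [|T HT] := near_Ny_comp (M := f (x t)) xp fcont; first by rewrite fp.
  pose a := Num.min (T - 1) t.
  have at_ : a <= t by rewrite /a ge_min lexx orbT.
  have aT : a < T by rewrite /a gt_min; apply/orP; left; lra.
  by have := le_lt_trans (fmono a t t0 at_) (HT a aT); rewrite ltxx.
(* [l' = - h l], and [h] is positive at [p] *)
pose H := cocrest e i.
pose h v : R := 2 * (1 - sq v) ^+ 2 + (2 - sq v) ^+ 2 * (2 * H v) +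
   dot n v * ((2 - sq v) ^+ 2 * 'D_n H v - 4 * dot n v * (2 - sq v) * H v).
have HC : C1 H by exact: C1_cocrest.
have hcont : continuous (fun z => h (z - m)).
  have c1 : continuous (fun v : P => sq v) by exact: sq_cont.
  have c2 : continuous (dot n) by apply: C1_continuous; exact: C1_dot.
  have c3 := @C1_cont _ _ H n HC; have c4 := C1_continuous HC.
  have cc (a : R) : continuous (fun _ : P => a) by exact: cont_cst.
  have hc : continuous h.
    apply: contD; first apply: contD.
    - by apply: contM => //; apply: contX; exact: contB.
    - by apply: contM; [apply: contX; exact: contB | exact: contM].
    - apply: contM => //; apply: contB.
        by apply: contM => //; apply: contX; exact: contB.
      by apply: contM => //; apply: contM; [exact: contM | exact: contB].
  move=> z; apply: (@continuous_comp _ _ _ (fun z : P => z - m) h); last exact: hc.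
  exact: differentiable_continuous.
pose g z := l z ^+ 2.
have lC : C1 l by exact: (C1_trans m (C1_dot n)).
have gC : C1 g by exact: C1X.
have dg z : f z < 2 -> 'D_(F z) g z = - (2 * h (z - m)) * g z.
  move=> fz.
  have dl : 'D_(F z) l z = - (l z * h (z - m)).
    rewrite (derive_trans m z (F z) (C1_dot n)).
    have [_ ->] := is_derive_dot n (z - m) (F z).
    rewrite dotC dot_field (derive_Lev_disc e L4 _ kN fz).
    rewrite (congr1 (@^~ (z - m)) (derive_profile_split e i n)) /= -/n -/(l z).
    have nn : dot n n = 1 by rewrite -/(sq n) sq_rot e_unit.
    by rewrite nn /h -/H -/(l z); ring.
  have [_ ->] := is_derive_pX 1 (C1_is_derive z (F z) lC).
  by rewrite dl expr1 /g; ring.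
have g0 t : 0 <= g (x t) by exact: sqr_ge0.
have g2 t : t <= 0 -> g (x t) <= 1.
  move=> t0; apply: le_trans (f1 t t0).
  by apply: le_trans (CauchyS _ _) _; rewrite sq_rot e_unit mul1r.
have he : h (p - m) = 2 * H (e i).
  by rewrite pm /h /n dot_rot e_unit subrr; ring.
have H0 : 0 < H (e i) by exact: cocrest_gt0.
have [T1 HT1] : exists T, forall t, t < T -> H (e i) < h (x t - m).
  have [|T HT] := near_Ny_comp (M := - H (e i)) xp (contN hcont).
    by rewrite he; lra.
  by exists T => t /HT; lra.
(* before [T1] a nonzero [l] would have exceeded 1 at the time [a] *)
have gearly t : t <= 0 -> t < T1 -> g (x t) = 0.
  move=> t0 tT; apply/eqP; rewrite eq_le g0 andbT leNgt; apply/negP => gt0.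
  pose c := 2 * H (e i); have c0 : 0 < c by rewrite mulr_gt0.
  pose a := t - (g (x t))^-1 / c.
  have at_ : a <= t by rewrite gerBl divr_ge0 ?invr_ge0// ltW.
  have := seg_exp (k := c) gC (seg a t t0) at_.
  have -> : c * (t - a) = (g (x t))^-1 by rewrite /a; field; rewrite !gt_eqF.
  move=> D; have {D} : g (x t) * expR (g (x t))^-1 <= g (x a).
    apply: D => s /andP[as_ st]; rewrite dg; last by apply: f2; rewrite (le_trans (ltW st)).
    rewrite !mulNr lerN2; apply: ler_wpM2r => //.
    by rewrite /c; have := HT1 s (lt_trans st tT); lra.
  have := g2 a (le_trans at_ t0).
  have := expR_ge1Dx (g (x t))^-1.
  rewrite -(ler_pM2l gt0) mulrDr mulr1 mulfV ?gt_eqF//.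
  by lra.
(* after [T1] the coefficient [h] is bounded below on a compact interval *)
have gzero t : t <= 0 -> g (x t) = 0.
  move=> t0; have [tT|tT] := ltP t T1; first exact: gearly.
  pose a := T1 - 1; have at_ : a <= t by rewrite /a; lra.
  have ga : g (x a) = 0 by apply: gearly; [exact: le_trans at_ t0 | rewrite /a; lra].
  have [c _ Hc] := EVT_min at_ (within_comp hcont (seg a t t0).1).
  have := seg_exp (k := 2 * h (x c - m)) gC (seg a t t0) at_; rewrite ga => D.
  have {D} : g (x t) * expR (2 * h (x c - m) * (t - a)) <= 0.
    apply: D => s /andP[as_ st]; rewrite dg; last by apply: f2; rewrite (le_trans (ltW st)).
    rewrite !mulNr lerN2; apply: ler_wpM2r => //.
    have := Hc s; rewrite in_itv /= (ltW as_) (ltW st) => /(_ isT).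
    by lra.
  rewrite pmulr_lle0 ?expR_gt0// => gt.
  by apply/eqP; rewrite eq_le gt g0.
have onray t : t <= 0 -> x t = m + dot (e i) (x t - m) *: e i.
  move=> t0; have := gzero t t0; move/eqP; rewrite sqrf_eq0 => /eqP lt0.
  have := frame (x t - m) (e_unit i); rewrite -/n -/(l (x t)) lt0 scale0r addr0 => <-.
  by rewrite addrC subrK.
have fr t : t <= 0 -> f (x t) = dot (e i) (x t - m) ^+ 2.
  by move=> t0; rewrite {1}/f {1}(onray t t0) addrC addKr sqZ e_unit mulr1.
exists (dot (e i) (q - m)); last by rewrite -x0; exact: onray.
have r1 : dot (e i) (q - m) ^+ 2 <= 1 by rewrite -x0 -fr// f1.
rewrite -(@ltr_pXn2r _ 2%N) ?nnegrE// expr1n real_normK ?num_real//.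
rewrite lt_neqAle r1 andbT; apply/eqP => E; apply: qp.
(* on the unit circle the trajectory would rest at [q], which is then its limit *)
have f1' t : t <= 0 -> f (x t) = 1.
  move=> t0; apply/eqP; rewrite eq_le f1//= -E -x0 -fr//.
  exact: fmono.
have still t : t <= 0 -> x t = q.
  move=> t0; apply/eqP; rewrite -x0 -subr_eq0 -sq_eq0 eq_le sq_ge0 andbT.
  have kC : C1 (fun z => sq (x 0 - z)).
    by under eq_fun do rewrite sqBC; exact: (C1_trans (x 0) C1_sq).
  rewrite sqBC.
  have := seg_mono (C1N kC) (seg t 0 (lexx 0)) t0.
  rewrite subrr sq0 oppr0 lerNr oppr0; apply => s /andP[_ s0].
  have -> : F (x s) = 0.
    rewrite (onray s (ltW s0)) field_ray -fr ?ltW//; last by rewrite f1' ?ltr1n// ltW.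
    by rewrite f1' ?ltW// subrr expr0n mulr0 oppr0 scale0r.
  by rewrite derive0.
have : x t @[t --> -oo] --> q.
  apply/cvgrPdist_lt => eps eps0; exists 0; split; first exact: num_real.
  by move=> t /ltW/still ->; rewrite subrr normr0.
by move=> h'; apply: (cvg_unique _ h' xp).
Qed.

Lemma unstable_nonempty : exists2 q, unstable_manifold F p q & q <> p.
Proof.
pose x t : P := m + (1 * orbit_radius (t + 0)) *: e i.
exists (x 0); last first.
  rewrite /x /p mul1r => /addrI/eqP; rewrite -subr_eq0 -{2}(scale1r (e i)) -scalerBl.
  rewrite scaler_eq0 -sq_eq0 e_unit oner_eq0 orbF subr_eq0 => /eqP h.
  by have := orbit_radius_lt1 (0 + 0 : R); rewrite h ltxx.
exists x; split=> //; first by apply: ray_solution; rewrite expr1n.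
apply/cvgrPdist_lt => eps eps0.
have [T HT] := orbit_radius_cvg eps0.
exists T; split; first exact: num_real.
move=> t tT; have := HT t (ltW tT) => h.
rewrite -(@ltr_pXn2r _ 2%N) ?nnegrE ?(ltW eps0)//.
apply: le_lt_trans (norm_sq _) _.
have -> : p - x t = (1 - orbit_radius t) *: e i.
  by rewrite /x /p addr0 mul1r scalerBl scale1r opprD addrACA subrr add0r.
rewrite sqZ e_unit mulr1 ltr_pXn2r ?nnegrE ?(ltW eps0)//.
by rewrite subr_ge0 ltW// orbit_radius_lt1.
Qed.

Lemma well_isolated : isolated (local_minima V) m.
Proof.
split; first by apply/mem_set; exact: well_local_min.
exists [set z | f z < 1].
  by apply: near_disc; rewrite subrr sq0.
apply/seteqP; split=> z /=; last first.
  move=> ->; rewrite /f subrr sq0; split=> //; exact: well_local_min.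
case=> fz /(local_min_well e_unit L4 (leq_ltn_trans (leq0n k) kN))[k' k'N zE].
have [kk'|kk'] := eqVneq k k'; first by rewrite zE /m kk'.
have fz2 : sq (z - well L k) <= 2 by rewrite (le_trans (ltW fz))// ler1n.
have := well_far L4 kk' fz2.
by rewrite {1}zE subrr sq0 leNgt ltr0n.
Qed.

End Escape.

(** * Moving wells *)

Section WellProduct.
Context {R : realType} {T : finType}.
Notation P := 'rV[R]_2.
Implicit Types (B : {set T}) (c : T -> P) (v z : P) (s t : T).

Definition wells B c z : R := \prod_(s in B) sq (z - c s).

Lemma C1_wells B c : C1 (wells B c).
Proof. by apply: C1_prod => s; exact: (C1_trans (c s) C1_sq). Qed.

(** Logarithmic derivatives add up over a product. *)
Lemma wells_slope B c v z (lam : T -> R) :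
  (forall s, s \in B -> 0 < sq (z - c s)) ->
  (forall s, s \in B -> lam s * sq (z - c s) <= 2 * dot (z - c s) v) ->
  (\sum_(s in B) lam s) * wells B c z <= 'D_v (wells B c) z.
Proof.
move=> q0 ql; rewrite /wells.
elim: (index_enum T) => [|s r IH].
  have -> : (fun z => \prod_(t <- [::] | t \in B) sq (z - c t)) = (fun=> 1).
    by apply/funext => y; rewrite big_nil.
  by rewrite !big_nil derive_cst mul0r.
have -> : (fun z => \prod_(t <- s :: r | t \in B) sq (z - c t)) =
    (fun z => if s \in B then sq (z - c s) * \prod_(t <- r | t \in B) sq (z - c t)
              else \prod_(t <- r | t \in B) sq (z - c t)).
  by apply/funext => y; rewrite big_cons.
rewrite !big_cons; case: ifP => sB; last exact: IH.
have p0 : 0 < \prod_(t <- r | t \in B) sq (z - c t) by exact: prodr_gt0.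
have qs := q0 s sB.
have C1r : C1 (fun z => \prod_(t <- r | t \in B) sq (z - c t)).
  by apply: C1_prod => t; exact: (C1_trans (c t) C1_sq).
rewrite (C1_deriveM z v (C1_trans (c s) C1_sq) C1r) (derive_trans (c s) z v C1_sq).
have [_ ->] := is_derive_sq (z - c s) v.
set q := sq (z - c s) in qs *; set pr := \prod_(_ <- r | _) _ in p0 IH *.
have h1 : 0 <= (2 * dot (z - c s) v - lam s * q) * pr.
  by rewrite mulr_ge0 ?(ltW p0)// subr_ge0; exact: ql.
have h2 : 0 <= q * ('D_v (fun z => \prod_(t <- r | t \in B) sq (z - c t)) z -
    (\sum_(t <- r | t \in B) lam t) * pr).
  by rewrite mulr_ge0 ?(ltW qs)// subr_ge0.
by lra.
Qed.

(** Relative slopes of the factors of [wells] near the well [s]: its own factor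
grows quadratically, and each of the others may lose a share that is small
enough for the total to stay positive. *)
Definition pull s t : R := if t == s then 2 else - #|T|.+1%:R^-1.

Lemma pull_dominates B s : s \in B -> 1 <= \sum_(t in B) pull s t.
Proof.
move=> sB; rewrite (bigD1 s)//= {1}/pull eqxx.
have -> : \sum_(t in B | t != s) pull s t =
    - (#|[pred t in B | t != s]|%:R * #|T|.+1%:R^-1).
  rewrite (eq_bigr (fun=> - #|T|.+1%:R^-1)); last first.
    by move=> t /andP[_ /negPf ts]; rewrite /pull ts.
  by rewrite sumr_const -[LHS]mulr_natl mulrN.
have : #|[pred t in B | t != s]|%:R * #|T|.+1%:R^-1 <= 1 :> R.
  rewrite ler_pdivrMr ?ltr0n// mul1r ler_nat.
  exact: leqW (max_card _).
by move: (_ * _) => x; lra.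
Qed.

Lemma dot_bound u v (mu : R) : 0 <= mu -> 4 * sq v <= mu ^+ 2 * sq u ->
  - mu * sq u <= 2 * dot u v.
Proof.
move=> mu0 h; have u0 := sq_ge0 u.
have : (2 * dot u v) ^+ 2 <= (mu * sq u) ^+ 2.
  have := CauchyS u v; have : 0 <= sq u * (mu ^+ 2 * sq u - 4 * sq v).
    by rewrite mulr_ge0// subr_ge0.
  by lra.
have m0 : 0 <= mu * sq u by rewrite mulr_ge0.
rewrite -(real_normK (num_real (2 * dot u v))) ler_pXn2r ?nnegrE// => /lerNnormlW.
by rewrite mulNr.
Qed.

Definition well_radius (d2 : R) : R := d2 / 10 / (#|T|.+1%:R ^+ 2).
Definition well_stiffness (d2 : R) : R := (d2 / 4) ^+ #|T|.

Lemma well_radius_gt0 d2 : 0 < d2 -> 0 < well_radius d2.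
Proof. by move=> h; rewrite !divr_gt0// exprn_gt0. Qed.

Lemma well_stiffness_gt0 d2 : 0 < d2 -> 0 < well_stiffness d2.
Proof. by move=> h; rewrite exprn_gt0// divr_gt0. Qed.

(** The other wells are so far that their relative slopes are at most the share
allowed by [pull], and each of them contributes a factor of at least [d2 / 4].
The bound depends only on the separation of the wells: it is uniform in time
while they move. *)
Lemma wells_stiff B c s (d2 : R) z : 0 < d2 -> d2 <= 1 -> s \in B ->
  (forall t, t \in B -> t != s -> d2 <= sq (c t - c s)) ->
  sq (z - c s) < well_radius d2 ->
  well_stiffness d2 * sq (z - c s) <= 'D_(z - c s) (wells B c) z.
Proof.
move=> d0 d1 sB sep zr.
have [->|zs] := eqVneq z (c s); first by rewrite subrr sq0 mulr0 derive0.
have A0 : 0 < sq (z - c s) by rewrite sq_gt0 subr_eq0.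
pose mu : R := #|T|.+1%:R^-1.
have n1 : (1 : R) <= #|T|.+1%:R by rewrite ler1n.
have mu0 : 0 < mu by rewrite invr_gt0 ltr0n.
have mu1 : mu <= 1 by rewrite invf_le1.
have mu2 : mu ^+ 2 <= 1 by rewrite expr_le1// ltW.
have rE : well_radius d2 = mu ^+ 2 * d2 / 10.
  by rewrite /well_radius /mu exprVn; field; rewrite gt_eqF// (lt_le_trans _ n1).
rewrite rE in zr.
set A := sq (z - c s) in zr A0 *.
have far t : t \in B -> t != s -> d2 / 4 <= sq (z - c t) /\ 4 * A <= mu ^+ 2 * sq (z - c t).
  move=> tB ts; have := sep t tB ts.
  have -> : c t - c s = (z - c s) - (z - c t) by rewrite opprB [RHS]addrC addrA subrK.
  rewrite sqB -/A; set B2 := sq (z - c t) => h.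
  have h2 : 0 <= A + 2 * dot (z - c s) (z - c t) + B2.
    by have := sq_ge0 ((z - c s) + (z - c t)); rewrite sqD.
  have Bd : d2 / 2 - A <= B2 by lra.
  have md : 0 <= (1 - mu ^+ 2) * d2 by rewrite mulr_ge0 ?(ltW d0)// subr_ge0.
  have mB : 0 <= mu ^+ 2 * (B2 - (d2 / 2 - A)) by rewrite mulr_ge0 ?sqr_ge0// subr_ge0.
  have mA : 0 <= (1 - mu ^+ 2) * A by rewrite mulr_ge0 ?(ltW A0)// subr_ge0.
  by split; lra.
have q0 t : t \in B -> 0 < sq (z - c t).
  move=> tB; have [->//|ts] := eqVneq t s.
  by have [h _] := far t tB ts; lra.
pose lam := pull s.
have ql t : t \in B -> lam t * sq (z - c t) <= 2 * dot (z - c t) (z - c s).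
  move=> tB; rewrite /lam /pull -/mu; have [->|ts] := eqVneq t s; first exact: lexx.
  by have [_ h] := far t tB ts; apply: dot_bound => //; exact: ltW.
have := wells_slope q0 ql.
have sl : 1 <= \sum_(t in B) lam t := pull_dominates sB.
have w0 : 0 < wells B c z by apply: prodr_gt0.
have wA : well_stiffness d2 * A <= wells B c z.
  rewrite /wells (bigD1 s)//= -/A mulrC ler_pM2l//.
  apply: (@le_trans _ _ (\prod_(t in B | t != s) (d2 / 4))); last first.
    apply: ler_prod => t /andP[tB ts]; have [h _] := far t tB ts.
    by rewrite h divr_ge0// ltW.
  rewrite prodr_const /well_stiffness; apply: ler_wiXn2l; last exact: max_card.
    by rewrite divr_ge0// ltW.
  by lra.
move=> h; apply: le_trans h; apply: le_trans wA _.
by rewrite ler_peMl// ltW.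
Qed.

(** Moving [p] away from [m] increases its distance to every well in the closed
unit disc around [m], and the other wells are too distant for their shares to
matter. *)
Lemma wells_push B c s m p : s \in B -> c s = m -> sq (p - m) = 1 ->
  (forall t, t \in B -> c t != p) ->
  (forall t, t \in B -> sq (c t - m) <= 1 \/ (2 * #|T|.+1%:R) ^+ 2 <= sq (p - c t)) ->
  0 < 'D_(p - m) (wells B c) p.
Proof.
move=> sB cs pm cp ctr; pose mu : R := #|T|.+1%:R^-1.
have mu0 : 0 < mu by rewrite invr_gt0 ltr0n.
have q0 t : t \in B -> 0 < sq (p - c t).
  by move=> tB; rewrite sq_gt0 subr_eq0 eq_sym cp.
pose lam := pull s.
have ql t : t \in B -> lam t * sq (p - c t) <= 2 * dot (p - c t) (p - m).
  move=> tB; rewrite /lam /pull -/mu; have [->|ts] := eqVneq t s; first by rewrite cs; exact: lexx.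
  have [near|far] := ctr t tB.
    have h := sqB (p - c t) (p - m).
    have E : p - c t - (p - m) = - (c t - m) by rewrite !opprB [LHS]addrC addrA subrK.
    rewrite E sqN pm in h.
    have : 0 < mu * sq (p - c t) by rewrite mulr_gt0// q0.
    have := q0 t tB.
    by lra.
  apply: dot_bound; first exact: ltW.
  rewrite pm mulr1 /mu exprVn mulrC ler_pdivlMr ?exprn_gt0//.
  by move: far; rewrite exprMn; lra.
have := wells_slope q0 ql.
have sl : 1 <= \sum_(t in B) lam t := pull_dominates sB.
apply: lt_le_trans; rewrite mulr_gt0//; first by lra.
by apply: prodr_gt0.
Qed.

Lemma radial_continuous (f : P -> R) m : C1 f -> continuous (fun z => 'D_(z - m) f z).
Proof.
move=> fC.
have -> : (fun z => 'D_(z - m) f z) = (fun z => (z - m) 0 0 * 'D_(delta_mx 0 0) f z +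
    (z - m) 0 1 * 'D_(delta_mx 0 1) f z).
  apply/funext => z; rewrite -derive_lin//; congr ('D_ _ f z).
  by apply: planeP; rewrite !mxE /= !mulr1 !mulr0 ?addr0 ?add0r.
have cc (j : 'I_2) : continuous (fun z : P => (z - m) 0 j).
  by apply: C1_continuous; exact: (C1_trans m (C1_coord j)).
by apply: contD; apply: contM => //; exact: C1_cont.
Qed.

Lemma wells_coercive B c (M : R) : (exists s, s \in B) ->
  exists r, forall z, r < `|z| -> M < wells B c z.
Proof.
move=> [s sB]; exists (\sum_t `|c t| + 1 + `|M|) => z zr.
have big t : 1 + `|M| <= sq (z - c t).
  have ct : `|c t| <= \sum_t `|c t|.
    by rewrite (bigD1 t)//= lerDl sumr_ge0.
  have h : 1 + `|M| <= `|z - c t|.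
    by have := lerB_dist z (c t); lra.
  apply: le_trans (norm_sq _).
  have M0 := normr_ge0 M.
  have : 0 <= (`|z - c t| - (1 + `|M|)) * `|z - c t| by rewrite mulr_ge0// subr_ge0.
  have : 0 <= `|M| * `|z - c t| by rewrite mulr_ge0.
  by rewrite expr2; lra.
have M0 := ler_norm M; have M1 := normr_ge0 M.
rewrite /wells (bigD1 s)//=; apply: (@lt_le_trans _ _ (1 + `|M|)); first by lra.
apply: le_trans (big s) _; rewrite ler_peMr ?sq_ge0//.
have : \prod_(t in B | t != s) (1 : R) <= \prod_(t in B | t != s) sq (z - c t).
  by apply: ler_prod => t _; rewrite ler01 /=; have := big t; lra.
by rewrite big1_eq.
Qed.

End WellProduct.

(** * Connections along a branch *)

Section Branches.
Context {R : realType} {d : nat}.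
Notation P := 'rV[R]_d.
Variable V : P -> R -> R.
Implicit Types (A : set R) (c y : R -> P) (a b u v : R) (p q z : P).

Let crit u := critical_points (V^~ u).

Lemma within_dist A c y u : {within A, continuous c} -> {within A, continuous y} -> A u ->
  (fun s => `|y s - c s|) @ within A (nbhs u) --> `|y u - c u|.
Proof.
move=> /subspace_continuousP cc /subspace_continuousP yc Au.
by apply: cvg_norm; apply: cvgB; [exact: yc | exact: cc].
Qed.

(** The neighbourhood in which [c] is the only critical point has a radius that is
locally uniform in the input: isolation at each input would not prevent other
branches from touching [c]. *)
Definition rigid A c := forall u, A u -> exists2 rho : R, 0 < rho &
  \forall v \near u, A v -> forall z, crit v z -> `|z - c v| < rho -> z = c v.

(** The set of inputs at which the branches agree is open by rigidity, and closed
by continuity. *)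
Lemma branch_unique A c y u : connected A -> {within A, continuous c} ->
  {within A, continuous y} -> rigid A c -> (forall v, A v -> crit v (y v)) ->
  A u -> y u = c u -> forall v, A v -> y v = c v.
Proof.
move=> Aconn cc yc rc ycrit Au yu.
pose B := [set v | A v /\ y v = c v].
suff BA : B = A by move=> v; rewrite -BA => -[].
apply: Aconn; first by exists u.
- exists (interior [set v | A v -> y v = c v]); first exact: open_interior.
  apply/seteqP; split=> [v [Av yv]|v [Av /interior_subset/=]]; last by move=> /(_ Av).
  split=> //; have [rho rho0 near1] := rc v Av.
  have near2 : \forall s \near within A (nbhs v), `|y s - c s| < rho.
    apply: (cvgr_lt _ (within_dist cc yc Av)).
    by rewrite yv subrr normr0.
  rewrite near_withinE in near2.
  apply: filterS2 near1 near2 => s n1 n2 As.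
  by apply: n1 => //; [exact: ycrit | exact: n2].
- exists (closure B); first exact: closed_closure.
  apply/seteqP; split=> [v Bv|v [Av cBv]].
    by split; [case: Bv | exact: subset_closure].
  split=> //; apply/eqP; apply: contrapT => /negP; rewrite -subr_eq0 -normr_gt0 => pos.
  have near2 : \forall s \near within A (nbhs v), 0 < `|y s - c s|.
    by apply: (cvgr_gt _ (within_dist cc yc Av)).
  rewrite near_withinE in near2.
  have [s [[As ys] ns]] := cBv _ near2.
  by have := ns As; rewrite ys subrr normr0 ltxx.
Qed.

Lemma branch_limit A c y b : {within A, continuous c} -> {within A, continuous y} ->
  A b -> closure (A `\ b) b -> (forall v, A v -> v != b -> y v = c v) -> y b = c b.
Proof.
move=> cc yc Ab clb yv; apply/eqP; apply: contrapT => /negP.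
rewrite -subr_eq0 -normr_gt0 => pos.
have near2 : \forall s \near within A (nbhs b), 0 < `|y s - c s|.
  by apply: (cvgr_gt _ (within_dist cc yc Ab)).
rewrite near_withinE in near2.
have [s [[As sb] ns]] := clb _ near2.
by have := ns As; rewrite yv// ?subrr ?normr0 ?ltxx//; exact/eqP.
Qed.

(** A nontrivial orbit of the unstable manifold converges to both minima. *)
Lemma escape_unique u p q q' : (exists2 w, unstable_manifold (field V u) p w & w <> p) ->
  escapes_to V u p q -> escapes_to V u p q' -> q = q'.
Proof.
move=> [w wu wp] [_ _ bq] [_ _ bq'].
have [[x [xs x0]] _] := bq w (conj wu wp).
have h := (bq w (conj wu wp)).2 x xs x0.
have h' := (bq' w (conj wu wp)).2 x xs x0.
by apply: (cvg_unique _ h h').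
Qed.

Lemma rigid_isolated A c u : rigid A c -> A u -> crit u (c u) ->
  isolated (crit u) (c u).
Proof.
move=> rc Au cu; split; first exact/mem_set.
have [rho rho0 near1] := rc u Au.
exists [set z | `|z - c u| < rho].
  apply/nbhs_ballP; exists rho => //= z; rewrite -ball_normE /= distrC; exact.
apply/seteqP; split=> z /=; last by move=> ->; rewrite subrr normr0.
by move=> [zr zc]; apply: (nbhs_singleton near1).
Qed.

Lemma closure_near A b : (forall r : R, 0 < r -> exists2 s, A s & `|b - s| < r) -> closure A b.
Proof.
by move=> H N /nbhs_ballP[r /= r0 rN]; have [s As sr] := H r r0; exists s; split=> //; exact: rN.
Qed.

(** Rigidity is lost at a fold [b], and the agreement is obtained there by
continuity. *)
Lemma agree_at_end A c y a b : {within A, continuous c} -> {within A, continuous y} ->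
  A b -> connected (A `\ b) -> closure (A `\ b) b -> rigid (A `\ b) c ->
  (forall v, (A `\ b) v -> crit v (y v)) -> (A `\ b) a -> y a = c a -> y b = c b.
Proof.
move=> cc yc Ab Aconn clb rc ycrit Aa ya; apply: (branch_limit cc yc Ab clb) => v Av /eqP vb.
have sub : A `\ b `<=` A by move=> t [].
by apply: (branch_unique Aconn (continuous_subspaceW sub cc) (continuous_subspaceW sub yc)
  rc ycrit Aa ya); split.
Qed.

(** By continuity the branch brings critical points close to [c b] for inputs of
[K] close to [b]. *)
Lemma no_inner_fold A (K : set R) c b (rho : R) : {within A, continuous c} -> A b ->
  0 < rho -> closure (A `&` K) b -> (forall u, (A `&` K) u -> crit u (c u)) ->
  (forall u x, K u -> `|x - c b| < rho -> ~ crit u x) -> False.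
Proof.
move=> /subspace_continuousP cw Ab rho0 clb ccrit kill.
have near2 : \forall s \near within A (nbhs b), `|c b - c s| < rho.
  by move: (cw b Ab) => /cvgrPdist_lt/(_ rho rho0).
rewrite near_withinE in near2.
have [s [[As Ks] ns]] := clb _ near2.
by apply: (kill s (c s) Ks); [rewrite distrC; exact: ns | exact: ccrit].
Qed.

Lemma rigidS A A' c : A `<=` A' -> rigid A' c -> rigid A c.
Proof.
move=> AA rc u Au; have [r r0 near1] := rc u (AA _ Au); exists r => //.
by apply: filterS near1 => v n1 Av; apply: n1; exact: AA.
Qed.

Lemma itv_cD1 a b : `[a, b]%classic `\ b = `[a, b[%classic.
Proof.
apply/seteqP; split=> t /=; rewrite !in_itv /=.
  by move=> [/andP[-> tb] /eqP tnb]; rewrite lt_neqAle tnb.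
by move=> /andP[-> tb]; split; [exact: ltW | move=> E; rewrite E ltxx in tb].
Qed.

Lemma itv_oD1 a b : `[a, b]%classic `\ a = `]a, b]%classic.
Proof.
apply/seteqP; split=> t /=; rewrite !in_itv /=.
  by move=> [/andP[at_ ->] /eqP tna]; rewrite andbT lt_neqAle eq_sym tna.
by move=> /andP[at_ ->]; split; [rewrite andbT; exact: ltW | move=> E; rewrite E ltxx in at_].
Qed.

Lemma closure_right a b : a < b -> closure `[a, b[%classic b.
Proof.
move=> ab; apply: closure_near => r r0.
have sb : Num.max a (b - r / 2) < b by rewrite gt_max ab /= ltrBlDr ltrDl divr_gt0.
have sr : b - r / 2 <= Num.max a (b - r / 2) by rewrite le_max lexx orbT.
exists (Num.max a (b - r / 2)); first by rewrite /= in_itv /= sb andbT le_max lexx.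
by rewrite gtr0_norm ?subr_gt0//; lra.
Qed.

Lemma closure_left a b : a < b -> closure `]a, b]%classic a.
Proof.
move=> ab; apply: closure_near => r r0.
have sb : a < Num.min b (a + r / 2) by rewrite lt_min ab /= ltrDl divr_gt0.
have sr : Num.min b (a + r / 2) <= a + r / 2 by rewrite ge_min lexx orbT.
exists (Num.min b (a + r / 2)); first by rewrite /= in_itv /= sb /= ge_min lexx.
by rewrite ltr0_norm ?subr_lt0//; lra.
Qed.

Lemma itv_connected (i : interval R) : connected [set` i].
Proof. by apply/connected_intervalP; exact: interval_is_interval. Qed.

Section Up.
Variables (um up : R) (c : R -> P) (q0 : P).
Hypothesis mp : um < up.
Hypothesis cc : {within `[um, up], continuous c}.
Hypothesis crigid : rigid `[um, up[ c.
Hypothesis ccrit : forall u, um <= u < up -> crit u (c u).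
Hypothesis cmin : forall u, um <= u < up -> local_minima (V^~ u) (c u).
Hypothesis ciso : isolated (crit up) (c up).
Hypothesis ckill : exists rho delta : R, [/\ 0 < rho, 0 < delta
  & forall u x, up < u < up + delta -> `|x - c up| < rho -> ~ crit u x].
Hypothesis cesc : escapes_to V up (c up) q0.
Hypothesis cun : exists2 w, unstable_manifold (field V up) (c up) w & w <> c up.

Lemma connects_up_branch : connects_up V um up (c um) q0.
Proof.
have one : connects1_up V um up (c um) q0.
  split=> //; exists c; split=> //; split=> // u /andP[h1 h2].
  move: h2; rewrite le_eqVlt => /orP[/eqP -> //|h2].
  have uI : `[um, up[%classic u by rewrite /= in_itv /= h1 h2.
  by apply: rigid_isolated crigid uI _; apply: ccrit; rewrite h1 h2.
exists 1%N, (fun k => if k == 0%N then um else up),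
  (fun k => if k == 0%N then c um else q0); split=> //; last by case.
split=> //; first by case.
case=> [|[|//]] _ /=; first by apply: cmin; rewrite lexx.
by have [_ /isolatedS] := cesc.
Qed.

(** The first step of a chain follows [c] as far as the input [b] where it folds.
For [b < up] the point [c b] would have to disappear beyond [b], but it persists;
so the chain consists of a single step, which ends at the escape of [c up]. *)
Lemma connects_up_branch_unique q : connects_up V um up (c um) q -> q = q0.
Proof.
move=> [l [v [xs [[l1 v0 vl vmono _] xs0 xsl steps]]]].
have [vb [ys [[ysc ysiso] ys0 _ [rho [delta [rho0 delta0 kill]]] esc]]] := steps 0%N l1.
set b := v 1%N in vb ysc ysiso ys0 kill esc; rewrite v0 in vb ysc ysiso ys0.
have vle k : (0 < k <= l)%N -> b <= v k.
  elim: k => [//|[|k] IH] // kl; apply: le_trans (IH _) (ltW (vmono _ _)); lia.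
have bup : b <= up by rewrite -vl; apply: vle; lia.
have cb : {within `[um, b], continuous c}.
  apply: continuous_subspaceW cc => t /=; rewrite !in_itv /= => /andP[-> h].
  exact: le_trans bup.
have yb : ys b = c b.
  apply: (agree_at_end (a := um) cb ysc); rewrite ?itv_cD1.
  - by rewrite /= in_itv /= lexx ltW.
  - exact: itv_connected.
  - exact: closure_right.
  - apply: rigidS crigid => t /=; rewrite !in_itv /= => /andP[-> h].
    exact: lt_le_trans bup.
  - move=> s /=; rewrite in_itv /= => /andP[h1 h2].
    by apply: isolatedS; apply: ysiso; rewrite h1 ltW.
  - by rewrite /= in_itv /= lexx.
  - by rewrite ys0 xs0.
have bE : b = up.
  apply/eqP; rewrite eq_le bup leNgt; apply/negP => bltup.
  apply: (no_inner_fold (K := `]b, b + delta[%classic) (b := b) cc _ rho0).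
  - by rewrite /= in_itv /= ltW.
  - have bm : b < Num.min (b + delta / 2) up by rewrite lt_min bltup ltrDl divr_gt0.
    apply: closureS (closure_left bm) => t /=; rewrite !in_itv /= le_min.
    move=> /andP[bt /andP[td ->]]; rewrite bt andbT; split; first by rewrite ltW// (lt_trans vb).
    by apply: le_lt_trans td _; rewrite ltrD2l ltr_pdivrMr// ltr_pMr// ltr1n.
  - move=> u [/=]; rewrite !in_itv /= => /andP[h1 h2] _.
    move: h2; rewrite le_eqVlt => /orP[/eqP ->|h2]; first exact: isolatedS ciso.
    by apply: ccrit; rewrite h1.
  - by move=> u x /=; rewrite in_itv /= -yb; exact: kill.
have lE : l = 1%N.
  case: l l1 vl vmono xsl steps vle => // -[|l] // _ vl vmono _ _ vle.
  have := vmono l.+1 (leqnn _); rewrite vl -bE.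
  by move=> h; have := lt_le_trans h (vle l.+1 ltac:(lia)); rewrite ltxx.
rewrite yb bE -/(xs 1%N) in esc; rewrite -xsl lE.
exact: escape_unique cun esc cesc.
Qed.

End Up.

Section Down.
Variables (um up : R) (c : R -> P) (q0 : P).
Hypothesis mp : um < up.
Hypothesis cc : {within `[um, up], continuous c}.
Hypothesis crigid : rigid `]um, up] c.
Hypothesis ccrit : forall u, um < u <= up -> crit u (c u).
Hypothesis cmin : forall u, um < u <= up -> local_minima (V^~ u) (c u).
Hypothesis ciso : isolated (crit um) (c um).
Hypothesis ckill : exists rho delta : R, [/\ 0 < rho, 0 < delta
  & forall u x, um - delta < u < um -> `|x - c um| < rho -> ~ crit u x].
Hypothesis cesc : escapes_to V um (c um) q0.
Hypothesis cun : exists2 w, unstable_manifold (field V um) (c um) w & w <> c um.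

Lemma connects_down_branch : connects_down V um up (c up) q0.
Proof.
have one : connects1_down V um up (c up) q0.
  split=> //; exists c; split=> //; split=> // u /andP[h1 h2].
  move: h1; rewrite le_eqVlt => /orP[/eqP <- //|h1].
  have uI : `]um, up]%classic u by rewrite /= in_itv /= h1 h2.
  by apply: rigid_isolated crigid uI _; apply: ccrit; rewrite h1 h2.
exists 1%N, (fun k => if k == 0%N then um else up),
  (fun k => if k == 0%N then q0 else c up); split=> //; last by case.
split=> //; first by case.
case=> [|[|//]] _ /=; last by apply: cmin; rewrite mp lexx.
by have [_ /isolatedS] := cesc.
Qed.

(** As for increasing inputs, with the last step of the chain in place of the
first one. *)
Lemma connects_down_branch_unique q : connects_down V um up (c up) q -> q = q0.
Proof.
move=> [l [v [xs [[l1 v0 vl vmono _] xsl xs0 steps]]]].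
have [k kE] : exists k, l = k.+1 by case: l l1 {vl vmono xsl steps} => // k _; exists k.
rewrite {l}kE in l1 vl vmono xsl steps.
have [vb [ys [[ysc ysiso] ysl _ [rho [delta [rho0 delta0 kill]]] esc]]] := steps k (leqnn _).
set b := v k in vb ysc ysiso kill esc; rewrite vl in vb ysc ysiso ysl.
have vle j : (j <= k)%N -> um <= v j.
  elim: j => [_|j IH jk]; first by rewrite v0.
  apply: le_trans (IH _) (ltW (vmono _ _)); lia.
have bum : um <= b by exact: vle.
have cb : {within `[b, up], continuous c}.
  apply: continuous_subspaceW cc => t /=; rewrite !in_itv /= => /andP[h ->].
  by rewrite (le_trans bum).
have yb : ys b = c b.
  apply: (agree_at_end (a := up) cb ysc); rewrite ?itv_oD1.
  - by rewrite /= in_itv /= lexx ltW.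
  - exact: itv_connected.
  - exact: closure_left.
  - apply: rigidS crigid => t /=; rewrite !in_itv /= => /andP[h ->].
    by rewrite (le_lt_trans bum).
  - move=> s /=; rewrite in_itv /= => /andP[h1 h2].
    by apply: isolatedS; apply: ysiso; rewrite h2 ltW.
  - by rewrite /= in_itv /= lexx andbT.
  - by rewrite ysl xsl.
have bE : b = um.
  apply/eqP; rewrite eq_le bum andbT leNgt; apply/negP => bltum.
  apply: (no_inner_fold (K := `]b - delta, b[%classic) (b := b) cc _ rho0).
  - by rewrite /= in_itv /= bum ltW.
  - have bm : Num.max (b - delta / 2) um < b by rewrite gt_max bltum ltrBlDr ltrDl divr_gt0.
    apply: closureS (closure_right bm) => t /=; rewrite !in_itv /= ge_max.
    move=> /andP[/andP[td ->] tb]; rewrite tb andbT; split; first by rewrite ltW// (lt_trans tb).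
    apply: lt_le_trans td; rewrite ltrD2l ltrN2 ltr_pdivrMr// ltr_pMr// ltr1n //.
  - move=> u [/=]; rewrite !in_itv /= => /andP[h1 h2] _.
    move: h1; rewrite le_eqVlt => /orP[/eqP <-|h1]; first exact: isolatedS ciso.
    by apply: ccrit; rewrite h1.
  - by move=> u x /=; rewrite in_itv /= -yb; exact: kill.
have kE : k = 0%N.
  have [//|k1] := posnP k.
  have := vmono k.-1 ltac:(lia).
  rewrite (prednK k1) -/b bE => h.
  by have := lt_le_trans h (vle k.-1 (leq_pred k)); rewrite ltxx.
rewrite yb bE kE xs0 in esc.
exact: escape_unique cun esc cesc.
Qed.

End Down.
End Branches.

(** * Interpolation between two consecutive inputs *)

Section Phases.
Context {R : realType}.
Implicit Types (x th : R) (j : nat).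

Definition clamp x : R := Num.max 0 (Num.min 1 x).

Lemma clamp_ge0 x : 0 <= clamp x.
Proof. by rewrite le_max lexx. Qed.
Lemma clamp_le1 x : clamp x <= 1.
Proof. by rewrite ge_max ler01 ge_min lexx. Qed.
Lemma clamp_lo x : x <= 0 -> clamp x = 0.
Proof. by move=> h; apply/max_idPl; rewrite ge_min h orbT. Qed.
Lemma clamp_hi x : 1 <= x -> clamp x = 1.
Proof. by move=> h; rewrite /clamp (min_idPl h); apply/max_idPr. Qed.
Lemma clamp_mid x : 0 <= x -> x <= 1 -> clamp x = x.
Proof. by move=> h h'; rewrite /clamp (min_idPr h'); apply/max_idPr. Qed.
Lemma clamp_mono x y : x <= y -> clamp x <= clamp y.
Proof.
by move=> h; rewrite /clamp ge_max !le_max lexx /= le_min !ge_min lexx h !orbT.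
Qed.
Lemma clamp_cont : continuous clamp.
Proof.
have ->  : clamp = (fun x => ppart (Num.min 1 x)) by apply/funext => x; rewrite /clamp /ppart maxC.
apply: (cont_comp (h := @ppart R)); first exact: ppart_cont.
by move=> x; apply: continuous_min; [exact: cvg_cst | exact: cvg_id].
Qed.

(** The unit interval is divided into five fifths, and the [j]-th phase is
performed during the fifth number [j], counted from 0. *)
Definition phase j th : R := clamp (5 * th - j%:R).

Lemma phase_ge0 j th : 0 <= phase j th. Proof. exact: clamp_ge0. Qed.
Lemma phase_le1 j th : phase j th <= 1. Proof. exact: clamp_le1. Qed.
Lemma phase_lo j th : 5 * th <= j%:R -> phase j th = 0.
Proof. by move=> h; apply: clamp_lo; lra. Qed.
Lemma phase_hi j th : j.+1%:R <= 5 * th -> phase j th = 1.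
Proof. by rewrite -natr1 => h; apply: clamp_hi; lra. Qed.
Lemma phase_cont j : continuous (phase j).
Proof.
apply: (cont_comp (h := clamp)); first exact: clamp_cont.
apply: contB; last exact: cont_cst.
by apply: contM; [exact: cont_cst | move=> x; exact: cvg_id].
Qed.
Lemma phase_mono j th th' : th <= th' -> phase j th <= phase j th'.
Proof. by move=> h; apply: clamp_mono; lra. Qed.
Lemma phase_gt0 j th : 0 < phase j th -> j%:R < 5 * th.
Proof. by rewrite ltNge => h; rewrite ltNge; apply: contra h => h; rewrite phase_lo. Qed.
Lemma phase_lt1 j th : phase j th < 1 -> 5 * th < j.+1%:R.
Proof. by rewrite ltNge => h; rewrite ltNge; apply: contra h => h; rewrite phase_hi. Qed.
Lemma phase_gt0E j th : j%:R < 5 * th -> 0 < phase j th.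
Proof.
move=> h; have [h1|h1] := leP (5 * th - j%:R) 1.
  by rewrite /phase clamp_mid//; lra.
by rewrite /phase clamp_hi ?ltr01// ltW.
Qed.
Lemma phase_lt1E j th : 5 * th < j.+1%:R -> phase j th < 1.
Proof.
rewrite -natr1 => h; have [h1|h1] := leP 0 (5 * th - j%:R).
  by rewrite /phase clamp_mid//; lra.
by rewrite /phase clamp_lo ?ltr01// ltW.
Qed.

End Phases.

Section Paths.
Context {R : realType}.
Notation P := 'rV[R]_2.
Implicit Types (a b : P) (h th : R).

(** Vertical to the private height [h], then horizontal, then vertical again:
at every time two such paths differ in abscissa or travel at their heights. *)
Definition path a b h th : P :=
  pt (a 0 0 + phase 2 th * (b 0 0 - a 0 0))
     ((1 - phase 1 th) * a 0 1 + (phase 1 th - phase 3 th) * h + phase 3 th * b 0 1).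

Lemma path_start a b h th : 5 * th <= 1 -> path a b h th = a.
Proof.
move=> t1; apply: planeP; rewrite !mxE /= !phase_lo; try lra.
all: by have : (2 : R) <= 3 by rewrite ler_nat; lra.
Qed.

Lemma path_end a b h th : 4 <= 5 * th -> path a b h th = b.
Proof.
move=> t1; apply: planeP; rewrite !mxE /= !phase_hi; try lra.
Qed.

Lemma path_cont0 a b h (j : 'I_2) : continuous (fun th => path a b h th 0 j).
Proof.
have pc := @phase_cont R; have cc (x : R) : continuous (fun _ : R => x) by exact: cont_cst.
case: (ord2 j) => ->.
  have -> : (fun th => path a b h th 0 0) = (fun th => a 0 0 + phase 2 th * (b 0 0 - a 0 0)).
    by apply/funext => th; rewrite mxE.
  by apply: contD => //; exact: contM.
have -> : (fun th => path a b h th 0 1) = (fun th => (1 - phase 1 th) * a 0 1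
     + (phase 1 th - phase 3 th) * h + phase 3 th * b 0 1).
  by apply/funext => th; rewrite mxE.
apply: contD; last exact: contM.
by apply: contD; apply: contM => //; exact: contB.
Qed.

Lemma rV_continuous (U : topologicalType) (g : U -> P) :
  (forall j, continuous (fun x => g x 0 j)) -> continuous g.
Proof.
move=> gc x; apply/cvgrPdist_lt => eps eps0.
have near1 j : \forall y \near x, `|g x 0 j - g y 0 j| < eps.
  by move: (gc j x) => /cvgrPdist_lt/(_ eps eps0).
near=> y; have h0 : `|g x 0 0 - g y 0 0| < eps by near: y; exact: near1.
have h1 : `|g x 0 1 - g y 0 1| < eps by near: y; exact: near1.
rewrite [ltLHS]/Num.Def.normr/= mx_normrE; apply: bigmax_lt => // -[i j] _ /=.
by rewrite (ord1 i) !mxE; case: (ord2 j) => ->.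
Unshelve. all: by end_near. Qed.

Lemma path_cont a b h : continuous (path a b h).
Proof. by apply: rV_continuous => j; exact: path_cont0. Qed.

Lemma path_sep a b h a' b' h' (del : R) th : 0 <= del ->
  del <= `|a 0 0 - a' 0 0| -> del <= `|b 0 0 - b' 0 0| -> del <= `|h - h'| ->
  del ^+ 2 <= sq (path a b h th - path a' b' h' th).
Proof.
move=> d0 da db dh.
have sqle (x : R) : del <= `|x| -> del ^+ 2 <= x ^+ 2.
  by move=> dx; rewrite -(real_normK (num_real x)) lerXn2r ?nnegrE.
have y0 := sqr_ge0 ((path a b h th - path a' b' h' th) 0 1).
have x0 := sqr_ge0 ((path a b h th - path a' b' h' th) 0 0).
rewrite sqE.
have [t2|t2] := leP (5 * th) 2.
  have : (path a b h th - path a' b' h' th) 0 0 = a 0 0 - a' 0 0.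
    by rewrite !mxE /= phase_lo//; ring.
  by move=> E; rewrite E in x0 *; have := sqle _ da; lra.
have [t3|t3] := leP 3 (5 * th).
  have : (path a b h th - path a' b' h' th) 0 0 = b 0 0 - b' 0 0.
    by rewrite !mxE /= phase_hi//; ring.
  by move=> E; rewrite E in x0 *; have := sqle _ db; lra.
have : (path a b h th - path a' b' h' th) 0 1 = h - h'.
  by rewrite !mxE /= (phase_hi (j := 1)) ?(phase_lo (j := 3)) ?ltW//; ring.
by move=> E; rewrite E in y0 *; have := sqle _ dh; lra.
Qed.

End Paths.

Section Segments.
Context {R : realType} {T : finType} (e : T -> 'rV[R]_2) (L del : R).
Notation P := 'rV[R]_2.
Variables (S : nat -> {set T}) (tg : nat -> T -> T).
Implicit Types (i j : nat) (s t : T) (z : P) (th : R).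
Hypothesis e_unit : forall t, sq (e t) = 1.
Hypothesis del0 : 0 < del.
Hypothesis e_del : forall t, del <= e t 0 0 <= 1.
Hypothesis e_gap : forall t t', t != t' -> del <= `|e t 0 0 - e t' 0 0|.
Hypothesis LE : L = (2 * #|T| + 6)%:R.
Hypothesis tg_id : forall i s, s \in S i -> tg i s = s.

Let L4 : 4 <= L.
Proof. by rewrite LE ler_nat; lia. Qed.

Let del1 : T -> del <= 1.
Proof. by move=> t; have /andP[] := e_del t; exact: le_trans. Qed.

(** [S i] is the [i]-th class and [tg i s] the well of level [i] to which [s]
belongs: [s] itself if [s] is in [S i], and the end point of its edge if [s] is
in a neighbouring class. *)
Definition rk i s : nat := index s (enum (S i)).
Definition card_lev i : nat := #|S i|.
Definition offset i s : P := if s \in S i then 0 else e s.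
Definition pos i s : P := well L (rk i (tg i s)) + offset i s.
(** Distinct heights allow the points to overtake one another. *)
Definition height s : R := (enum_rank s)%:R.
Definition curve i s th : P := path (pos i s) (pos i.+1 s) (height s) th.
Definition alive i : {set T} := S i :|: S i.+1.
Definition level i : P -> R := Lev e L (card_lev i).

Lemma rk_lt i s : s \in S i -> (rk i s < card_lev i)%N.
Proof. by move=> sS; rewrite /card_lev cardE index_mem mem_enum. Qed.

Lemma rk_inj i s t : s \in S i -> t \in S i -> rk i s = rk i t -> s = t.
Proof.
move=> sS tS h; rewrite -(nth_index s (s := enum (S i)) (x := s)) ?mem_enum//.
by rewrite -/(rk i s) h nth_index ?mem_enum.
Qed.

Lemma pos_min i s : s \in S i -> pos i s = well L (rk i s).
Proof. by move=> sS; rewrite /pos /offset sS addr0 tg_id. Qed.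

Lemma pos_sn i s : s \notin S i -> pos i s = well L (rk i (tg i s)) + e s.
Proof. by move=> /negPf sS; rewrite /pos /offset sS. Qed.

Lemma offset01 i s : 0 <= offset i s 0 0 <= 1.
Proof.
rewrite /offset; case: ifP => _; first by rewrite mxE lexx ler01.
by have /andP[h ->] := e_del s; rewrite andbT (le_trans _ h)// ltW.
Qed.

Lemma pos0 i s : pos i s 0 0 = (rk i (tg i s))%:R * L + offset i s 0 0.
Proof. by rewrite /pos /well !mxE. Qed.

Lemma rk_far i s t : rk i (tg i s) != rk i (tg i t) -> L - 1 <= `|pos i s 0 0 - pos i t 0 0|.
Proof.
have hL := L4; rewrite !pos0.
have /andP[a0 a1] := offset01 i s; have /andP[b0 b1] := offset01 i t.
rewrite neq_lt => /orP[/natr_gap|/natr_gap] => /(_ R L L4) g.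
  by rewrite distrC; apply: le_trans (ler_norm _); lra.
by apply: le_trans (ler_norm _); lra.
Qed.

(** Abscissas of positions separate the vertices: those in the same well have
different directions, those in different wells are at least [L - 1] apart. *)
Lemma pos_gap i s t : s != t -> del <= `|pos i s 0 0 - pos i t 0 0|.
Proof.
move=> st; have d1 := del1 s; have hL := L4.
have [E|ne] := eqVneq (rk i (tg i s)) (rk i (tg i t)); last first.
  by apply: le_trans (rk_far ne); lra.
rewrite !pos0 E opprD addrACA subrr add0r /offset.
case: ifPn => sS; case: ifPn => tS.
- by move: E; rewrite !tg_id// => /(rk_inj sS tS) E; rewrite E eqxx in st.
- rewrite mxE sub0r normrN; have /andP[h _] := e_del t.
  exact: le_trans (ler_norm _).
- rewrite mxE subr0; have /andP[h _] := e_del s.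
  exact: le_trans (ler_norm _).
- exact: e_gap.
Qed.

Lemma height_gap s t : s != t -> del <= `|height s - height t|.
Proof.
move=> st; apply: le_trans (del1 s) _; rewrite /height.
have : (enum_rank s : nat) != enum_rank t.
  by apply: contra st => /eqP/val_inj/enum_rank_inj ->.
rewrite neq_lt => /orP[h|h].
  rewrite distrC; apply: le_trans (ler_norm _).
  by rewrite lerBrDr nat1r ler_nat.
apply: le_trans (ler_norm _).
by rewrite lerBrDr nat1r ler_nat.
Qed.

Lemma curve_sep i s t th : s != t -> del ^+ 2 <= sq (curve i s th - curve i t th).
Proof.
move=> st; apply: path_sep; first exact: ltW.
- exact: pos_gap.
- exact: pos_gap.
- exact: height_gap.
Qed.

Lemma curve_start i s th : 5 * th <= 1 -> curve i s th = pos i s.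
Proof. exact: path_start. Qed.

Lemma curve_end i s th : 4 <= 5 * th -> curve i s th = pos i.+1 s.
Proof. exact: path_end. Qed.

Lemma pos_neq i s t : s != t -> pos i s != pos i t.
Proof.
move=> st; apply/eqP => E; have := pos_gap i st.
by rewrite E subrr normr0 leNgt del0.
Qed.

Lemma level_slope_min i s z : s \in S i -> sq (z - pos i s) < 2^-1 ->
  4^-1 * sq (z - pos i s) <= 'D_(z - pos i s) (level i) z.
Proof.
move=> sS; rewrite pos_min// => zr.
have z2 : sq (z - well L (rk i s)) < 2 by lra.
rewrite /level (derive_Lev_disc e L4 _ (rk_lt sS) z2).
apply: le_trans (radial_profile_ge e_unit (ltW z2)).
rewrite mulrC ler_wpM2l ?sq_ge0//.
have := sq_ge0 (z - well L (rk i s)); move: zr.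
set q := sq _ => zr q0.
have : 0 <= (2^-1 - q) * (3 / 2 - q) by apply: mulr_ge0; lra.
by lra.
Qed.

Lemma level_slope_sn i s (eta : R) : s \notin S i -> tg i s \in S i -> 0 < eta ->
  exists2 r : R, 0 < r & forall z, sq (z - pos i s) < r ->
    - eta * sq (z - pos i s) <= 'D_(z - pos i s) (level i) z.
Proof.
move=> sS tS eta0; have [r r0 H] := profile_flat e_unit s eta0.
exists (Num.min r (100^-1)); first by rewrite lt_min r0 invr_gt0 ltr0n.
rewrite pos_sn//; set m := well L (rk i (tg i s)) => z.
have -> : z - (m + e s) = (z - m) - e s by rewrite opprD addrA.
rewrite lt_min => /andP[zr z100].
have z2 : sq (z - m) < 2.
  have -> : z - m = e s + (z - m - e s) by rewrite [RHS]addrC subrK.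
  rewrite sqD e_unit; set w := z - m - e s in z100 *.
  have := CauchyS (e s) w; rewrite e_unit mul1r => c.
  have : 0 <= (dot (e s) w - 10^-1) ^+ 2 by exact: sqr_ge0.
  by lra.
by rewrite /level (derive_Lev_disc e L4 _ (rk_lt tS) z2); exact: H.
Qed.

Lemma level_radial i s z : tg i s \in S i -> sq (z - well L (rk i (tg i s))) < 2 ->
  0 <= 'D_(z - well L (rk i (tg i s))) (level i) z.
Proof.
move=> tS z2; rewrite /level (derive_Lev_disc e L4 _ (rk_lt tS) z2).
by apply: le_trans (radial_profile_ge e_unit (ltW z2)); rewrite mulr_ge0 ?sq_ge0 ?sqr_ge0.
Qed.

(** The product of the wells is fully in charge from phase 1 to phase 3, while the
points move; during the phases 0 and 4 the points rest and the potentials are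
exchanged. *)
Definition blend i th z : R := (1 - phase 0 th) * level i z +
  (phase 0 th - phase 4 th) * wells (alive i) (curve i ^~ th) z +
  phase 4 th * level i.+1 z.

Lemma C1_blend i th : C1 (blend i th).
Proof.
have cc (a : R) : C1 (fun _ : P => a) by exact: C1_cst.
apply: C1D; first apply: C1D; apply: C1M => //; by [exact: C1_Lev | exact: C1_wells].
Qed.

Lemma blend_derive i th z v : 'D_v (blend i th) z = (1 - phase 0 th) * 'D_v (level i) z +
  (phase 0 th - phase 4 th) * 'D_v (wells (alive i) (curve i ^~ th)) z +
  phase 4 th * 'D_v (level i.+1) z.
Proof.
have h1 : C1 (level i) by exact: C1_Lev.
have h2 : C1 (level i.+1) by exact: C1_Lev.
have h3 : C1 (wells (alive i) (curve i ^~ th)) by exact: C1_wells.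
have cc (a : R) : C1 (fun _ : P => a) by exact: C1_cst.
have C1c (a : R) (f : P -> R) : C1 f -> C1 (fun z => a * f z) by move=> fC; exact: C1M.
rewrite /blend (C1_deriveD z v (C1D (C1c _ _ h1) (C1c _ _ h3)) (C1c _ _ h2)).
rewrite (C1_deriveD z v (C1c _ _ h1) (C1c _ _ h3)).
by rewrite !C1_deriveZ.
Qed.

Lemma phase40 th : phase 4 th <= phase 0 th.
Proof.
have [h|h] := leP (5 * th) 4; first by rewrite phase_lo ?phase_ge0.
by rewrite (phase_hi (j := 0)) ?phase_le1//; lra.
Qed.

Let kst : R := well_stiffness (T := T) (del ^+ 2).
Let rst : R := well_radius (T := T) (del ^+ 2).

Let kst0 : 0 < kst. Proof. by apply: well_stiffness_gt0; rewrite exprn_gt0. Qed.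
Let rst0 : 0 < rst. Proof. by apply: well_radius_gt0; rewrite exprn_gt0. Qed.

(** The three slopes combine with the weights of the blend; each fixed potential
enters only while the point rests at its position for that potential. *)
Lemma blend_slope i s th z (ea eb : R) : s \in alive i -> sq (z - curve i s th) < rst ->
  (th < 5^-1 -> - ea * sq (z - pos i s) <= 'D_(z - pos i s) (level i) z) ->
  (4 / 5 < th -> - eb * sq (z - pos i.+1 s) <= 'D_(z - pos i.+1 s) (level i.+1) z) ->
  ((1 - phase 0 th) * (- ea) + (phase 0 th - phase 4 th) * kst + phase 4 th * (- eb)) *
    sq (z - curve i s th) <= 'D_(z - curve i s th) (blend i th) z.
Proof.
move=> sA zr Ha Hb; rewrite blend_derive.
set q := sq _ in zr *; set w := z - curve i s th.
set Da := 'D_w (level i) z; set Db := 'D_w (level i.+1) z.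
set Dw := 'D_w (wells _ _) z.
have D : kst * q <= Dw.
  apply: wells_stiff => //; first by rewrite exprn_gt0.
    by rewrite expr_le1 ?(del1 s)// ltW.
  by move=> t _ ts; exact: curve_sep.
have a1 : (1 - phase 0 th) * (- ea * q) <= (1 - phase 0 th) * Da.
  have := phase_le1 0 th; rewrite -subr_ge0 le_eqVlt => /orP[/eqP <-|p0]; first by rewrite !mul0r.
  rewrite ler_pM2l//; have := phase_lt1 (j := 0) (th := th); rewrite -subr_gt0 => /(_ p0) h.
  have th1 : 5 * th <= 1 by lra.
  by rewrite /Da /w /q (curve_start i s th1); apply: Ha; lra.
have a3 : phase 4 th * (- eb * q) <= phase 4 th * Db.
  have := phase_ge0 4 th; rewrite le_eqVlt => /orP[/eqP <-|p0]; first by rewrite !mul0r.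
  rewrite ler_pM2l//; have h := phase_gt0 p0.
  have th4 : 4 <= 5 * th by exact: ltW.
  rewrite /Db /w /q (curve_end i s th4); apply: Hb.
  by rewrite ltr_pdivrMr// mulrC.
have a2 : 0 <= (phase 0 th - phase 4 th) * (Dw - kst * q).
  by apply: mulr_ge0; rewrite subr_ge0// phase40.
move: Da Db Dw D a1 a2 a3 => Da Db Dw D a1 a2 a3.
by lra.
Qed.

(** The radius is uniform in time near [th0], which yields both minimality and
rigidity of the moving point. *)
Definition funnel i s th0 := exists2 r : R, 0 < r &
  \forall th \near th0, forall z, sq (z - curve i s th) < r -> z != curve i s th ->
     0 < 'D_(z - curve i s th) (blend i th) z.

(** Near the end the point rests at a saddle-node of level [i.+1], where that
potential may lose an [eta]-share of the squared distance; before the weight of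
the product vanishes, [eta] can be chosen smaller than what the product gains. *)
Lemma funnel_up i s th0 : s \in S i -> (s \notin S i.+1) -> tg i.+1 s \in S i.+1 ->
  th0 < 1 -> funnel i s th0.
Proof.
move=> sS sS1 tS th1; pose tmax := (th0 + 1) / 2.
have tm : th0 < tmax < 1 by rewrite /tmax; apply/andP; split; lra.
case/andP: tm => tm0 tm1.
have k4 : phase 4 tmax < 1 by apply: phase_lt1E; lra.
pose eta := (1 - phase 4 tmax) * kst / 2.
have eta0 : 0 < eta by rewrite divr_gt0// mulr_gt0// subr_gt0.
have [r r0 H] := level_slope_sn sS1 tS eta0.
have sA : s \in alive i by rewrite inE sS.
exists (Num.min r (Num.min rst 2^-1)); first by rewrite !lt_min r0 rst0 invr_gt0 ltr0n.
have := lt_nbhsl tm0; apply: filterS => th tht z.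
rewrite !lt_min => /and3P[zr zs zh] zc.
have q0 : 0 < sq (z - curve i s th) by rewrite sq_gt0 subr_eq0.
apply: lt_le_trans (blend_slope (ea := - 4^-1) (eb := eta) sA zs _ _); last 2 first.
- move=> th5; rewrite opprK; apply: level_slope_min => //.
  by rewrite -(@curve_start i s th)//; lra.
- by move=> th5; apply: H; rewrite -(@curve_end i s th)//; lra.
rewrite mulr_gt0// opprK.
have p4 := phase_mono 4 (ltW tht).
have [h|h] := leP (5 * th) 4.
  rewrite (phase_lo (j := 4))// mul0r addr0 subr0.
  have p0 := phase_ge0 0 th; have p1 := phase_le1 0 th.
  have [h0|h0] := leP (phase 0 th) 2^-1.
    have : 0 <= phase 0 th * kst by rewrite mulr_ge0// ltW.
    by lra.
  have : 0 < phase 0 th * kst by rewrite mulr_gt0//; lra.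
  by lra.
rewrite (phase_hi (j := 0)); last by lra.
have p41 := phase_le1 4 th; have p40 := phase_ge0 4 th.
have : 0 <= (phase 4 tmax - phase 4 th) * kst by rewrite mulr_ge0 ?(ltW kst0)// subr_ge0.
have : 0 <= (1 - phase 4 th) * eta by rewrite mulr_ge0 ?(ltW eta0)// subr_ge0.
by rewrite subrr mul0r add0r; move: eta0; rewrite /eta; lra.
Qed.

Lemma funnel_down i s th0 : s \in S i.+1 -> (s \notin S i) -> tg i s \in S i ->
  0 < th0 -> funnel i s th0.
Proof.
move=> sS sS1 tS th1; pose tmin := th0 / 2.
have tm : 0 < tmin < th0 by rewrite /tmin; apply/andP; split; lra.
case/andP: tm => tm0 tm1.
have k0 : 0 < phase 0 tmin by apply: phase_gt0E; lra.
pose eta := phase 0 tmin * kst / 2.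
have eta0 : 0 < eta by rewrite divr_gt0// mulr_gt0.
have [r r0 H] := level_slope_sn sS1 tS eta0.
have sA : s \in alive i by rewrite inE sS orbT.
exists (Num.min r (Num.min rst 2^-1)); first by rewrite !lt_min r0 rst0 invr_gt0 ltr0n.
have := lt_nbhsr tm1; apply: filterS => th tht z.
rewrite !lt_min => /and3P[zr zs zh] zc.
have q0 : 0 < sq (z - curve i s th) by rewrite sq_gt0 subr_eq0.
apply: lt_le_trans (blend_slope (ea := eta) (eb := - 4^-1) sA zs _ _); last 2 first.
- by move=> th5; apply: H; rewrite -(@curve_start i s th)//; lra.
- move=> th5; rewrite opprK; apply: level_slope_min => //.
  by rewrite -(@curve_end i s th)//; lra.
rewrite mulr_gt0// opprK.
have p0 := phase_mono 0 (ltW tht).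
have [h|h] := leP 1 (5 * th).
  rewrite (phase_hi (j := 0))// subrr mul0r add0r.
  have p4 := phase_ge0 4 th; have p1 := phase_le1 4 th.
  have [h0|h0] := leP 2^-1 (phase 4 th).
    have : 0 <= (1 - phase 4 th) * kst by rewrite mulr_ge0 ?(ltW kst0)// subr_ge0.
    by lra.
  have : 0 < (1 - phase 4 th) * kst by rewrite mulr_gt0// subr_gt0; lra.
  by lra.
rewrite (phase_lo (j := 4)); last by lra.
have p41 := phase_le1 0 th; have p40 := phase_ge0 0 th.
have : 0 <= (phase 0 th - phase 0 tmin) * kst by rewrite mulr_ge0 ?(ltW kst0)// subr_ge0.
have : 0 <= phase 0 th * eta by rewrite mulr_ge0 ?(ltW eta0).
by rewrite mul0r addr0 subr0; move: eta0; rewrite /eta; lra.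
Qed.

(** The fixed potential has a nonnegative radial slope and the product a positive
one at [pos i t], so no combination with a positive weight of the product is
critical there. *)
Lemma fold_killed i t (B : {set T}) : t \notin B -> t \notin S i -> tg i t \in S i ->
  tg i t \in B -> let m := well L (rk i (tg i t)) in
  \forall z \near pos i t, forall a b : R, 0 <= a -> 0 < b ->
    0 < a * 'D_(z - m) (level i) z + b * 'D_(z - m) (wells B (pos i)) z.
Proof.
move=> tB tS gS gB m; have pE : pos i t = m + e t by exact: pos_sn.
have pm : pos i t - m = e t by rewrite pE addrC addKr.
have push : 0 < 'D_(pos i t - m) (wells B (pos i)) (pos i t).
  apply: (wells_push gB); rewrite ?pm ?e_unit//.
  - by rewrite pos_min.
  - by move=> s sB; apply: pos_neq; apply: contraTneq sB => ->.
  - move=> s sB; have [E|ne] := eqVneq (rk i (tg i t)) (rk i (tg i s)).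
      left; rewrite /pos -E addrC addKr /offset; case: ifP => _; first by rewrite sq0.
      by rewrite e_unit.
    right; have h := rk_far ne; rewrite sqE.
    apply: (@le_trans _ _ ((pos i t - pos i s) 0 0 ^+ 2)); last by rewrite lerDl sqr_ge0.
    have -> : (pos i t - pos i s) 0 0 = pos i t 0 0 - pos i s 0 0 by rewrite !mxE.
    rewrite -[leRHS](real_normK (num_real _)) lerXn2r ?nnegrE ?mulr_ge0//.
    by apply: le_trans h; rewrite LE lerBrDr -natrM natr1 ler_nat; lia.
have near1 : \forall z \near pos i t, 0 < 'D_(z - m) (wells B (pos i)) z.
  by apply: (cont_gt (f := fun z => 'D_(z - m) (wells B (pos i)) z)) => //;
    apply: radial_continuous; exact: C1_wells.
have near2 : \forall z \near pos i t, sq (z - m) < 2.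
  by apply: near_disc; rewrite pm e_unit ltr1n.
apply: filterS2 near1 near2 => z h1 h2 a b a0 b0.
rewrite ltr_wpDl//; last exact: mulr_gt0.
by apply: mulr_ge0 => //; exact: level_radial.
Qed.

End Segments.

(** * The potential for all inputs *)

Section Assembly.
Context {R : realType} {T : finType} (e : T -> 'rV[R]_2) (L del : R).
Notation P := 'rV[R]_2.
Variables (S : nat -> {set T}) (tg : nat -> T -> T) (ux : nat -> R) (n : nat).
Implicit Types (i j : nat) (s t : T) (z : P) (u th : R).
Hypothesis e_unit : forall t, sq (e t) = 1.
Hypothesis e_indep : forall t t', t != t' -> dot (rot (e t')) (e t) != 0.
Hypothesis del0 : 0 < del.
Hypothesis e_del : forall t, del <= e t 0 0 <= 1.
Hypothesis e_gap : forall t t', t != t' -> del <= `|e t 0 0 - e t' 0 0|.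
Hypothesis LE : L = (2 * #|T| + 6)%:R.
Hypothesis tg_id : forall i s, s \in S i -> tg i s = s.
Hypothesis S_disj : forall i j s, s \in S i -> s \in S j -> i = j.
Hypothesis S_ne : forall i, (0 < i <= n.+1)%N -> exists s, s \in S i.
Hypothesis tg_up : forall i s, (i <= n)%N -> s \in S i -> tg i.+1 s \in S i.+1.
Hypothesis tg_down : forall i s, (0 < i <= n.+1)%N -> s \in S i.+1 -> tg i s \in S i.
Hypothesis ux_incr : forall i, ux i < ux i.+1.

Let L4 : 4 <= L.
Proof. by rewrite LE ler_nat; lia. Qed.

Let lev := level e L S.
Let crv := curve e L S tg.
Let ps := pos e L S tg.
Let bl := blend e L S tg.

Lemma blend_start i th : th <= 0 -> bl i th = lev i.
Proof.
move=> th0; apply/funext => z; rewrite /bl /blend !phase_lo; try lra.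
  by rewrite subrr !mul0r !addr0 subr0 mul1r.
Qed.

Lemma blend_end i th : 1 <= th -> bl i th = lev i.+1.
Proof.
move=> th0; apply/funext => z; rewrite /bl /blend !phase_hi; try lra.
by rewrite subrr !mul0r !add0r mul1r.
Qed.

Definition theta i u : R := (u - ux i) / (ux i.+1 - ux i).

Lemma theta_cont i : continuous (theta i).
Proof.
apply: contM; last exact: cont_cst.
by apply: contB; [move=> u; exact: cvg_id | exact: cont_cst].
Qed.

Lemma gap_gt0 i : 0 < ux i.+1 - ux i.
Proof. by rewrite subr_gt0. Qed.

Lemma theta_ge0 i u : (0 <= theta i u) = (ux i <= u).
Proof. by rewrite /theta pmulr_lge0 ?invr_gt0 ?gap_gt0// subr_ge0. Qed.
Lemma theta_gt0 i u : (0 < theta i u) = (ux i < u).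
Proof. by rewrite /theta pmulr_lgt0 ?invr_gt0 ?gap_gt0// subr_gt0. Qed.
Lemma theta_le1 i u : (theta i u <= 1) = (u <= ux i.+1).
Proof. by rewrite /theta ler_pdivrMr ?gap_gt0// mul1r lerD2r. Qed.
Lemma theta_lt1 i u : (theta i u < 1) = (u < ux i.+1).
Proof. by rewrite /theta ltr_pdivrMr ?gap_gt0// mul1r ltrD2r. Qed.
Lemma theta0 i : theta i (ux i) = 0.
Proof. by rewrite /theta subrr mul0r. Qed.
Lemma theta1 i : theta i (ux i.+1) = 1.
Proof. by rewrite /theta divff// gt_eqF// gap_gt0. Qed.

Lemma ux_mono i j : (i <= j)%N -> ux i <= ux j.
Proof.
elim: j => [|j IH]; first by rewrite leqn0 => /eqP ->.
rewrite leq_eqVlt => /orP[/eqP -> //|ij].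
by apply: le_trans (IH _) (ltW (ux_incr j)).
Qed.

(** The sum telescopes: on the [i]-th input interval only the [i]-th blend is
in progress. *)
Definition potential z u : R :=
  lev 0 z + \sum_(0 <= i < n.+2) (bl i (theta i u) z - lev i z).

Lemma potential_seg i u : (i < n.+2)%N -> ux i <= u <= ux i.+1 ->
  potential^~ u = bl i (theta i u).
Proof.
move=> iM /andP[u1 u2]; apply/funext => z; rewrite /potential.
rewrite (@big_cat_nat _ _ _ i 0 n.+2)//=; last exact: ltnW.
rewrite (big_ltn iM).
rewrite (eq_big_nat _ _ (F2 := fun j => lev j.+1 z - lev j z)); last first.
  move=> j /andP[_ ji]; rewrite blend_end// leNgt theta_lt1 -leNgt.
  by apply: le_trans u1; exact: ux_mono.
rewrite telescope_sumr// big_nat_cond big1; last first.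
  move=> j /andP[/andP[ij _] _]; rewrite blend_start ?subrr//.
  rewrite leNgt theta_gt0 -leNgt.
  by apply: le_trans u2 _; exact: ux_mono.
by ring.
Qed.

Lemma potential_lev i : (i <= n.+2)%N -> potential^~ (ux i) = lev i.
Proof.
rewrite leq_eqVlt => /orP[/eqP ->|iM].
  rewrite (@potential_seg n.+1)//; last by rewrite ltW//= lexx.
  by rewrite blend_end// theta1.
rewrite (@potential_seg i)//; last by rewrite lexx ltW.
by rewrite blend_start// theta0.
Qed.

Lemma C1_potential u : C1 (potential^~ u).
Proof.
have Cl i : C1 (lev i) by exact: C1_Lev.
have Cb i : C1 (bl i (theta i u)) by exact: C1_blend.
by apply: C1D => //; apply: C1_sum => i; exact: C1B.
Qed.

Lemma potential_regular : regular_potential potential.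
Proof.
split=> [u|]; first by have := C1_potential u; rewrite C1E.
have Cl i : continuous (fun z : P * R => lev i z.1).
  move=> z; apply: (@continuous_comp _ _ _ (fun z : P * R => z.1) (lev i)); first exact: cvg_fst.
  by apply: C1_continuous; exact: C1_Lev.
have ct (f : R -> R) i : continuous f -> continuous (fun z : P * R => f (theta i z.2)).
  move=> fc z; apply: (@continuous_comp _ _ _ (fun z : P * R => z.2) (fun u => f (theta i u))).
    exact: cvg_snd.
  by apply: (cont_comp (h := f)) => //; exact: theta_cont.
have cw i : continuous (fun z : P * R =>
    wells (alive S i) (fun s => crv i s (theta i z.2)) z.1).
  apply: cont_prod => s.
  have cj (j : 'I_2) : continuous (fun z : P * R => (z.1 - crv i s (theta i z.2)) 0 j).
    have -> : (fun z : P * R => (z.1 - crv i s (theta i z.2)) 0 j) =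
        (fun w : P * R => w.1 0 j - crv i s (theta i w.2) 0 j).
      by apply/funext => w; rewrite [LHS]mxE; congr (_ + _); rewrite mxE.
    apply: contB.
      move=> z; apply: (@continuous_comp _ _ _ (fun z : P * R => z.1) (fun z : P => z 0 j)).
        exact: cvg_fst.
      by apply: C1_continuous; exact: C1_coord.
    exact: (ct (fun th => crv i s th 0 j) i (path_cont0 (j := j))).
  have -> : (fun w : P * R => sq (w.1 - crv i s (theta i w.2))) = (fun w : P * R =>
      (w.1 - crv i s (theta i w.2)) 0 0 * (w.1 - crv i s (theta i w.2)) 0 0 +
      (w.1 - crv i s (theta i w.2)) 0 1 * (w.1 - crv i s (theta i w.2)) 0 1).
    by apply/funext => w; rewrite sqE !expr2.
  by apply: contD; apply: contM; exact: cj.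
apply: contD; first exact: Cl.
apply: cont_sum => i; apply: contB; last exact: Cl.
have cp j : continuous (fun z : P * R => phase j (theta i z.2)) by apply: ct; exact: phase_cont.
apply: contD; first apply: contD; apply: contM => //.
- by apply: contB => //; exact: cont_cst.
- exact: contB.
Qed.

Lemma seg_of u : ux 1 <= u <= ux n.+1 -> (0 < n)%N ->
  exists2 i, (0 < i <= n)%N & ux i <= u <= ux i.+1.
Proof.
move=> /andP[u1 u2] n0.
have [k kn] : exists k, (n = k.+1)%N by exists n.-1; rewrite prednK.
rewrite kn in u2 *; elim: k u2 {kn n0} => [|k IH] u2.
  by exists 1%N => //; rewrite u1 u2.
have [h|h] := leP u (ux k.+2).
  have [i /andP[i0 ik] H] := IH h; exists i => //; rewrite i0; lia.
by exists k.+2; [lia | rewrite u2 ltW].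
Qed.

(** A convex combination of coercive functions; the estimate uses that one of the
three weights is bounded below. *)
Lemma potential_coercive u : (0 < n)%N -> ux 1 <= u <= ux n.+1 ->
  forall M, exists r, forall z, r < `|z| -> M < potential z u.
Proof.
move=> n0 uI M; have [i /andP[i0 ilen] ui] := seg_of uI n0.
have iM : (i < n.+2)%N by lia.
have E := potential_seg iM ui.
have [s sS] := S_ne (i := i) ltac:(lia).
have sA : s \in alive S i by rewrite inE sS.
have [r1 H1] := Lev_coercive e L4 (card_lev S i) M.
have [r2 H2] := Lev_coercive e L4 (card_lev S i.+1) M.
have [r3 H3] := @wells_coercive _ _ (alive S i) (fun s => crv i s (theta i u)) M
  (ex_intro _ s sA).
exists (Num.max r1 (Num.max r2 r3)) => z; rewrite !gt_max => /and3P[z1 z2 z3].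
rewrite (congr1 (@^~ z) E) /bl /blend.
have h1 := H1 z z1; have h2 := H2 z z2; have h3 := H3 z z3.
rewrite -/(level e L S i z) in h1; rewrite -/(level e L S i.+1 z) in h2.
move: h1 h2 h3; set a := level _ _ _ i z; set b := level _ _ _ i.+1 z; set w := wells _ _ z.
have p0 := phase_le1 0 (theta i u); have p4 := phase_ge0 4 (theta i u).
have p40 := phase40 (theta i u).
move: (phase 0 _) (phase 4 _) p0 p4 p40 a b w => k0 k4 p0 p4 p40 a b w h1 h2 h3.
have t1 : 0 <= (1 - k0) * (a - M) by rewrite mulr_ge0// subr_ge0// ltW.
have t2 : 0 <= (k0 - k4) * (w - M) by rewrite mulr_ge0// subr_ge0// ltW.
have t3 : 0 <= k4 * (b - M) by rewrite mulr_ge0// subr_ge0// ltW.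
have [k05|k05] := ltP k0 (1 / 2).
  have : 0 < (1 - k0) * (a - M) by rewrite mulr_gt0// subr_gt0//; lra.
  by lra.
have [k45|k45] := ltP k4 (1 / 4).
  have : 0 < (k0 - k4) * (w - M) by rewrite mulr_gt0// subr_gt0//; lra.
  by lra.
have : 0 < k4 * (b - M) by rewrite mulr_gt0// ?subr_gt0//; lra.
by lra.
Qed.

Lemma field_lev i : (i <= n.+2)%N -> field potential (ux i) = field_of e L (card_lev S i).
Proof. by move=> iM; rewrite /field /field_of (potential_lev iM). Qed.

Lemma escape_lev i s : (i <= n.+2)%N -> s \notin S i -> tg i s \in S i ->
  escapes_to potential (ux i) (ps i s) (ps i (tg i s)).
Proof.
move=> iM sS tS; rewrite /escapes_to (field_lev iM) (potential_lev iM).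
rewrite /ps (pos_min e L tg_id tS) (pos_sn e L tg sS).
have kN := rk_lt tS; split.
- exact: Lev_saddle_node.
- exact: well_isolated.
- move=> q [uq qp].
  have [rho r1 ->] := unstable_ray e_unit e_indep L4 kN uq qp.
  exact: ray_basin.
Qed.

Lemma escape_ne i s : (i <= n.+2)%N -> s \notin S i -> tg i s \in S i ->
  exists2 w, unstable_manifold (field potential (ux i)) (ps i s) w & w <> ps i s.
Proof.
move=> iM sS tS; rewrite (field_lev iM) /ps (pos_sn e L tg sS).
by have kN := rk_lt tS; exact: unstable_nonempty.
Qed.

Lemma sn_isolated i s : (i <= n.+2)%N -> s \notin S i -> tg i s \in S i ->
  isolated (critical_points (potential^~ (ux i))) (ps i s).
Proof.
move=> iM sS tS; have kN := rk_lt tS.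
have nearc : \forall z \near ps i s, critical_points (lev i) z -> z = ps i s.
  rewrite /ps (pos_sn e L tg sS).
  exact: near_saddle_critical.
have crit : critical_points (lev i) (ps i s).
  have [[_ + _ _] _ _] := escape_lev iM sS tS.
  rewrite (field_lev iM) /field_of => /eqP; rewrite oppr_eq0 => /eqP E.
  exact: E.
rewrite (potential_lev iM); split; first exact/mem_set.
exists [set z | critical_points (lev i) z -> z = ps i s]; first exact: nearc.
apply/seteqP; split=> z /=; first by move=> [h /h].
by move=> ->.
Qed.

Lemma small_norm (r : R) : 0 < r -> exists2 rho : R, 0 < rho &
  forall z : P, `|z| < rho -> sq z < r.
Proof.
move=> r0; have m0 : 0 < Num.min 1 r by rewrite lt_min ltr01.
exists (Num.min 1 r / 2); first by rewrite divr_gt0.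
move=> z zr; have m1 : Num.min 1 r <= 1 by rewrite ge_min lexx.
have m2 : Num.min 1 r <= r by rewrite ge_min lexx orbT.
have z0 := normr_ge0 z; apply: le_lt_trans (sq_norm z) _.
have : 0 <= (Num.min 1 r / 2 - `|z|) * `|z| by rewrite mulr_ge0// subr_ge0 ltW.
have : 0 <= (1 - Num.min 1 r) * (Num.min 1 r) by rewrite mulr_ge0 ?subr_ge0// ltW.
have : 0 <= (1 - Num.min 1 r) * `|z| by rewrite mulr_ge0 ?subr_ge0.
by rewrite expr2; lra.
Qed.

(** In the funnel the derivative towards the moving point does not vanish. *)
Lemma funnel_rigid i s u : (i < n.+2)%N -> funnel e L S tg i s (theta i u) ->
  exists2 rho : R, 0 < rho & \forall v \near u, ux i <= v <= ux i.+1 ->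
    forall z, critical_points (potential^~ v) z -> `|z - crv i s (theta i v)| < rho ->
    z = crv i s (theta i v).
Proof.
move=> iM [r r0 near1]; have [rho rho0 H] := small_norm r0.
exists rho => //; have near2 := theta_cont near1.
apply: (@filterS _ (nbhs u) _ _ _ _ near2) => v pv vI z.
rewrite (potential_seg iM vI) => zc zr.
have [//|zne] := eqVneq z (crv i s (theta i v)).
have := pv z (H _ zr) zne.
by rewrite ((critical_dir z (C1_blend e L S tg i (theta i v))).1 zc) ltxx.
Qed.

Lemma funnel_min i s u : (i < n.+2)%N -> ux i <= u <= ux i.+1 ->
  funnel e L S tg i s (theta i u) ->
  local_minima (potential^~ u) (crv i s (theta i u)).
Proof.
move=> iM uI [r r0 /nbhs_singleton near1]; rewrite (potential_seg iM uI).
apply: (well_min (r := r)) => //; first exact: C1_blend.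
move=> z zr; have [->|zne] := eqVneq z (crv i s (theta i u)).
  by rewrite subrr derive0.
exact: ltW (near1 z zr zne).
Qed.

Lemma curve_cont i s (A : set R) : {within A, continuous (fun u => crv i s (theta i u))}.
Proof.
apply: continuous_subspaceT => u.
apply: (@continuous_comp _ _ _ (theta i) (crv i s)); first exact: theta_cont.
exact: path_cont.
Qed.

(** Above the level [i], during the phase 0, the vertex [s] is absent from the
wells of the segment, and [fold_killed] applies to every blend. *)
Lemma kill_after i s : (i < n.+2)%N -> s \notin S i -> s \notin S i.+1 -> tg i s \in S i ->
  exists rho delta : R, [/\ 0 < rho, 0 < delta
  & forall u x, ux i < u < ux i + delta -> `|x - ps i s| < rho ->
     ~ critical_points (potential^~ u) x].
Proof.
move=> iM sS sS1 tS.
have sA : s \notin alive S i by rewrite inE negb_or sS.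
have tA : tg i s \in alive S i by rewrite inE tS.
have := @fold_killed _ _ e L del S tg e_unit del0 e_del e_gap LE tg_id i s _ sA sS tS tA.
move=> /nbhs_ballP[rho /= rho0 H].
exists rho, ((ux i.+1 - ux i) / 5); split=> //; first by rewrite divr_gt0// gap_gt0.
move=> u x /andP[u1 u2] xr.
have g0 := gap_gt0 i.
have th0 : 0 < theta i u by rewrite theta_gt0.
have th5 : 5 * theta i u < 1.
  by rewrite /theta mulrA ltr_pdivrMr// mul1r; lra.
rewrite (@potential_seg i)//; last by rewrite (ltW u1) -theta_le1; lra.
move=> /(critical_dir _ (C1_blend e L S tg i (theta i u))).1/(_ (x - well L (rk S i (tg i s)))).
rewrite blend_derive (phase_lo (j := 4)); last by lra.
have -> : curve e L S tg i ^~ (theta i u) = pos e L S tg i.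
  by apply/funext => t; rewrite curve_start// ltW.
rewrite subr0 mul0r addr0 => E.
have := H x; rewrite -ball_normE /= distrC => /(_ xr).
move=> /(_ (1 - phase 0 (theta i u)) (phase 0 (theta i u))).
rewrite E ltxx subr_ge0 => F; have : false; last by [].
by apply: F; [exact: phase_le1 | apply: phase_gt0E; lra].
Qed.

Lemma kill_before i s : (i < n.+2)%N -> s \notin S i.+1 -> s \notin S i -> tg i.+1 s \in S i.+1 ->
  exists rho delta : R, [/\ 0 < rho, 0 < delta
  & forall u x, ux i.+1 - delta < u < ux i.+1 -> `|x - ps i.+1 s| < rho ->
     ~ critical_points (potential^~ u) x].
Proof.
move=> iM sS sS1 tS.
have sA : s \notin alive S i by rewrite inE negb_or sS1.
have tA : tg i.+1 s \in alive S i by rewrite inE tS orbT.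
have := @fold_killed _ _ e L del S tg e_unit del0 e_del e_gap LE tg_id i.+1 s _ sA sS tS tA.
move=> /nbhs_ballP[rho /= rho0 H].
exists rho, ((ux i.+1 - ux i) / 5); split=> //; first by rewrite divr_gt0// gap_gt0.
move=> u x /andP[u1 u2] xr.
have g0 := gap_gt0 i.
have th0 : theta i u < 1 by rewrite theta_lt1.
have th5 : 4 < 5 * theta i u.
  by rewrite /theta mulrA ltr_pdivlMr//; lra.
rewrite (@potential_seg i)//; last by rewrite (ltW u2) andbT -theta_ge0; lra.
move=> /(critical_dir _ (C1_blend e L S tg i (theta i u))).1/(_ (x - well L (rk S i.+1 (tg i.+1 s)))).
rewrite blend_derive (phase_hi (j := 0)); last by lra.
have -> : curve e L S tg i ^~ (theta i u) = pos e L S tg i.+1.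
  by apply/funext => t; rewrite curve_end// ltW.
rewrite subrr mul0r add0r addrC => E.
have := H x; rewrite -ball_normE /= distrC => /(_ xr).
move=> /(_ (phase 4 (theta i u)) (1 - phase 4 (theta i u))).
rewrite E ltxx subr_gt0 => F; have : false; last by [].
by apply: F; [exact: phase_ge0 | apply: phase_lt1E; lra].
Qed.

Lemma notin_S i j s : s \in S i -> i != j -> s \notin S j.
Proof. by move=> sS; apply: contra => sS'; apply/eqP; exact: S_disj sS sS'. Qed.

(** The curve of [s] is a rigid branch of minima up to its fold at the level
[i.+1]; the fold is destroyed in the segment [i.+1], to which [s] does not
belong. *)
Lemma up_connection i s : (0 < i <= n)%N -> s \in S i ->
  connects_up potential (ux i) (ux i.+1) (ps i s) (ps i.+1 (tg i.+1 s)) /\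
  forall q, connects_up potential (ux i) (ux i.+1) (ps i s) q -> q = ps i.+1 (tg i.+1 s).
Proof.
move=> /andP[i0 ilen] sS.
have iM : (i < n.+2)%N by lia.
have s1 : s \notin S i.+1 by apply: notin_S sS _; rewrite neq_ltn ltnSn.
have s2 : s \notin S i.+2 by apply: notin_S sS _; rewrite neq_ltn; apply/orP; left; lia.
have tS := tg_up ilen sS.
pose c u := crv i s (theta i u).
have c0 : c (ux i) = ps i s by rewrite /c theta0 /crv curve_start// mulr0.
have c1 : c (ux i.+1) = ps i.+1 s by rewrite /c theta1 /crv curve_end// mulr1 ler_nat.
have fun_ u : u < ux i.+1 -> funnel e L S tg i s (theta i u).
  move=> uu; apply: (@funnel_up _ _ e L del) => //.
  by rewrite theta_lt1.
have cmin u : ux i <= u < ux i.+1 -> local_minima (potential^~ u) (c u).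
  by move=> /andP[h1 h2]; apply: funnel_min => //; [rewrite h1 ltW | exact: fun_].
have crig : rigid potential `[ux i, ux i.+1[ c.
  move=> u /=; rewrite in_itv /= => /andP[h1 h2].
  have [rho rho0 H] := funnel_rigid iM (fun_ u h2); exists rho => //.
  apply: filterS H => v Hv; rewrite /= in_itv /= => /andP[h3 h4].
  by apply: Hv; rewrite h3 ltW.
have ccrit u : ux i <= u < ux i.+1 -> critical_points (potential^~ u) (c u).
  by move=> /cmin; apply: local_min_critical; exact: C1_potential.
have cc : {within `[ux i, ux i.+1], continuous c} by exact: curve_cont.
rewrite -c0; split.
  apply: connects_up_branch => //; rewrite ?c1.
  - by apply: sn_isolated => //; lia.
  - by apply: kill_after => //; lia.
  - by apply: escape_lev => //; lia.
move=> q; apply: connects_up_branch_unique => //; rewrite ?c1.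
- by apply: sn_isolated => //; lia.
- by apply: escape_lev => //; lia.
- by apply: escape_ne => //; lia.
Qed.

Lemma down_connection i s : (0 < i <= n)%N -> s \in S i.+1 ->
  connects_down potential (ux i) (ux i.+1) (ps i.+1 s) (ps i (tg i s)) /\
  forall q, connects_down potential (ux i) (ux i.+1) (ps i.+1 s) q -> q = ps i (tg i s).
Proof.
move=> /andP[i0 ilen] sS.
have iM : (i < n.+2)%N by lia.
have s1 : s \notin S i by apply: notin_S sS _; rewrite neq_ltn ltnSn orbT.
have s2 : s \notin S i.-1 by apply: notin_S sS _; rewrite neq_ltn; apply/orP; right; lia.
have tS := tg_down (i := i) ltac:(lia) sS.
pose c u := crv i s (theta i u).
have c0 : c (ux i) = ps i s by rewrite /c theta0 /crv curve_start// mulr0.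
have c1 : c (ux i.+1) = ps i.+1 s by rewrite /c theta1 /crv curve_end// mulr1 ler_nat.
have fun_ u : ux i < u -> funnel e L S tg i s (theta i u).
  move=> uu; apply: (@funnel_down _ _ e L del) => //.
  by rewrite theta_gt0.
have cmin u : ux i < u <= ux i.+1 -> local_minima (potential^~ u) (c u).
  by move=> /andP[h1 h2]; apply: funnel_min => //; [rewrite h2 ltW | exact: fun_].
have crig : rigid potential `]ux i, ux i.+1] c.
  move=> u /=; rewrite in_itv /= => /andP[h1 h2].
  have [rho rho0 H] := funnel_rigid iM (fun_ u h1); exists rho => //.
  apply: filterS H => v Hv; rewrite /= in_itv /= => /andP[h3 h4].
  by apply: Hv; rewrite h4 ltW.
have ccrit u : ux i < u <= ux i.+1 -> critical_points (potential^~ u) (c u).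
  by move=> /cmin; apply: local_min_critical; exact: C1_potential.
have cc : {within `[ux i, ux i.+1], continuous c} by exact: curve_cont.
have kill : exists rho delta : R, [/\ 0 < rho, 0 < delta
  & forall u x, ux i - delta < u < ux i -> `|x - ps i s| < rho ->
     ~ critical_points (potential^~ u) x].
  have [j jE] : exists j, i = j.+1 by exists i.-1; lia.
  move: s1 s2 tS; rewrite jE /= => s1 s2 tS.
  by apply: kill_before => //; lia.
rewrite -c1; split.
  apply: connects_down_branch => //; rewrite ?c0 //.
  - by apply: sn_isolated => //; lia.
  - by apply: escape_lev => //; lia.
move=> q; apply: connects_down_branch_unique => //; rewrite ?c0.
- by apply: sn_isolated => //; lia.
- by apply: escape_lev => //; lia.
- by apply: escape_ne => //; lia.
Qed.

End Assembly.

(** * From the graph to the potential *)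

Section Fan.
Context {R : realType} {T : finType}.
Implicit Types t : T.

(** Unit vectors with different abscissas in the open interval (0, 1) and positive
ordinates: no two of them are parallel, and their abscissas can be told apart
during the motion. *)
Definition fan_step : R := (#|T| + 2)%:R^-1.
Definition abscissa t : R := (enum_rank t).+1%:R * fan_step.
Definition dir t : 'rV[R]_2 := pt (abscissa t) (Num.sqrt (1 - abscissa t ^+ 2)).

Lemma fan_step_gt0 : 0 < fan_step.
Proof. by rewrite invr_gt0 ltr0n; lia. Qed.

Lemma abscissa_ge t : fan_step <= abscissa t.
Proof. by rewrite ler_peMl ?(ltW fan_step_gt0)// ler1n. Qed.

Lemma abscissa_lt1 t : abscissa t < 1.
Proof.
rewrite /abscissa ltr_pdivrMr ?ltr0n ?mul1r ?ltr_nat; last lia.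
by rewrite addn2 !ltnS ltnW.
Qed.

Lemma abscissa_gap t t' : t != t' -> fan_step <= `|abscissa t - abscissa t'|.
Proof.
move=> tt'; rewrite -mulrBl normrM (gtr0_norm fan_step_gt0).
rewrite ler_peMl ?(ltW fan_step_gt0)//.
have : (enum_rank t : nat) != enum_rank t'.
  by apply: contra tt' => /eqP/val_inj/enum_rank_inj ->.
move: (nat_of_ord _) (nat_of_ord _) => a b; rewrite neq_lt => /orP[h|h].
  rewrite distrC; apply: le_trans (ler_norm _).
  by rewrite lerBrDr nat1r ler_nat.
apply: le_trans (ler_norm _).
by rewrite lerBrDr nat1r ler_nat.
Qed.

Lemma abscissa_sqr_lt1 t : 0 < 1 - abscissa t ^+ 2.
Proof.
have h1 := abscissa_lt1 t; have h0 := lt_le_trans fan_step_gt0 (abscissa_ge t).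
by rewrite subr_gt0 expr_lt1// ltW.
Qed.

Lemma dir_unit t : sq (dir t) = 1.
Proof. by rewrite sqE pt0 pt1 sqr_sqrtr ?(ltW (abscissa_sqr_lt1 t))// addrC subrK. Qed.

Lemma dir_indep t t' : t != t' -> dot (rot (dir t')) (dir t) != 0.
Proof.
move=> tt'; rewrite /dot !(pt0, pt1).
have a0 := lt_le_trans fan_step_gt0 (abscissa_ge t).
have a0' := lt_le_trans fan_step_gt0 (abscissa_ge t').
have b2 := sqr_sqrtr (ltW (abscissa_sqr_lt1 t)).
have b2' := sqr_sqrtr (ltW (abscissa_sqr_lt1 t')).
have gap := abscissa_gap tt'; have s0 := fan_step_gt0.
move: b2 b2'; move: (Num.sqrt (1 - abscissa t ^+ 2)) (Num.sqrt (1 - abscissa t' ^+ 2)) => b b' b2 b2'.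
move: (abscissa t) (abscissa t') a0 a0' gap b2 b2' => a a' a0 a0' gap b2 b2'.
apply/eqP => E; have Esq : (a' * b) ^+ 2 = (a * b') ^+ 2 by congr (_ ^+ 2); lra.
have : (a' - a) * (a' + a) = 0.
  by move: Esq; rewrite !exprMn b2 b2'; lra.
move/eqP; rewrite mulf_eq0 => /orP[|/eqP h]; last by lra.
by rewrite subr_eq0 => /eqP h; move: gap; rewrite h subrr normr0; lra.
Qed.

End Fan.

Section Input.
Context {R : realType} {n : nat} (u : 'I_n.+1 -> R).
Hypothesis u_incr : forall i j : 'I_n.+1, (i < j)%N -> u i < u j.

(** Levels are numbered from 1, so that level 0 and those above [n.+1] are empty;
the inputs attached to these are arbitrary up to monotonicity. *)
Definition input (k : nat) : R :=
  if k is k'.+1 then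
    if (k' <= n)%N then u (inord k') else u ord_max + (k' - n)%:R
  else u ord0 - 1.

Lemma inputE (i : 'I_n.+1) : input i.+1 = u i.
Proof. by rewrite /input -ltnS ltn_ord inord_val. Qed.

Lemma input_incr k : input k < input k.+1.
Proof.
case: k => [|k] /=.
  by rewrite (_ : inord 0 = ord0) ?gtrBl ?ltr01//; apply/val_inj; rewrite /= inordK.
case: (ltngtP k n) => kn.
- by apply: u_incr; rewrite !inordK// ltnW.
- by rewrite /= ltrD2l ltr_nat; lia.
- rewrite /= kn subSnn (_ : inord n = ord_max) ?ltrDl ?ltr01//.
  by apply/val_inj; rewrite /= inordK.
Qed.

End Input.

Section Graph.
Context {T : finType} (e : rel T) {n : nat} (S : 'I_n.+1 -> {set T}).
Hypothesis adm : admissible e S.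
Implicit Types (i j : 'I_n.+1) (s t : T) (k : nat).

Definition layer k : {set T} :=
  if (0 < k <= n.+1)%N then S (inord k.-1) else finset.set0.

(** The default value concerns only vertices that are far from the class [k]. *)
Definition neighbour k s : T :=
  if s \in layer k then s else odflt s [pick t in layer k | e s t].

Lemma layerE i : layer i.+1 = S i.
Proof. by rewrite /layer /= ltn_ord inord_val. Qed.

Lemma layerP k s : s \in layer k -> exists2 i : 'I_n.+1, k = i.+1 & s \in S i.
Proof.
rewrite /layer; case: ifP => [/andP[k0 kn] sS|]; last by rewrite finset.in_set0.
by exists (inord k.-1) => //; rewrite inordK; lia.
Qed.

Lemma S_uniq i j s : s \in S i -> s \in S j -> i = j.
Proof.
have [_ [_ disj _] _ _ _] := adm; move=> si sj; apply/eqP.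
apply: contraT => /disj/setP/(_ s).
by rewrite finset.in_setI si sj finset.in_set0.
Qed.

Lemma layer_disj k l s : s \in layer k -> s \in layer l -> k = l.
Proof. by move=> /layerP[i -> si] /layerP[j -> /(S_uniq si) ->]. Qed.

Lemma neighbour_id k s : s \in layer k -> neighbour k s = s.
Proof. by rewrite /neighbour => ->. Qed.

Definition adjacent i j := (j == i.+1 :> nat) || (i == j.+1 :> nat).

Lemma out_neighbour i j s : adjacent i j -> s \in S i ->
  exists2 t, t \in S j & forall t', t' \in S j -> e s t' = (t' == t).
Proof.
move=> ij sS; have [n1 _ mid bot top] := adm.
have only t : t \in S j -> ([set t' | e s t'] = [set t])%SET ->
    exists2 t, t \in S j & forall t', t' \in S j -> e s t' = (t' == t).
  move=> tS /setP E; exists t => // t' _.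
  by have := E t'; rewrite finset.in_set finset.in_set1.
have [i0|i0] := posnP i.
  have [t tS E] := bot i j i0 ltac:(move: ij; rewrite /adjacent i0; lia) s sS.
  exact: only tS E.
have [iN|iN] := eqVneq (i : nat) n.
  have [t tS E] := top i j iN ltac:(move: ij (ltn_ord j); rewrite /adjacent; lia) s sS.
  exact: only tS E.
have iK : (i < n)%N by have := ltn_ord i; lia.
pose a : 'I_n.+1 := inord i.-1; pose b : 'I_n.+1 := inord i.+1.
have aE : i = a.+1 :> nat by rewrite inordK; lia.
have bE : b = i.+1 :> nat by rewrite inordK; lia.
have [t [t' [tS t'S /setP E]]] := mid i a b aE bE s sS.
have edge w : e s w = (w == t) || (w == t').
  by have := E w; rewrite finset.in_set finset.in_set2.
have other (p q : 'I_n.+1) w w' : w \in S p -> w' \in S q -> p != q -> (w == w') = false.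
  by move=> wp wq; apply: contraNF => /eqP E'; rewrite E' in wp; apply/eqP/(S_uniq wp wq).
have ab : a != b by apply: contraNneq iN => /(congr1 val) /=; lia.
have [jE|jE] : j = b \/ j = a.
  by move: ij; rewrite /adjacent => /orP[/eqP|/eqP] h; [left|right]; apply: ord_inj; lia.
- exists t'; rewrite jE// => w wS; by rewrite edge (other b a w t)// eq_sym.
- exists t; rewrite jE// => w wS; by rewrite edge (other a b w t')// orbF.
Qed.

Lemma neighbourP i j s : adjacent i j -> s \in S i ->
  neighbour j.+1 s \in S j /\ forall t, t \in S j -> e s t = (t == neighbour j.+1 s).
Proof.
move=> ij sS; have [t tS tE] := out_neighbour ij sS.
have ne : s \notin S j.
  apply/negP => /(S_uniq sS) E; move: ij; rewrite E /adjacent; lia.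
suff -> : neighbour j.+1 s = t by [].
rewrite /neighbour layerE (negPf ne); case: pickP => [w /andP[wS]|none] /=.
  by rewrite tE// => /eqP.
by have := none t; rewrite tS tE// eqxx.
Qed.

Lemma layer_ne k : (0 < k <= n.+1)%N -> exists s, s \in layer k.
Proof.
move=> h; rewrite /layer h; have [_ [_ _ ne] _ _ _] := adm.
exact/set0Pn.
Qed.

Lemma neighbour_up k s : (k <= n)%N -> s \in layer k -> neighbour k.+1 s \in layer k.+1.
Proof.
move=> kn /layerP[i kE sS]; rewrite kE in kn *.
pose j : 'I_n.+1 := inord i.+1; have jE : j = i.+1 :> nat by rewrite inordK; lia.
have ij : adjacent i j by rewrite /adjacent jE eqxx.
by have [] := neighbourP ij sS; rewrite -layerE jE.
Qed.

Lemma neighbour_down k s : (0 < k <= n.+1)%N -> s \in layer k.+1 -> neighbour k s \in layer k.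
Proof.
move=> /andP[k0 kn] /layerP[i kE sS].
pose j : 'I_n.+1 := inord k.-1; have jE : k = j.+1 by rewrite inordK; lia.
have ij : adjacent i j by rewrite /adjacent; lia.
by have [] := neighbourP ij sS; rewrite -layerE -jE.
Qed.

End Graph.

Theorem theorem2p1 (R : realType) (T : finType) (e : rel T) (n : nat)
    (S : 'I_n.+1 -> {set T}) (u : 'I_n.+1 -> R) :
  admissible e S ->
  (forall i j : 'I_n.+1, (i < j)%N -> u i < u j) ->
  exists V : 'rV[R]_2 -> R -> R,
    regular_potential V /\ realization V e S u.
Proof.
move=> adm u_incr; pose L : R := (2 * #|T| + 6)%:R.
have L4 : 4 <= L by rewrite ler_nat; lia.
pose dirs := @dir R T; pose S' := layer S; pose tg := neighbour e S.
pose ux := input u; pose V := potential dirs L S' tg ux n.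
have unit : forall t, sq (dirs t) = 1 := dir_unit.
have indep : forall t t', t != t' -> dot (rot (dirs t')) (dirs t) != 0 := dir_indep.
pose del := @fan_step R T; have del0 : 0 < del := fan_step_gt0.
have range t : del <= dirs t 0 0 <= 1.
  by rewrite pt0 abscissa_ge ltW// abscissa_lt1.
have gap t t' : t != t' -> del <= `|dirs t 0 0 - dirs t' 0 0|.
  by rewrite !pt0; exact: abscissa_gap.
have disj k l s : s \in S' k -> s \in S' l -> k = l by exact: (layer_disj adm).
have stay k s : s \in S' k -> tg k s = s by exact: neighbour_id.
have incr k : ux k < ux k.+1 by exact: input_incr.
have [n1 [_ _ ne] _ _ _] := adm.
exists V; split; first exact: potential_regular.
split=> [c cI|].
  apply: (potential_coercive dirs tg del0 erefl (layer_ne adm) incr n1).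
  by rewrite -(inputE u ord0) -(inputE u ord_max) in cI.
pose X (i : 'I_n.+1) s := pos dirs L S' tg i.+1 s.
have VE (i : 'I_n.+1) : V^~ (u i) = level dirs L S' i.+1.
  by rewrite -inputE; apply: potential_lev => //; have := ltn_ord i; lia.
have Sin (i : 'I_n.+1) s : s \in S i -> s \in S' i.+1 by rewrite /S' layerE.
have XE (i : 'I_n.+1) s : s \in S i -> X i s = well L (rk S' i.+1 s).
  by move=> /Sin; exact: pos_min.
have X_inj (i : 'I_n.+1) s t : s \in S i -> t \in S i -> X i s = X i t -> s = t.
  move=> sS tS; rewrite !XE// => /(congr1 (fun z : 'rV[R]_2 => z 0 0)).
  rewrite !pt0 => /mulIf; have L0 : L != 0 by rewrite gt_eqF//; lra.
  move=> /(_ L0)/eqP; rewrite eqr_nat => /eqP.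
  by apply: rk_inj; exact: Sin.
have X_onto (i : 'I_n.+1) p : local_minima (V^~ (u i)) p -> exists2 s, s \in S i & p = X i s.
  have [s0 s0S] : exists s, s \in S i by exact/set0Pn.
  rewrite VE => /(local_min_well unit L4)[|k kN ->].
    by rewrite /card_lev /S' layerE card_gt0 ne.
  have kE : (k < size (enum (S i)))%N by rewrite -cardE -layerE.
  pose s := nth s0 (enum (S i)) k.
  have sS : s \in S i by rewrite -mem_enum mem_nth.
  by exists s; rewrite ?XE// /rk /S' layerE index_uniq ?enum_uniq.
exists X; split=> [i|i j ij p q pm qm].
  split.
  - move=> s /= sS; rewrite VE XE//; apply: well_local_min => //.
    exact: rk_lt (Sin _ _ sS).
  - by move=> s t; rewrite !inE => sS tS; exact: X_inj.
  - by move=> p /X_onto[s sS ->]; exists s.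
have [sp spS pE] := X_onto i p pm; have [sq sqS qE] := X_onto j q qm.
have ilen : (0 < i.+1 <= n)%N by have := ltn_ord j; rewrite ij; lia.
have aij : adjacent i j by rewrite /adjacent ij eqxx.
have aji : adjacent j i by rewrite /adjacent ij eqxx orbT.
have [upS upE] := neighbourP adm aij spS; have [dnS dnE] := neighbourP adm aji sqS.
have up_ k s : (k <= n)%N -> s \in S' k -> tg k.+1 s \in S' k.+1 by exact: neighbour_up.
have dn_ k s : (0 < k <= n.+1)%N -> s \in S' k.+1 -> tg k s \in S' k.
  by exact: neighbour_down.
have uE : u j = ux i.+2 by rewrite -ij -inputE.
rewrite -(inputE u i) uE; split.
- have [con uni] := up_connection unit indep del0 range gap erefl stay disj up_ incr
    ilen (Sin _ _ spS).
  split=> [|[s [t [sS tS est E1 E2]]]].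
    rewrite pE => /uni qE2; exists sp, (tg i.+2 sp); rewrite -ij; split=> //.
    by rewrite upE.
    by rewrite qE2 -ij.
  move: tS est; rewrite E1 in pE; rewrite -(X_inj _ _ _ sS spS pE) in upE con * => tS.
  by rewrite upE// E1 E2 => /eqP ->; rewrite /X ij.
- have sq' : sq \in S' i.+2 by rewrite -ij; exact: Sin.
  have [con uni] := down_connection unit indep del0 range gap erefl stay disj dn_ incr
    ilen sq'.
  split=> [|[s [t [sS tS est E1 E2]]]].
    rewrite qE /X ij => /uni pE2; exists sq, (tg i.+1 sq); split=> //.
    by rewrite dnE.
  move: tS est; rewrite E1 in qE; rewrite -(X_inj _ _ _ sS sqS qE) in dnE con * => tS.
  by rewrite dnE// E1 E2 => /eqP ->; rewrite /X ij.
Qed.
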